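(* For each positive integer $n$, the variety $\mathbb{V}(\mathbf{F}_n(\mathbb{Z}))$ generated by $\mathbf{F}_n(\mathbb{Z})$ is axiomatized relative to the variety $\mathsf{LP}_n$ of $n$-periodic $\ell$-pregroups by the equation $x\,\sigma_n(y)^n \approx \sigma_n(y)^n\, x$. That is, an $n$-periodic $\ell$-pregroup belongs to $\mathbb{V}(\mathbf{F}_n(\mathbb{Z}))$ if and only if it satisfies $x\,\sigma_n(y)^n \approx \sigma_n(y)^n\, x$.
   Context: An $\ell$-pregroup is an algebra $(A,\wedge,\vee,\cdot,1,{}^{\ell},{}^{r})$ such that $(A,\wedge,\vee)$ is a lattice, $(A,\cdot,1)$ is a monoid, multiplication is order-preserving in both arguments, and $a^{\ell}a\le 1\le aa^{\ell}$ and $aa^{r}\le 1\le a^{r}a$ for all $a\in A$. Write $x^{\ell^k}$, $x^{r^k}$ for the $k$-fold application of ${}^\ell$, ${}^r$. An $\ell$-pregroup is $n$-periodic if it satisfies $x^{\ell^n}\approx x^{r^n}$; $\mathsf{LP}_n$ is the variety of $n$-periodic $\ell$-pregroups. For $k\ge 0$ let $x^{[k]}:=x^{\ell^{2k}}$, and let $\sigma_n(x):=x\wedge x^{[1]}\wedge\dots\wedge x^{[n-1]}$. $\mathbf{F}(\mathbb{Z})$ is the $\ell$-pregroup of all order-preserving maps $f\colon\mathbb{Z}\to\mathbb{Z}$ such that $f^{-1}[\{x\}]$ is finite for every $x\in\mathbb{Z}$, with composition as multiplication, the identity map as $1$, the pointwise order, and $f^{\ell}(q)=\min\{p: q\le f(p)\}$,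 $f^{r}(q)=\max\{p: f(p)\le q\}$. $\mathbf{F}_n(\mathbb{Z})$ is the subalgebra of all $f$ with $f^{\ell^n}=f^{r^n}$; equivalently, all $f\in \mathbf{F}(\mathbb{Z})$ with $f(x+n)=f(x)+n$ for all $x\in\mathbb{Z}$. $\mathbb{V}(\mathcal{K})$ denotes the variety generated by $\mathcal{K}$. *)

(* Defs.v *)
From Stdlib Require Import ZArith List Lia.
From Stdlib Require Import Classical ClassicalEpsilon.
From Stdlib Require Import FunctionalExtensionality ProofIrrelevance.

Record algebra : Type := Algebra {
  carrier :> Type;
  meet : carrier -> carrier -> carrier;
  join : carrier -> carrier -> carrier;
  mul  : carrier -> carrier -> carrier;
  one  : carrier;
  ell  : carrier -> carrier;
  rr   : carrier -> carrier
}.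

Arguments meet {_} _ _.
Arguments join {_} _ _.
Arguments mul {_} _ _.
Arguments one {_}.
Arguments ell {_} _.
Arguments rr {_} _.

Definition le {A : algebra} (a b : A) : Prop := meet a b = a.

Record is_lattice (A : algebra) : Prop := {
  meetC : forall a b : A, meet a b = meet b a;
  meetA : forall a b c : A, meet a (meet b c) = meet (meet a b) c;
  joinC : forall a b : A, join a b = join b a;
  joinA : forall a b c : A, join a (join b c) = join (join a b) c;
  meet_joinK : forall a b : A, meet a (join a b) = a;
  join_meetK : forall a b : A, join a (meet a b) = a
}.

Record is_monoid (A : algebra) : Prop := {
  mulA : forall a b c : A, mul a (mul b c) = mul (mul a b) c;
  mul1l : forall a : A, mul one a = a;
  mul1r : forall a : A, mul a one = a
}.

Record is_lpregroup (A : algebra) : Prop := {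
  lpg_lattice : is_lattice A;
  lpg_monoid : is_monoid A;
  le_mul : forall a b c d : A, le a b -> le c d -> le (mul a c) (mul b d);
  ell_mul_le1 : forall a : A, le (mul (ell a) a) one;
  le1_mul_ell : forall a : A, le one (mul a (ell a));
  mul_rr_le1 : forall a : A, le (mul a (rr a)) one;
  le1_rr_mul : forall a : A, le one (mul (rr a) a)
}.

Definition periodic_elt {A : algebra} (n : nat) (x : A) : Prop :=
  Nat.iter n ell x = Nat.iter n rr x.

Definition LP (n : nat) (A : algebra) : Prop :=
  is_lpregroup A /\ forall x : A, periodic_elt n x.

Definition bracket {A : algebra} (k : nat) (x : A) : A := Nat.iter (2 * k) ell x.

(** [x /\ x^[1] /\ ... /\ x^[n-1]], bracketed to the left; only meaningful
    for [0 < n]. *)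
Definition sigma {A : algebra} (n : nat) (x : A) : A :=
  fold_left (fun a k => meet a (bracket k x)) (seq 1 (n - 1)) x.

Definition power {A : algebra} (x : A) (n : nat) : A := Nat.iter n (mul x) one.

Record is_hom (A B : algebra) (h : A -> B) : Prop := {
  hom_meet : forall a b, h (meet a b) = meet (h a) (h b);
  hom_join : forall a b, h (join a b) = join (h a) (h b);
  hom_mul  : forall a b, h (mul a b) = mul (h a) (h b);
  hom_one  : h one = one;
  hom_ell  : forall a, h (ell a) = ell (h a);
  hom_rr   : forall a, h (rr a) = rr (h a)
}.

Record subuniverse (A : algebra) (P : A -> Prop) : Prop := {
  sub_meet : forall a b, P a -> P b -> P (meet a b);
  sub_join : forall a b, P a -> P b -> P (join a b);
  sub_mul  : forall a b, P a -> P b -> P (mul a b);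
  sub_one  : P one;
  sub_ell  : forall a, P a -> P (ell a);
  sub_rr   : forall a, P a -> P (rr a)
}.

Definition subalgebra (A : algebra) (P : A -> Prop) (hP : subuniverse A P) : algebra := {|
  carrier := {x : A | P x};
  meet a b := exist P _ (sub_meet _ _ hP _ _ (proj2_sig a) (proj2_sig b));
  join a b := exist P _ (sub_join _ _ hP _ _ (proj2_sig a) (proj2_sig b));
  mul a b  := exist P _ (sub_mul _ _ hP _ _ (proj2_sig a) (proj2_sig b));
  one      := exist P _ (sub_one _ _ hP);
  ell a    := exist P _ (sub_ell _ _ hP _ (proj2_sig a));
  rr a     := exist P _ (sub_rr _ _ hP _ (proj2_sig a))
|}.

Definition product (I : Type) (A : I -> algebra) : algebra := {|
  carrier := forall i, A i;
  meet a b := fun i => meet (a i) (b i);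
  join a b := fun i => join (a i) (b i);
  mul a b  := fun i => mul (a i) (b i);
  one      := fun i => one;
  ell a    := fun i => ell (a i);
  rr a     := fun i => rr (a i)
|}.

Record is_variety (V : algebra -> Prop) : Prop := {
  variety_H : forall (A B : algebra) (h : A -> B),
    is_hom A B h -> (forall b, exists a, h a = b) -> V A -> V B;
  variety_S : forall (A : algebra) (P : A -> Prop) (hP : subuniverse A P),
    V A -> V (subalgebra A P hP);
  variety_P : forall (I : Type) (A : I -> algebra),
    (forall i, V (A i)) -> V (product I A)
}.

Definition generated_variety (K : algebra -> Prop) (A : algebra) : Prop :=
  forall V : algebra -> Prop,
    is_variety V -> (forall B, K B -> V B) -> V A.

Section Periodic.
Variables (A : algebra) (hA : is_lpregroup A).
Implicit Types a b c : A.

Let hL := lpg_lattice A hA.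
Let hM := lpg_monoid A hA.

Lemma le_refl a : le a a.
Proof.
  unfold le. rewrite <- (join_meetK _ hL a a) at 2. apply (meet_joinK _ hL).
Qed.

Lemma le_trans a b c : le a b -> le b c -> le a c.
Proof.
  unfold le. intros H1 H2. rewrite <- H1 at 1.
  rewrite <- (meetA _ hL), H2. exact H1.
Qed.

Lemma le_anti a b : le a b -> le b a -> a = b.
Proof. unfold le. intros H1 H2. rewrite <- H1, (meetC _ hL). exact H2. Qed.

Lemma meet_lel a b : le (meet a b) a.
Proof.
  unfold le. rewrite (meetC _ hL (meet a b)), (meetA _ hL).
  now rewrite (le_refl a).
Qed.

Lemma meet_ler a b : le (meet a b) b.
Proof. rewrite (meetC _ hL). apply meet_lel. Qed.

Lemma le_meet a b c : le c a -> le c b -> le c (meet a b).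
Proof. unfold le. intros H1 H2. now rewrite (meetA _ hL), H1. Qed.

Lemma le_joinE a b : le a b <-> join a b = b.
Proof.
  unfold le. split; intros H; rewrite <- H.
  - rewrite (joinC _ hL), (meetC _ hL). apply (join_meetK _ hL).
  - apply (meet_joinK _ hL).
Qed.

Lemma join_gel a b : le a (join a b).
Proof. apply (meet_joinK _ hL). Qed.

Lemma join_ger a b : le b (join a b).
Proof. rewrite (joinC _ hL). apply join_gel. Qed.

Lemma join_le a b c : le a c -> le b c -> le (join a b) c.
Proof.
  rewrite !le_joinE. intros H1 H2. now rewrite <- (joinA _ hL), H2.
Qed.

Lemma ell_uniq a b : le (mul b a) one -> le one (mul a b) -> b = ell a.
Proof.
  intros H1 H2. apply le_anti.
  - rewrite <- (mul1r _ hM b), <- (mul1l _ hM (ell a)).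
    apply le_trans with (mul b (mul a (ell a))).
    + apply (le_mul _ hA); [apply le_refl | apply (le1_mul_ell _ hA)].
    + rewrite (mulA _ hM). apply (le_mul _ hA); [exact H1 | apply le_refl].
  - rewrite <- (mul1r _ hM (ell a)), <- (mul1l _ hM b).
    apply le_trans with (mul (ell a) (mul a b)).
    + apply (le_mul _ hA); [apply le_refl | exact H2].
    + rewrite (mulA _ hM).
      apply (le_mul _ hA); [apply (ell_mul_le1 _ hA) | apply le_refl].
Qed.

Lemma rr_uniq a b : le (mul a b) one -> le one (mul b a) -> b = rr a.
Proof.
  intros H1 H2. apply le_anti.
  - rewrite <- (mul1l _ hM b), <- (mul1r _ hM (rr a)).
    apply le_trans with (mul (mul (rr a) a) b).
    + apply (le_mul _ hA); [apply (le1_rr_mul _ hA) | apply le_refl].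
    + rewrite <- (mulA _ hM). apply (le_mul _ hA); [apply le_refl | exact H1].
  - rewrite <- (mul1l _ hM (rr a)), <- (mul1r _ hM b).
    apply le_trans with (mul (mul b a) (rr a)).
    + apply (le_mul _ hA); [exact H2 | apply le_refl].
    + rewrite <- (mulA _ hM).
      apply (le_mul _ hA); [apply le_refl | apply (mul_rr_le1 _ hA)].
Qed.

Lemma ellK a : rr (ell a) = a.
Proof.
  symmetry. apply rr_uniq; [apply (ell_mul_le1 _ hA) | apply (le1_mul_ell _ hA)].
Qed.

Lemma rrK a : ell (rr a) = a.
Proof.
  symmetry. apply ell_uniq; [apply (mul_rr_le1 _ hA) | apply (le1_rr_mul _ hA)].
Qed.

Lemma ell_one : ell (one : A) = one.
Proof.
  symmetry. apply ell_uniq; rewrite (mul1l _ hM); apply le_refl.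
Qed.

Lemma rr_one : rr (one : A) = one.
Proof.
  symmetry. apply rr_uniq; rewrite (mul1l _ hM); apply le_refl.
Qed.

Lemma ell_mul a b : ell (mul a b) = mul (ell b) (ell a).
Proof.
  symmetry. apply ell_uniq.
  - rewrite <- (mulA _ hM), (mulA _ hM (ell a)).
    apply le_trans with (mul (ell b) (mul one b)).
    + repeat apply (le_mul _ hA); try apply le_refl. apply (ell_mul_le1 _ hA).
    + rewrite (mul1l _ hM). apply (ell_mul_le1 _ hA).
  - rewrite <- (mulA _ hM), (mulA _ hM b).
    apply le_trans with (mul a (mul one (ell a))).
    + rewrite (mul1l _ hM). apply (le1_mul_ell _ hA).
    + repeat apply (le_mul _ hA); try apply le_refl. apply (le1_mul_ell _ hA).
Qed.

Lemma rr_mul a b : rr (mul a b) = mul (rr b) (rr a).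
Proof.
  rewrite <- (rrK a) at 1. rewrite <- (rrK b) at 1.
  rewrite <- ell_mul. apply ellK.
Qed.

Lemma ell_anti a b : le a b -> le (ell b) (ell a).
Proof.
  intros H. rewrite <- (mul1r _ hM (ell b)).
  apply le_trans with (mul (ell b) (mul a (ell a))).
  - apply (le_mul _ hA); [apply le_refl | apply (le1_mul_ell _ hA)].
  - rewrite (mulA _ hM). rewrite <- (mul1l _ hM (ell a)) at 2.
    apply (le_mul _ hA); [| apply le_refl].
    apply le_trans with (mul (ell b) b).
    + apply (le_mul _ hA); [apply le_refl | exact H].
    + apply (ell_mul_le1 _ hA).
Qed.

Lemma rr_anti a b : le a b -> le (rr b) (rr a).
Proof.
  intros H. rewrite <- (mul1l _ hM (rr b)).
  apply le_trans with (mul (mul (rr a) a) (rr b)).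
  - apply (le_mul _ hA); [apply (le1_rr_mul _ hA) | apply le_refl].
  - rewrite <- (mulA _ hM). rewrite <- (mul1r _ hM (rr a)) at 2.
    apply (le_mul _ hA); [apply le_refl |].
    apply le_trans with (mul b (rr b)).
    + apply (le_mul _ hA); [exact H | apply le_refl].
    + apply (mul_rr_le1 _ hA).
Qed.

Lemma ell_meet a b : ell (meet a b) = join (ell a) (ell b).
Proof.
  apply le_anti.
  - rewrite <- (rrK (join (ell a) (ell b))). apply ell_anti, le_meet.
    + rewrite <- (ellK a) at 2. apply rr_anti, join_gel.
    + rewrite <- (ellK b) at 2. apply rr_anti, join_ger.
  - apply join_le; apply ell_anti; [apply meet_lel | apply meet_ler].
Qed.

Lemma rr_meet a b : rr (meet a b) = join (rr a) (rr b).
Proof.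
  apply le_anti.
  - rewrite <- (ellK (join (rr a) (rr b))). apply rr_anti, le_meet.
    + rewrite <- (rrK a) at 2. apply ell_anti, join_gel.
    + rewrite <- (rrK b) at 2. apply ell_anti, join_ger.
  - apply join_le; apply rr_anti; [apply meet_lel | apply meet_ler].
Qed.

Lemma ell_join a b : ell (join a b) = meet (ell a) (ell b).
Proof.
  rewrite <- (ellK a) at 1. rewrite <- (ellK b) at 1.
  rewrite <- rr_meet. apply rrK.
Qed.

Lemma rr_join a b : rr (join a b) = meet (rr a) (rr b).
Proof.
  rewrite <- (rrK a) at 1. rewrite <- (rrK b) at 1.
  rewrite <- ell_meet. apply ellK.
Qed.

Lemma iter_mul n :
  (forall a b, Nat.iter n ell (mul a b) = mul (Nat.iter n ell a) (Nat.iter n ell b) /\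
               Nat.iter n rr (mul a b) = mul (Nat.iter n rr a) (Nat.iter n rr b)) \/
  (forall a b, Nat.iter n ell (mul a b) = mul (Nat.iter n ell b) (Nat.iter n ell a) /\
               Nat.iter n rr (mul a b) = mul (Nat.iter n rr b) (Nat.iter n rr a)).
Proof.
  induction n as [|n [IH|IH]].
  - left. intros a b. split; reflexivity.
  - right. intros a b. destruct (IH a b) as [E1 E2].
    rewrite !Nat.iter_succ, E1, E2, ell_mul, rr_mul. split; reflexivity.
  - left. intros a b. destruct (IH a b) as [E1 E2].
    rewrite !Nat.iter_succ, E1, E2, ell_mul, rr_mul. split; reflexivity.
Qed.

Lemma iter_lattice n :
  (forall a b,
     (Nat.iter n ell (meet a b) = meet (Nat.iter n ell a) (Nat.iter n ell b) /\
      Nat.iter n rr (meet a b) = meet (Nat.iter n rr a) (Nat.iter n rr b)) /\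
     (Nat.iter n ell (join a b) = join (Nat.iter n ell a) (Nat.iter n ell b) /\
      Nat.iter n rr (join a b) = join (Nat.iter n rr a) (Nat.iter n rr b))) \/
  (forall a b,
     (Nat.iter n ell (meet a b) = join (Nat.iter n ell a) (Nat.iter n ell b) /\
      Nat.iter n rr (meet a b) = join (Nat.iter n rr a) (Nat.iter n rr b)) /\
     (Nat.iter n ell (join a b) = meet (Nat.iter n ell a) (Nat.iter n ell b) /\
      Nat.iter n rr (join a b) = meet (Nat.iter n rr a) (Nat.iter n rr b))).
Proof.
  induction n as [|n [IH|IH]].
  - left. intros a b. repeat split; reflexivity.
  - right. intros a b. destruct (IH a b) as [[E1 E2] [E3 E4]].
    rewrite !Nat.iter_succ, E1, E2, E3, E4, ell_meet, rr_meet, ell_join, rr_join.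
    repeat split; reflexivity.
  - left. intros a b. destruct (IH a b) as [[E1 E2] [E3 E4]].
    rewrite !Nat.iter_succ, E1, E2, E3, E4, ell_meet, rr_meet, ell_join, rr_join.
    repeat split; reflexivity.
Qed.

Lemma periodic_subuniverse n : subuniverse A (periodic_elt n).
Proof.
  unfold periodic_elt. split.
  - intros a b Ha Hb. destruct (iter_lattice n) as [H|H];
      destruct (H a b) as [[E1 E2] _]; now rewrite E1, E2, Ha, Hb.
  - intros a b Ha Hb. destruct (iter_lattice n) as [H|H];
      destruct (H a b) as [_ [E1 E2]]; now rewrite E1, E2, Ha, Hb.
  - intros a b Ha Hb. destruct (iter_mul n) as [H|H];
      destruct (H a b) as [E1 E2]; now rewrite E1, E2, Ha, Hb.
  - assert (E : forall m, Nat.iter m ell (one : A) = one /\ Nat.iter m rr (one : A) = one).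
    { induction m as [|m [E1 E2]]; [split; reflexivity|].
      rewrite !Nat.iter_succ, E1, E2. split; [apply ell_one | apply rr_one]. }
    destruct (E n) as [E1 E2]. now rewrite E1, E2.
  - intros a Ha. destruct n as [|n]; [reflexivity|].
    rewrite (Nat.iter_succ_r _ _ rr), ellK.
    rewrite <- Nat.iter_succ_r, (Nat.iter_succ (S n)), Ha.
    rewrite Nat.iter_succ. apply rrK.
  - intros a Ha. destruct n as [|n]; [reflexivity|].
    rewrite (Nat.iter_succ_r _ _ ell), rrK.
    rewrite <- Nat.iter_succ_r. rewrite (Nat.iter_succ (S n)), <- Ha.
    rewrite Nat.iter_succ. symmetry. apply ellK.
Qed.

End Periodic.

Definition in_FZ (f : Z -> Z) : Prop :=
  (forall p q, (p <= q)%Z -> (f p <= f q)%Z) /\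
  (forall x, exists s : list Z, forall p, f p = x -> In p s).

Definition is_min (P : Z -> Prop) (m : Z) : Prop := P m /\ forall p, P p -> (m <= p)%Z.
Definition is_max (P : Z -> Prop) (m : Z) : Prop := P m /\ forall p, P p -> (p <= m)%Z.

Lemma exists_min (P : Z -> Prop) (b : Z) :
  (exists p, P p) -> (forall p, P p -> (b <= p)%Z) -> exists m, is_min P m.
Proof.
  intros [p0 Hp0] Hb.
  revert Hp0. induction p0 as [p IH] using (well_founded_induction (Z.lt_wf b)).
  intros Hp. destruct (classic (exists q, (q < p)%Z /\ P q)) as [[q [Hq HPq]]|Hn].
  - exact (IH q (conj (Hb q HPq) Hq) HPq).
  - exists p. split; [exact Hp|]. intros q Hq.
    destruct (Z_lt_le_dec q p); [exfalso; eauto | assumption].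
Qed.

Lemma exists_max (P : Z -> Prop) (b : Z) :
  (exists p, P p) -> (forall p, P p -> (p <= b)%Z) -> exists m, is_max P m.
Proof.
  intros [p Hp] Hb.
  destruct (exists_min (fun p => P (- p)%Z) (- b)) as [m [Hm Hl]].
  - exists (- p)%Z. now rewrite Z.opp_involutive.
  - intros q Hq. specialize (Hb _ Hq). lia.
  - exists (- m)%Z. split; [exact Hm|]. intros q Hq.
    enough (m <= - q)%Z by lia. apply Hl. now rewrite Z.opp_involutive.
Qed.

Lemma list_bounds (s : list Z) : exists b, forall p, In p s -> (- b < p < b)%Z.
Proof.
  induction s as [|x s [b Hb]].
  - exists 0%Z. intros p [].
  - exists (Z.max b (Z.abs x + 1)). intros p [<-|Hp]; [lia|]. specialize (Hb p Hp). lia.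
Qed.

Lemma interval_list (a b : Z) : exists s, forall p, (a <= p <= b)%Z -> In p s.
Proof.
  exists (map (fun i => a + Z.of_nat i)%Z (seq 0 (Z.to_nat (b - a + 1)))).
  intros p Hp. apply in_map_iff. exists (Z.to_nat (p - a)). split; [lia|].
  apply in_seq. lia.
Qed.

Lemma FZ_unbounded_above f : in_FZ f -> forall q, exists p, (q <= f p)%Z.
Proof.
  intros [Hm Hf] q.
  assert (H : forall k, exists p, (f 0 + Z.of_nat k <= f p)%Z).
  { induction k as [|k [p Hp]]; [exists 0%Z; lia|].
    destruct (Hf (f p)) as [s Hs]. destruct (list_bounds s) as [b Hb].
    exists (Z.max p b). pose proof (Hm p (Z.max p b) ltac:(lia)).
    assert (f (Z.max p b) <> f p) by (intros E; specialize (Hb _ (Hs _ E)); lia).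
    lia. }
  destruct (H (Z.to_nat (q - f 0%Z))) as [p Hp]. exists p. lia.
Qed.

Lemma FZ_unbounded_below f : in_FZ f -> forall q, exists p, (f p <= q)%Z.
Proof.
  intros [Hm Hf] q.
  assert (H : forall k, exists p, (f p <= f 0 - Z.of_nat k)%Z).
  { induction k as [|k [p Hp]]; [exists 0%Z; lia|].
    destruct (Hf (f p)) as [s Hs]. destruct (list_bounds s) as [b Hb].
    exists (Z.min p (- b)). pose proof (Hm (Z.min p (- b)) p ltac:(lia)).
    assert (f (Z.min p (- b)) <> f p) by (intros E; specialize (Hb _ (Hs _ E)); lia).
    lia. }
  destruct (H (Z.to_nat (f 0%Z - q))) as [p Hp]. exists p. lia.
Qed.

Lemma FZ_ell_exists f (hf : in_FZ f) q : exists m, is_min (fun p => (q <= f p)%Z) m.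
Proof.
  destruct (FZ_unbounded_below f hf (q - 1)) as [b Hb].
  apply exists_min with b; [apply (FZ_unbounded_above f hf)|].
  intros p Hp. destruct (Z_lt_le_dec p b) as [H|H]; [|exact H].
  pose proof (proj1 hf p b ltac:(lia)). lia.
Qed.

Lemma FZ_rr_exists f (hf : in_FZ f) q : exists m, is_max (fun p => (f p <= q)%Z) m.
Proof.
  destruct (FZ_unbounded_above f hf (q + 1)) as [b Hb].
  apply exists_max with b; [apply (FZ_unbounded_below f hf)|].
  intros p Hp. destruct (Z_lt_le_dec b p) as [H|H]; [|exact H].
  pose proof (proj1 hf b p ltac:(lia)). lia.
Qed.

Definition FZ_ell_fun f (hf : in_FZ f) (q : Z) : Z :=
  proj1_sig (constructive_indefinite_description _ (FZ_ell_exists f hf q)).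

Definition FZ_rr_fun f (hf : in_FZ f) (q : Z) : Z :=
  proj1_sig (constructive_indefinite_description _ (FZ_rr_exists f hf q)).

Lemma FZ_ell_min f hf q : is_min (fun p => (q <= f p)%Z) (FZ_ell_fun f hf q).
Proof. exact (proj2_sig (constructive_indefinite_description _ (FZ_ell_exists f hf q))). Qed.

Lemma FZ_rr_max f hf q : is_max (fun p => (f p <= q)%Z) (FZ_rr_fun f hf q).
Proof. exact (proj2_sig (constructive_indefinite_description _ (FZ_rr_exists f hf q))). Qed.

Lemma FZ_meet_closed f g : in_FZ f -> in_FZ g -> in_FZ (fun p => Z.min (f p) (g p)).
Proof.
  intros [Hf Ff] [Hg Fg]. split.
  - intros p q H. specialize (Hf p q H). specialize (Hg p q H). lia.
  - intros x. destruct (Ff x) as [s Hs]. destruct (Fg x) as [t Ht].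
    exists (s ++ t). intros p Hp. apply in_or_app.
    destruct (Z.min_spec (f p) (g p)) as [[_ E]|[_ E]]; rewrite E in Hp; auto.
Qed.

Lemma FZ_join_closed f g : in_FZ f -> in_FZ g -> in_FZ (fun p => Z.max (f p) (g p)).
Proof.
  intros [Hf Ff] [Hg Fg]. split.
  - intros p q H. specialize (Hf p q H). specialize (Hg p q H). lia.
  - intros x. destruct (Ff x) as [s Hs]. destruct (Fg x) as [t Ht].
    exists (s ++ t). intros p Hp. apply in_or_app.
    destruct (Z.max_spec (f p) (g p)) as [[_ E]|[_ E]]; rewrite E in Hp; auto.
Qed.

Lemma FZ_comp_closed f g : in_FZ f -> in_FZ g -> in_FZ (fun p => f (g p)).
Proof.
  intros [Hf Ff] [Hg Fg]. split; [auto|].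
  intros x. destruct (Ff x) as [s Hs].
  assert (H : forall s, exists t, forall p, In (g p) s -> In p t).
  { clear s Hs. induction s as [|y s [t Ht]].
    - exists nil. intros p [].
    - destruct (Fg y) as [u Hu]. exists (u ++ t).
      intros p [E|Hp]; apply in_or_app; auto. }
  destruct (H s) as [t Ht]. exists t. auto.
Qed.

Lemma FZ_id_closed : in_FZ (fun p => p).
Proof.
  split; [auto|]. intros x. exists (x :: nil). intros p ->. now left.
Qed.

Lemma FZ_ell_closed f (hf : in_FZ f) : in_FZ (FZ_ell_fun f hf).
Proof.
  split.
  - intros p q H. apply (FZ_ell_min f hf p). pose proof (proj1 (FZ_ell_min f hf q)).
    cbv beta in *. lia.
  - intros x. destruct (interval_list (f (x - 1)%Z) (f x)) as [s Hs].
    exists s. intros p <-. apply Hs. destruct (FZ_ell_min f hf p) as [H1 H2].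
    split; [|exact H1]. destruct (Z_lt_le_dec p (f (FZ_ell_fun f hf p - 1)%Z)) as [H|H];
      [|exact H].
    specialize (H2 (FZ_ell_fun f hf p - 1)%Z). cbv beta in H2. lia.
Qed.

Lemma FZ_rr_closed f (hf : in_FZ f) : in_FZ (FZ_rr_fun f hf).
Proof.
  split.
  - intros p q H. apply (FZ_rr_max f hf q). pose proof (proj1 (FZ_rr_max f hf p)).
    cbv beta in *. lia.
  - intros x. destruct (interval_list (f x) (f (x + 1)%Z)) as [s Hs].
    exists s. intros p <-. apply Hs. destruct (FZ_rr_max f hf p) as [H1 H2].
    split; [exact H1|]. destruct (Z_lt_le_dec (f (FZ_rr_fun f hf p + 1)%Z) p) as [H|H];
      [|exact H].
    specialize (H2 (FZ_rr_fun f hf p + 1)%Z). cbv beta in H2. lia.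
Qed.

Definition FZ : algebra := {|
  carrier := {f : Z -> Z | in_FZ f};
  meet f g := exist in_FZ _ (FZ_meet_closed _ _ (proj2_sig f) (proj2_sig g));
  join f g := exist in_FZ _ (FZ_join_closed _ _ (proj2_sig f) (proj2_sig g));
  mul f g  := exist in_FZ _ (FZ_comp_closed _ _ (proj2_sig f) (proj2_sig g));
  one      := exist in_FZ _ FZ_id_closed;
  ell f    := exist in_FZ _ (FZ_ell_closed _ (proj2_sig f));
  rr f     := exist in_FZ _ (FZ_rr_closed _ (proj2_sig f))
|}.

Lemma FZ_ext (f g : FZ) : (forall p, proj1_sig f p = proj1_sig g p) -> f = g.
Proof.
  destruct f as [f hf], g as [g hg]. cbn. intros H.
  assert (f = g) by (now apply functional_extensionality). subst g.
  f_equal. apply proof_irrelevance.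
Qed.

Lemma FZ_leE (f g : FZ) : le f g <-> forall p, (proj1_sig f p <= proj1_sig g p)%Z.
Proof.
  unfold le. split.
  - intros H p. apply (f_equal (fun h : FZ => proj1_sig h p)) in H. cbn in H. lia.
  - intros H. apply FZ_ext. intros p. specialize (H p). cbn. lia.
Qed.

Lemma FZ_lpregroup : is_lpregroup FZ.
Proof.
  split.
  - split; intros; apply FZ_ext; intros p; cbn; lia.
  - split; intros; apply FZ_ext; intros p; reflexivity.
  - intros a b c d. rewrite !FZ_leE. intros H1 H2 p. cbn.
    apply Z.le_trans with (proj1_sig b (proj1_sig c p)); [apply H1|].
    apply (proj1 (proj2_sig b)), H2.
  - intros a. apply FZ_leE. intros p. cbn.
    apply (FZ_ell_min _ (proj2_sig a)). cbv beta. lia.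
  - intros a. apply FZ_leE. intros p. cbn. apply (FZ_ell_min _ (proj2_sig a)).
  - intros a. apply FZ_leE. intros p. cbn. apply (FZ_rr_max _ (proj2_sig a)).
  - intros a. apply FZ_leE. intros p. cbn.
    apply (FZ_rr_max _ (proj2_sig a)). cbv beta. lia.
Qed.

Definition FnZ (n : nat) : algebra :=
  subalgebra FZ (periodic_elt n) (periodic_subuniverse FZ FZ_lpregroup n).

(* Main.v *)
(* The invertible elements of [F_n(Z)] are translations, whose [n]-th powers commute
    with every [n]-periodic map; this gives one direction.

    Conversely let [A] be [n]-periodic with all [sigma n y ^ n] central. The lattice of
    [A] is distributive, so a failing inequality [a ≤ b] is separated by a prime filter
    [p]. In the quotient by the syntactic congruence of [p], the elements form a chain of
    points preordered by [x ⊑ y] iff [p (z x)] implies [p (z y)] for all [z], on which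
    the algebra acts by left multiplication. Centrality makes the group [U] of invertible
    elements totally ordered, abelian and free on points. Either every element is
    invertible, or some invertible [t] acts as the successor of points; then every point
    lies in the orbit of [1] under [U], so the algebra acts on the ordered abelian group
    [U], the bracket is conjugation by [t], and every [u] in [U] becomes central after
    multiplication by a power of [t].

    Finally, finitely many elements of [U] embed modulo powers of [t] into a free abelian
    group with a positive basis (Elliott), so a homomorphism [U -> Z] on a finitely
    generated subgroup, sending [t] to [1] and the basis to large multiples of [n], turns
    the action of finitely many elements into [n]-periodic maps on [Z] and the failing
    inequality into a failing one in [F_n(Z)]. *)

Require Import Defs.
From Stdlib Require Import ZArith List Lia Arith Ring.
From Stdlib Require Import Classical ClassicalEpsilon.
From Stdlib Require Import FunctionalExtensionality PropExtensionality ProofIrrelevance.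
From Stdlib Require Import Setoid Morphisms.
From mathcomp Require boolp classical_sets.

(* Prime filters of points need distributivity, which is not assumed and cannot use them. It comes
   from periodicity: a failure would give a bump, finitely many pairwise disjoint brackets whose
   join is an invertible translation, and counting powers of that translation is contradictory. On
   points only left multiplication is monotone, so a comparison at one point says little about an
   element, unless the element is central and can be moved to the other side. This is what the
   centrality of [u^n] buys. [U] may contain elements infinitely larger than [t], so its order need
   not embed in that of [Z]. With a homomorphism [τ], the maps sending [x] to [τ (a (x t))] compose
   correctly only if [a] commutes with translation by [v - (τ v) t] for the points [v] involved.
   Translations by [n t] and by suitable representatives modulo the powers of [t] do commute; hence
   a basis of such representatives, and values that are multiples of [n]. If every element is
   invertible, [U] may lack a least positive element, and a lexicographic factor [Z] supplies
   one. *)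
Declare Scope lpg_scope.
Delimit Scope lpg_scope with lpg.
Local Open Scope lpg_scope.

Notation "x ≤ y" := (le x y) (at level 70, no associativity) : lpg_scope.
Notation "x ⊓ y" := (meet x y) (at level 40, left associativity) : lpg_scope.
Notation "x ⊔ y" := (join x y) (at level 50, left associativity) : lpg_scope.
Notation "x ∙ y" := (mul x y) (at level 35, right associativity) : lpg_scope.
Notation "𝟙" := one : lpg_scope.

Existing Class is_lpregroup.
#[global] Arguments bracket : simpl never.
#[global] Arguments sigma : simpl never.
#[global] Arguments power : simpl never.

(** * Arithmetic of ℓ-pregroups: residuals, brackets, powers *)

Section Basics.
Context {A : algebra} {hA : is_lpregroup A}.
Implicit Types a b c e g h r s x y z u v w : A.

#[export] Instance le_preorder : PreOrder (@le A).
Proof. split; [exact (le_refl A hA) | exact (le_trans A hA)]. Qed.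

#[export] Instance mul_mono : Proper (le ++> le ++> le) (@mul A).
Proof. intros a b H c d H'. now apply (le_mul A hA). Qed.

#[export] Instance ell_anti_proper : Proper (le --> le) (@ell A).
Proof. intros a b H. now apply (ell_anti A hA). Qed.

#[export] Instance rr_anti_proper : Proper (le --> le) (@rr A).
Proof. intros a b H. now apply (rr_anti A hA). Qed.

Lemma le_of_eq a b : a = b -> a ≤ b.
Proof. intros ->. reflexivity. Qed.

Lemma anti a b : a ≤ b -> b ≤ a -> a = b.
Proof. apply (le_anti A hA). Qed.

Lemma meet_l a b : a ⊓ b ≤ a.
Proof. apply (meet_lel A hA). Qed.
Lemma meet_r a b : a ⊓ b ≤ b.
Proof. apply (meet_ler A hA). Qed.
Lemma meet_glb a b c : c ≤ a -> c ≤ b -> c ≤ a ⊓ b.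
Proof. apply (le_meet A hA). Qed.
Lemma join_l a b : a ≤ a ⊔ b.
Proof. apply (join_gel A hA). Qed.
Lemma join_r a b : b ≤ a ⊔ b.
Proof. apply (join_ger A hA). Qed.
Lemma join_lub a b c : a ≤ c -> b ≤ c -> a ⊔ b ≤ c.
Proof. apply (join_le A hA). Qed.

#[export] Instance meet_mono : Proper (le ++> le ++> le) (@meet A).
Proof.
  intros a b H c d H'. apply meet_glb; [rewrite meet_l | rewrite meet_r]; assumption.
Qed.

#[export] Instance join_mono : Proper (le ++> le ++> le) (@join A).
Proof.
  intros a b H c d H'. apply join_lub; [rewrite <- join_l | rewrite <- join_r]; assumption.
Qed.

Lemma meet_comm a b : a ⊓ b = b ⊓ a.
Proof. apply (meetC _ (lpg_lattice A hA)). Qed.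
Lemma join_comm a b : a ⊔ b = b ⊔ a.
Proof. apply (joinC _ (lpg_lattice A hA)). Qed.
Lemma meet_eq_l a b : a ≤ b -> a ⊓ b = a.
Proof. trivial. Qed.
Lemma join_eq_r a b : a ≤ b -> a ⊔ b = b.
Proof. apply (le_joinE A hA). Qed.

Lemma mul_assoc a b c : (a ∙ b) ∙ c = a ∙ b ∙ c.
Proof. symmetry. apply (mulA _ (lpg_monoid A hA)). Qed.
Lemma mul_1_l a : 𝟙 ∙ a = a.
Proof. apply (mul1l _ (lpg_monoid A hA)). Qed.
Lemma mul_1_r a : a ∙ 𝟙 = a.
Proof. apply (mul1r _ (lpg_monoid A hA)). Qed.

Lemma ell_l a : ell a ∙ a ≤ 𝟙.
Proof. apply (ell_mul_le1 A hA). Qed.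
Lemma ell_r a : 𝟙 ≤ a ∙ ell a.
Proof. apply (le1_mul_ell A hA). Qed.
Lemma rr_r a : a ∙ rr a ≤ 𝟙.
Proof. apply (mul_rr_le1 A hA). Qed.
Lemma rr_l a : 𝟙 ≤ rr a ∙ a.
Proof. apply (le1_rr_mul A hA). Qed.

Lemma adj_ell_l a x y : ell a ∙ x ≤ y <-> x ≤ a ∙ y.
Proof.
  split; intros H.
  - rewrite <- H, <- mul_assoc, <- ell_r, mul_1_l. reflexivity.
  - rewrite H, <- mul_assoc, ell_l, mul_1_l. reflexivity.
Qed.

Lemma adj_rr_l a x y : a ∙ x ≤ y <-> x ≤ rr a ∙ y.
Proof.
  split; intros H.
  - rewrite <- H, <- mul_assoc, <- rr_l, mul_1_l. reflexivity.
  - rewrite H, <- mul_assoc, rr_r, mul_1_l. reflexivity.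
Qed.

Lemma adj_ell_r a x y : x ∙ a ≤ y <-> x ≤ y ∙ ell a.
Proof.
  split; intros H.
  - rewrite <- H, mul_assoc, <- ell_r, mul_1_r. reflexivity.
  - rewrite H, mul_assoc, ell_l, mul_1_r. reflexivity.
Qed.

Lemma adj_rr_r a x y : x ∙ rr a ≤ y <-> x ≤ y ∙ a.
Proof.
  split; intros H.
  - rewrite <- H, mul_assoc, <- rr_l, mul_1_r. reflexivity.
  - rewrite H, mul_assoc, rr_r, mul_1_r. reflexivity.
Qed.

(** Left multiplication by [a] has the left adjoint [ell a] and so preserves meets; the next three
    lemmas use the other adjoints in the same way. *)
Lemma mul_meet_l a x y : a ∙ (x ⊓ y) = (a ∙ x) ⊓ (a ∙ y).
Proof.
  apply anti.
  - apply meet_glb; [rewrite meet_l | rewrite meet_r]; reflexivity.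
  - apply adj_ell_l. apply meet_glb; apply adj_ell_l; [apply meet_l | apply meet_r].
Qed.

Lemma mul_join_l a x y : a ∙ (x ⊔ y) = (a ∙ x) ⊔ (a ∙ y).
Proof.
  apply anti.
  - apply adj_rr_l. apply join_lub; apply adj_rr_l; [apply join_l | apply join_r].
  - apply join_lub; [rewrite <- join_l | rewrite <- join_r]; reflexivity.
Qed.

Lemma mul_meet_r a x y : (x ⊓ y) ∙ a = (x ∙ a) ⊓ (y ∙ a).
Proof.
  apply anti.
  - apply meet_glb; [rewrite meet_l | rewrite meet_r]; reflexivity.
  - apply adj_rr_r. apply meet_glb; apply adj_rr_r; [apply meet_l | apply meet_r].
Qed.

Lemma mul_join_r a x y : (x ⊔ y) ∙ a = (x ∙ a) ⊔ (y ∙ a).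
Proof.
  apply anti.
  - apply adj_ell_r. apply join_lub; apply adj_ell_r; [apply join_l | apply join_r].
  - apply join_lub; [rewrite <- join_l | rewrite <- join_r]; reflexivity.
Qed.

Lemma rr_meetE a b : rr (a ⊓ b) = rr a ⊔ rr b.
Proof. apply (rr_meet A hA). Qed.
Lemma ell_meetE a b : ell (a ⊓ b) = ell a ⊔ ell b.
Proof. apply (ell_meet A hA). Qed.
Lemma ell_joinE a b : ell (a ⊔ b) = ell a ⊓ ell b.
Proof. apply (ell_join A hA). Qed.
Lemma ell_mulE a b : ell (a ∙ b) = ell b ∙ ell a.
Proof. apply (ell_mul A hA). Qed.
Lemma rr_ell a : rr (ell a) = a.
Proof. apply (ellK A hA). Qed.
Lemma ell_rr a : ell (rr a) = a.
Proof. apply (rrK A hA). Qed.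
Lemma rr_1 : rr (𝟙 : A) = 𝟙.
Proof. apply (rr_one A hA). Qed.
Lemma ell_1 : ell (𝟙 : A) = 𝟙.
Proof. apply (ell_one A hA). Qed.

Lemma bracket_succ k x : bracket (S k) x = ell (ell (bracket k x)).
Proof. unfold bracket. replace (2 * S k) with (S (S (2 * k))) by lia. reflexivity. Qed.
Lemma bracket_0 x : bracket 0 x = x.
Proof. reflexivity. Qed.
Lemma bracket_add j k x : bracket (j + k) x = bracket j (bracket k x).
Proof. unfold bracket. rewrite <- Nat.iter_add. f_equal. lia. Qed.

Lemma bracket_meet k x y : bracket k (x ⊓ y) = bracket k x ⊓ bracket k y.
Proof.
  induction k as [|k IH]; [reflexivity|]. now rewrite !bracket_succ, IH, ell_meetE, ell_joinE.
Qed.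
Lemma bracket_join k x y : bracket k (x ⊔ y) = bracket k x ⊔ bracket k y.
Proof.
  induction k as [|k IH]; [reflexivity|]. now rewrite !bracket_succ, IH, ell_joinE, ell_meetE.
Qed.
Lemma bracket_mul k x y : bracket k (x ∙ y) = bracket k x ∙ bracket k y.
Proof.
  induction k as [|k IH]; [reflexivity|]. now rewrite !bracket_succ, IH, !ell_mulE.
Qed.
Lemma bracket_one k : bracket k (𝟙 : A) = 𝟙.
Proof. induction k as [|k IH]; [reflexivity|]. now rewrite !bracket_succ, IH, !ell_1. Qed.
Lemma bracket_rr k x : bracket k (rr x) = rr (bracket k x).
Proof.
  induction k as [|k IH]; [reflexivity|]. now rewrite !bracket_succ, IH, !ell_rr, rr_ell.
Qed.
Lemma bracket_ell k x : bracket k (ell x) = ell (bracket k x).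
Proof.
  induction k as [|k IH]; [reflexivity|]. now rewrite !bracket_succ, IH.
Qed.
#[export] Instance bracket_mono k : Proper (le ++> le) (@bracket A k).
Proof.
  induction k as [|k IH]; intros x y H; [exact H|].
  rewrite !bracket_succ. apply ell_anti_proper, ell_anti_proper, IH, H.
Qed.
Lemma power_S x k : power x (S k) = x ∙ power x k.
Proof. reflexivity. Qed.
Lemma power_add x j k : power x (j + k) = power x j ∙ power x k.
Proof.
  induction j as [|j IH]; cbn [Nat.add]; [symmetry; apply mul_1_l|].
  now rewrite !power_S, IH, mul_assoc.
Qed.
Lemma power_1 x : power x 1 = x.
Proof. apply mul_1_r. Qed.
Lemma power_S_r x k : power x (S k) = power x k ∙ x.
Proof. replace (S k) with (k + 1) by lia. now rewrite power_add, power_1. Qed.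
Lemma power_comm x y k : x ∙ y = y ∙ x -> power x k ∙ y = y ∙ power x k.
Proof.
  intros H. induction k as [|k IH]; [now rewrite mul_1_l, mul_1_r|].
  now rewrite power_S, mul_assoc, IH, <- !mul_assoc, H.
Qed.
Lemma power_mul x y k : x ∙ y = y ∙ x -> power (x ∙ y) k = power x k ∙ power y k.
Proof.
  intros H. induction k as [|k IH]; [now rewrite mul_1_l|].
  rewrite !power_S, IH, !mul_assoc. f_equal. rewrite <- !mul_assoc. f_equal.
  symmetry. now apply power_comm.
Qed.
Lemma power_one k : power (𝟙 : A) k = 𝟙.
Proof. induction k as [|k IH]; [reflexivity|]. now rewrite power_S, IH, mul_1_l. Qed.
Lemma one_le_power x k : 𝟙 ≤ x -> 𝟙 ≤ power x k.
Proof.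
  intros H. induction k as [|k IH]; [reflexivity|].
  rewrite power_S. transitivity (𝟙 ∙ 𝟙 : A); [now rewrite mul_1_l | now apply mul_mono].
Qed.
Lemma power_mono_exp x j k : 𝟙 ≤ x -> j <= k -> power x j ≤ power x k.
Proof.
  intros H Hjk. replace k with (j + (k - j)) by lia.
  rewrite power_add. transitivity (power x j ∙ 𝟙); [now rewrite mul_1_r|].
  apply mul_mono; [reflexivity | now apply one_le_power].
Qed.

(** * Invertible elements *)

Definition inv u : Prop := ell u ∙ u = 𝟙 /\ u ∙ ell u = 𝟙.

Lemma inv_of_fixed u : bracket 1 u = u -> inv u.
Proof.
  intros H. change (ell (ell u) = u) in H.
  assert (E : ell u = rr u) by (rewrite <- H at 2; now rewrite rr_ell).
  split; apply anti; try apply ell_l; try apply ell_r; rewrite E; [apply rr_l | apply rr_r].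
Qed.

Lemma inv_rr u : inv u -> rr u = ell u.
Proof. intros [H1 H2]. symmetry. apply (rr_uniq A hA); [rewrite H2 | rewrite H1]; reflexivity. Qed.

Lemma inv_intro u v : u ∙ v = 𝟙 -> v ∙ u = 𝟙 -> inv u /\ ell u = v.
Proof.
  intros H1 H2. assert (E : v = ell u) by (apply (ell_uniq A hA); [rewrite H2 | rewrite H1]; reflexivity).
  subst v. repeat split; assumption.
Qed.

Lemma inv_ell u : inv u -> inv (ell u).
Proof. intros [H1 H2]. apply (inv_intro (ell u) u H1 H2). Qed.
Lemma ell_ell_inv u : inv u -> ell (ell u) = u.
Proof. intros [H1 H2]. apply (inv_intro (ell u) u H1 H2). Qed.
Lemma inv_mul u v : inv u -> inv v -> inv (u ∙ v).
Proof.
  intros [H1 H2] [H3 H4]. apply (inv_intro _ (ell v ∙ ell u)).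
  - now rewrite mul_assoc, <- (mul_assoc v), H4, mul_1_l.
  - now rewrite mul_assoc, <- (mul_assoc (ell u)), H1, mul_1_l.
Qed.
Lemma inv_1 : inv 𝟙.
Proof. unfold inv. now rewrite ell_1, mul_1_l. Qed.
Lemma inv_power u k : inv u -> inv (power u k).
Proof. intros H. induction k; [apply inv_1|]. now apply inv_mul. Qed.
Lemma inv_bracket u k : inv u -> bracket k u = u.
Proof.
  intros H. induction k as [|k IH]; [reflexivity|]. now rewrite bracket_succ, IH, ell_ell_inv.
Qed.
Lemma inv_meet u v : inv u -> inv v -> inv (u ⊓ v).
Proof.
  intros Hu Hv. apply inv_of_fixed. now rewrite bracket_meet, !inv_bracket.
Qed.
Lemma power_ell_l u k : inv u -> power (ell u) k ∙ power u k = 𝟙.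
Proof.
  intros [E1 E2]. rewrite <- power_mul by congruence. rewrite E1. apply power_one.
Qed.
Lemma power_ell_r u k : inv u -> power u k ∙ power (ell u) k = 𝟙.
Proof.
  intros [E1 E2]. rewrite <- power_mul by congruence. rewrite E2. apply power_one.
Qed.

Lemma inv_le_l u x y : inv u -> ell u ∙ x ≤ y <-> x ≤ u ∙ y.
Proof. intros _. apply adj_ell_l. Qed.
Lemma inv_le_l' u x y : inv u -> x ≤ ell u ∙ y <-> u ∙ x ≤ y.
Proof. intros Hu. rewrite <- (inv_rr u Hu). symmetry. apply adj_rr_l. Qed.
Lemma inv_cancel_l u x y : inv u -> u ∙ x ≤ u ∙ y -> x ≤ y.
Proof.
  intros Hu H. apply (inv_le_l' u) in H; [|exact Hu]. destruct Hu as [E _].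
  now rewrite <- mul_assoc, E, mul_1_l in H.
Qed.
Lemma inv_cancel_r u x y : inv u -> x ∙ u ≤ y ∙ u -> x ≤ y.
Proof.
  intros [_ E] H. apply adj_ell_r in H. now rewrite mul_assoc, E, mul_1_r in H.
Qed.
Lemma inv_cancel_eq u x y : inv u -> u ∙ x = u ∙ y -> x = y.
Proof. intros Hu H. apply anti; apply (inv_cancel_l u); trivial; now apply le_of_eq. Qed.
Lemma inv_ell_l u x : inv u -> ell u ∙ u ∙ x = x.
Proof. intros [E _]. now rewrite <- mul_assoc, E, mul_1_l. Qed.
Lemma inv_ell_r u x : inv u -> u ∙ ell u ∙ x = x.
Proof. intros [_ E]. now rewrite <- mul_assoc, E, mul_1_l. Qed.

(** [(x ⊓ y) ∙ (x ⊓ z)] expands to a meet of four terms, each above [x ⊓ (y ∙ z)]. Before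
    distributivity is available, disjointness from a join is obtained by bounding the join by a
    product. *)
Lemma orth_mul x y z : 𝟙 ≤ x -> 𝟙 ≤ y -> 𝟙 ≤ z -> x ⊓ y = 𝟙 -> x ⊓ z = 𝟙 -> x ⊓ (y ∙ z) = 𝟙.
Proof.
  intros Hx Hy Hz E1 E2. apply anti.
  - transitivity ((x ⊓ y) ∙ (x ⊓ z)); [|now rewrite E1, E2, mul_1_l].
    rewrite mul_meet_l, !mul_meet_r. repeat apply meet_glb.
    + rewrite meet_l. transitivity (x ∙ 𝟙); [now rewrite mul_1_r | now apply mul_mono].
    + rewrite meet_l. transitivity (𝟙 ∙ x); [now rewrite mul_1_l | now apply mul_mono].
    + rewrite meet_l. transitivity (x ∙ 𝟙); [now rewrite mul_1_r | now apply mul_mono].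
    + apply meet_r.
  - apply meet_glb; [exact Hx|]. now rewrite <- Hy, <- Hz, mul_1_l.
Qed.

End Basics.

(** * Periodic l-pregroups are distributive *)

Section Sigma.
Context {A : algebra} {hA : is_lpregroup A} (n : nat) (hn : 0 < n).
Hypothesis hp : forall x : A, bracket n x = x.
Implicit Types a b c e g h r s x y z u v w : A.

Lemma bracket_mod k x : bracket (k mod n) x = bracket k x.
Proof.
  rewrite (Nat.div_mod_eq k n) at 2. generalize (k mod n). intros i.
  induction (k / n) as [|q IH]; [now rewrite Nat.mul_0_r|].
  rewrite Nat.mul_succ_r. replace (n * q + n + i) with (n + (n * q + i)) by lia.
  rewrite bracket_add, hp. exact IH.
Qed.

Lemma sigma_glb_iff c x : c ≤ sigma n x <-> forall k, k < n -> c ≤ bracket k x.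
Proof.
  assert (E : forall l b, c ≤ fold_left (fun a k => a ⊓ bracket k x) l b <->
                c ≤ b /\ forall k, In k l -> c ≤ bracket k x).
  { induction l as [|i l IH]; intros b; cbn.
    - split; [intros H; split; [exact H|contradiction] | now intros [H _]].
    - rewrite IH. split.
      + intros [H1 H2]. split; [now rewrite H1, meet_l|].
        intros k [<-|Hk]; [now rewrite H1, meet_r | auto].
      + intros [H1 H2]. split; [apply meet_glb; auto | auto]. }
  unfold sigma. rewrite E. split.
  - intros [H1 H2] [|k] Hk; [exact H1|]. apply H2, in_seq. lia.
  - intros H. split; [apply (H 0 hn)|]. intros k Hk%in_seq. apply H. lia.
Qed.

Lemma sigma_le_bracket k x : sigma n x ≤ bracket k x.
Proof.
  rewrite <- bracket_mod. apply sigma_glb_iff; [reflexivity | apply Nat.mod_upper_bound; lia].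
Qed.

Lemma sigma_le x : sigma n x ≤ x.
Proof. apply (sigma_le_bracket 0). Qed.

(** Brackets permute the terms of the meet [sigma n x] cyclically, so [bracket 1] fixes it. With
    [inv_le_sigma], it is the greatest invertible element below [x]. *)
Lemma sigma_inv x : inv (sigma n x).
Proof.
  assert (H : forall k, sigma n x ≤ bracket k (sigma n x)).
  { intros k. rewrite <- bracket_mod.
    assert (Hk : k mod n < n) by (apply Nat.mod_upper_bound; lia).
    transitivity (bracket (k mod n) (bracket (n - k mod n) (sigma n x))).
    - rewrite <- bracket_add. replace (k mod n + (n - k mod n)) with n by lia. now rewrite hp.
    - apply bracket_mono, sigma_glb_iff. intros i _.
      transitivity (bracket (n - k mod n) (bracket (i + k mod n) x)).
      + apply bracket_mono, sigma_le_bracket.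
      + rewrite <- bracket_add. replace (n - k mod n + (i + k mod n)) with (n + i) by lia.
        now rewrite bracket_add, hp. }
  apply inv_of_fixed, anti; [|apply H].
  transitivity (bracket 1 (bracket (n - 1) (sigma n x))).
  - apply bracket_mono, H.
  - rewrite <- bracket_add. replace (1 + (n - 1)) with n by lia. now rewrite hp.
Qed.

Lemma inv_le_sigma u x : inv u -> u ≤ x -> u ≤ sigma n x.
Proof.
  intros Hu H. apply sigma_glb_iff. intros k _. rewrite <- (inv_bracket u k Hu).
  now apply bracket_mono.
Qed.

(** Dual of [sigma]: unfolding the residuals gives the join of the brackets of [x]. *)
Definition sigma_up x : A := rr (sigma n (ell x)).

Lemma sigma_up_inv x : inv (sigma_up x).
Proof. unfold sigma_up. rewrite inv_rr by apply sigma_inv. apply inv_ell, sigma_inv. Qed.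

Lemma le_sigma_up x : x ≤ sigma_up x.
Proof. rewrite <- (rr_ell x) at 1. apply rr_anti_proper, sigma_le. Qed.

Lemma sigma_inv_eq u : inv u -> sigma n u = u.
Proof. intros H. apply anti; [apply sigma_le | apply inv_le_sigma; [exact H | reflexivity]]. Qed.

(** [sigma n e ∙ sigma n x] lies below every bracket of [e ∙ x = e], hence below [sigma n e], which
    cancels. *)
Lemma sigma_fix_one e x : 𝟙 ≤ x -> e ∙ x = e -> sigma n x = 𝟙.
Proof.
  intros Hx He.
  assert (H1 : 𝟙 ≤ sigma n x) by (apply inv_le_sigma; [apply inv_1 | exact Hx]).
  apply anti; [|exact H1].
  apply (inv_cancel_l (sigma n e)); [apply sigma_inv|]. rewrite mul_1_r.
  apply sigma_glb_iff. intros k _. rewrite <- He at 2. rewrite bracket_mul.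
  apply mul_mono; apply sigma_le_bracket.
Qed.

(** [r] is a nontrivial meet of as many brackets of [s] as possible. *)
Lemma exists_disjoint_or_fixed s : 𝟙 ≤ s -> s <> 𝟙 ->
  exists r, 𝟙 ≤ r /\ r ≤ s /\ r <> 𝟙 /\ forall j, bracket j r = r \/ r ⊓ bracket j r = 𝟙.
Proof.
  intros Hs Hs1.
  set (mJ := fun J => fold_right (fun j a => bracket j s ⊓ a) s J).
  assert (mJ_iff : forall J c, c ≤ mJ J <-> c ≤ s /\ forall i, In i J -> c ≤ bracket i s).
  { induction J as [|i J IH]; intros c; cbn.
    - split; [intros H; split; [exact H|contradiction] | now intros [H _]].
    - split.
      + intros H. assert (H' : c ≤ mJ J) by (rewrite H; apply meet_r).
        apply IH in H'. destruct H' as [H1 H2]. split; [exact H1|].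
        intros k [<-|Hk]; [rewrite H; apply meet_l | auto].
      + intros [H1 H2]. apply meet_glb; [auto|]. apply IH. auto. }
  set (P := fun k => exists J, NoDup J /\ (forall i, In i J -> i < n) /\ In 0 J /\
                       length J = k /\ mJ J <> 𝟙).
  assert (Hb : forall k, P k -> k <= n).
  { intros k (J & HJ & HJn & _ & <- & _).
    rewrite <- (length_seq n 0). apply NoDup_incl_length; [exact HJ|].
    intros i Hi. apply in_seq. specialize (HJn i Hi). lia. }
  assert (Hmax : exists k, P k /\ forall k', P k' -> k' <= k).
  { assert (H1 : P 1).
    { exists (0 :: nil). repeat split; auto.
      - constructor; [easy | constructor].
      - intros i [<-|[]]. exact hn.
      - now left.
      - cbn. rewrite bracket_0. now rewrite (meet_eq_l s s) by reflexivity. }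
    clear -Hb H1. assert (H : forall d k, P k -> n <= k + d -> exists k, P k /\ forall k', P k' -> k' <= k).
    { induction d as [|d IH]; intros k Hk Hd.
      - exists k. split; [exact Hk|]. intros k' Hk'. specialize (Hb k' Hk'). lia.
      - destruct (classic (exists k', P k' /\ k < k')) as [(k' & Hk' & Hlt)|Hno].
        + apply (IH k'); [exact Hk' | lia].
        + exists k. split; [exact Hk|]. intros k' Hk'.
          destruct (Nat.le_gt_cases k' k); [assumption | exfalso; eauto]. }
    apply (H n 1 H1). lia. }
  destruct Hmax as (k & (J & HJ & HJn & HJ0 & HJk & HJ1) & Hmax).
  assert (Hge : forall J, 𝟙 ≤ mJ J).
  { intros K. apply mJ_iff. split; [exact Hs|]. intros i _.
    rewrite <- (bracket_one i). now apply bracket_mono. }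
  exists (mJ J). repeat split; [apply Hge | now apply mJ_iff with J; reflexivity | exact HJ1 |].
  intros j.
  (* [K] is the union of [J] and its shift by [j]. A trivial meet over [K] makes the two brackets
     disjoint; a nontrivial one forces [K] into [J] by maximality, so [J] is closed under the
     shift. *)
  set (K := nodup Nat.eq_dec (J ++ map (fun i => (i + j) mod n) J)).
  assert (Hle : mJ J ⊓ bracket j (mJ J) ≤ mJ K).
  { apply mJ_iff. split; [rewrite meet_l; now apply mJ_iff with J; reflexivity|].
    intros i Hi%nodup_In. apply in_app_or in Hi. destruct Hi as [Hi|Hi].
    - rewrite meet_l. now apply mJ_iff with J; [reflexivity|].
    - apply in_map_iff in Hi. destruct Hi as (i' & <- & Hi'). rewrite meet_r, bracket_mod.
      replace (i' + j) with (j + i') by lia. rewrite bracket_add. apply bracket_mono.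
      now apply mJ_iff with J; [reflexivity|]. }
  destruct (classic (mJ K = 𝟙)) as [E|E].
  - right. apply anti; [now rewrite <- E|]. apply meet_glb; [apply Hge|].
    rewrite <- (bracket_one j). apply bracket_mono, Hge.
  - left.
    assert (HKJ : incl K J).
    { apply NoDup_length_incl; [exact HJ| |].
      - rewrite HJk. apply Hmax. exists K. repeat split; auto.
        + apply NoDup_nodup.
        + intros i Hi%nodup_In. apply in_app_or in Hi. destruct Hi as [Hi|Hi]; [auto|].
          apply in_map_iff in Hi. destruct Hi as (i' & <- & _). apply Nat.mod_upper_bound. lia.
        + apply nodup_In, in_or_app. now left.
      - intros i Hi. apply nodup_In, in_or_app. now left. }
    assert (Hj : mJ J ≤ bracket j (mJ J)).
    { assert (Hj : forall l c, incl l J -> c ≤ mJ J -> c ≤ bracket j (fold_right (fun j a => bracket j s ⊓ a) s l)).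
      { intros l c Hl Hc. induction l as [|i l IH]; cbn.
        - rewrite Hc. transitivity (bracket (j mod n) s); [|now rewrite bracket_mod].
          apply mJ_iff with J; [reflexivity|]. apply HKJ, nodup_In, in_or_app. right.
          apply in_map_iff. exists 0. now split.
        - rewrite bracket_meet. apply meet_glb.
          + rewrite Hc, <- bracket_add. transitivity (bracket ((i + j) mod n) s).
            * apply mJ_iff with J; [reflexivity|]. apply HKJ, nodup_In, in_or_app. right.
              apply in_map_iff. exists i. split; [reflexivity|]. apply Hl. now left.
            * rewrite bracket_mod. now replace (j + i) with (i + j) by lia.
          + apply IH. intros i' Hi'. apply Hl. now right. }
      apply Hj; [apply incl_refl | reflexivity]. }
    apply anti; [|exact Hj].
    (* Iterating [n] times closes the chain of inequalities, because [bracket (n * j)] is the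
       identity. *)
    assert (Hi : forall i, bracket j (mJ J) ≤ bracket (j + i * j) (mJ J)).
    { induction i as [|i IH]; [now rewrite Nat.add_0_r|].
      rewrite IH. replace (j + S i * j) with ((j + i * j) + j) by lia.
      rewrite (bracket_add (j + i * j) j). now apply bracket_mono. }
    rewrite (Hi (n - 1)). replace (j + (n - 1) * j) with (n * j) by nia.
    rewrite <- bracket_mod, Nat.mul_comm, Nat.Div0.mod_mul. reflexivity.
Qed.

(** [m] is the least positive period of the element from [exists_disjoint_or_fixed], so the earlier
    brackets do not fix it and must be disjoint from it. Period [1] would put [r] below every
    bracket of [s], hence below [sigma n s = 𝟙]. *)
Lemma exists_bump s : 𝟙 ≤ s -> s <> 𝟙 -> sigma n s = 𝟙 ->
  exists r m, 2 <= m /\ 𝟙 ≤ r /\ r ≤ s /\ r <> 𝟙 /\ bracket m r = r /\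
    forall j, 0 < j < m -> r ⊓ bracket j r = 𝟙.
Proof.
  intros Hs Hs1 Hsig. destruct (exists_disjoint_or_fixed s Hs Hs1) as (r & Hr & Hrs & Hr1 & Hj).
  assert (Hex : exists m, (0 < m /\ bracket m r = r) /\
            forall j, 0 < j /\ bracket j r = r -> m <= j).
  { assert (H : forall k, 0 < k /\ bracket k r = r ->
              exists m, (0 < m /\ bracket m r = r) /\ forall j, 0 < j /\ bracket j r = r -> m <= j).
    { induction k as [k IH] using (well_founded_induction lt_wf). intros Hk.
      destruct (classic (exists j, j < k /\ 0 < j /\ bracket j r = r)) as [(j & Hlt & Hj')|Hno].
      - apply (IH j Hlt Hj').
      - exists k. split; [exact Hk|]. intros j Hj'.
        destruct (Nat.le_gt_cases k j); [assumption | exfalso; eauto]. }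
    apply (H n). split; [exact hn | apply hp]. }
  destruct Hex as (m & [Hm Hmr] & Hmin). exists r, m. repeat split; trivial.
  - destruct (Nat.eq_dec m 1) as [->|]; [|lia]. exfalso. apply Hr1, anti; [|exact Hr].
    rewrite <- Hsig.
    assert (E : forall k, bracket k r = r).
    { induction k as [|k IH]; [reflexivity|]. replace (S k) with (k + 1) by lia.
      rewrite bracket_add, Hmr. exact IH. }
    apply sigma_glb_iff. intros k _. rewrite <- (E k) at 1. now apply bracket_mono.
  - intros j [H1 H2]. destruct (Hj j) as [E|E]; [|exact E].
    specialize (Hmin j (conj H1 E)). lia.
Qed.

End Sigma.

(** The model to keep in mind: in [F_n(Z)], [r x = x + 1] if [m] divides [x] and
    [r x = x] otherwise. Then [R j] moves [x = j] mod [m] one step up, [D j] moves it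
    one step down, [bump_t] is [x + 1], and [PP 1 (m - 1)] and [PP 2 (m - 1)] round [x]
    down to the nearest number congruent to [0], resp. [1], modulo [m]. *)
Section Bump.
Context {A : algebra} {hA : is_lpregroup A} (r : A) (m : nat).
Hypothesis hm : 2 <= m.
Hypothesis r_pos : 𝟙 ≤ r.
Hypothesis r_per : bracket m r = r.
Hypothesis r_orth : forall j, 0 < j < m -> r ⊓ bracket j r = 𝟙.
Implicit Types x y z : A.

Notation R j := (bracket j r).
Notation D j := (rr (bracket j r)).

Lemma R_pos j : 𝟙 ≤ R j.
Proof. rewrite <- (bracket_one j). now apply bracket_mono. Qed.

Lemma D_le1 j : D j ≤ 𝟙.
Proof. rewrite <- rr_1. apply rr_anti_proper, R_pos. Qed.

Lemma D_ell j : D (S j) = ell (R j).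
Proof. now rewrite bracket_succ, rr_ell. Qed.

Lemma R_shift j : R (j + m) = R j.
Proof. now rewrite bracket_add, r_per. Qed.

Lemma R_orth i j : i < j < i + m -> R i ⊓ R j = 𝟙.
Proof.
  intros H. replace j with (i + (j - i)) by lia.
  rewrite bracket_add, <- bracket_meet, r_orth by lia. apply bracket_one.
Qed.

Lemma D_orth i j : i < j < i + m -> D i ⊔ D j = 𝟙.
Proof. intros H. now rewrite <- rr_meetE, R_orth, rr_1. Qed.

(** [𝟙] is written as [D j ⊔ D (S j)], and the first summand is absorbed since
    [R j ∙ D j ≤ 𝟙 ≤ R j ∙ D (S j)]. The same device proves [D_R]. *)
Lemma R_D j : R j ∙ D (S j) = R j.
Proof.
  transitivity (R j ∙ (D j ⊔ D (S j))); [|now rewrite D_orth, mul_1_r by lia].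
  rewrite mul_join_l, join_eq_r; [reflexivity|].
  rewrite rr_r, D_ell. apply ell_r.
Qed.

Lemma D_R j : D j ∙ R j = R j.
Proof.
  transitivity ((D j ⊔ D (S j)) ∙ R j); [|now rewrite D_orth, mul_1_l by lia].
  rewrite mul_join_r, join_comm, join_eq_r; [reflexivity|].
  rewrite <- rr_l, D_ell. apply ell_l.
Qed.

Lemma D_S_R j : D (S j) ∙ R j = D (S j).
Proof.
  rewrite D_ell. rewrite <- (D_R j) at 3. now rewrite ell_mulE, ell_rr.
Qed.

Lemma R_R j : R j ∙ R j ≤ R j.
Proof. rewrite <- (R_D j) at 1. rewrite mul_assoc, D_ell, ell_l, mul_1_r. reflexivity. Qed.

(** By [D_orth] the hypothesis holds unless [j = l + 1] modulo [m]. *)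
Lemma R_R_le j l : D j ⊔ D (S l) = 𝟙 -> R j ∙ R l ≤ R l ∙ R j.
Proof.
  intros H. transitivity (R j ⊔ R l).
  - apply adj_ell_r. rewrite <- D_ell.
    rewrite mul_join_r, R_D. transitivity (R j ∙ (D j ⊔ D (S l))).
    + now rewrite H, mul_1_r.
    + rewrite mul_join_l. apply join_lub; [|apply join_l].
      rewrite rr_r, (R_pos l). apply join_r.
  - apply join_lub.
    + transitivity (𝟙 ∙ R j); [now rewrite mul_1_l|].
      apply mul_mono; [apply R_pos | reflexivity].
    + transitivity (R l ∙ 𝟙); [now rewrite mul_1_r|].
      apply mul_mono; [reflexivity | apply R_pos].
Qed.

Lemma D_R_le i j : D j ⊔ D (S i) = 𝟙 -> D (S i) ∙ R j ≤ R j ∙ D (S i).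
Proof.
  intros H. rewrite D_ell. apply adj_ell_l. rewrite <- mul_assoc. apply adj_ell_r.
  now apply R_R_le.
Qed.

Fixpoint bigjoin (f : nat -> A) k : A :=
  match k with 0 => f 0 | S k => bigjoin f k ⊔ f (S k) end.

Lemma bigjoin_ub f k i : i <= k -> f i ≤ bigjoin f k.
Proof.
  induction k as [|k IH]; intros Hi; cbn.
  - now replace i with 0 by lia.
  - destruct (Nat.eq_dec i (S k)) as [->|]; [apply join_r|].
    rewrite IH by lia. apply join_l.
Qed.

Lemma bigjoin_lub f k x : (forall i, i <= k -> f i ≤ x) -> bigjoin f k ≤ x.
Proof.
  induction k as [|k IH]; intros H; cbn; [now apply H|].
  apply join_lub; [apply IH|]; intros; apply H; lia.
Qed.

Lemma bracket_bigjoin i f k : bracket i (bigjoin f k) = bigjoin (fun j => bracket i (f j)) k.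
Proof.
  induction k as [|k IH]; cbn; [reflexivity|]. now rewrite bracket_join, IH.
Qed.

Definition bump_t : A := bigjoin (fun j => R j) (m - 1).
(** In the model, [bump_c] fixes the multiples of [m] and moves every other number one step up. *)
Definition bump_c : A := bigjoin (fun j => R (S j)) (m - 2).
Notation t := bump_t.
Notation c := bump_c.

Lemma t_eq : t = r ⊔ c.
Proof.
  apply anti.
  - apply bigjoin_lub. intros [|i] Hi; [apply join_l|].
    transitivity c; [|apply join_r].
    apply (bigjoin_ub (fun j => R (S j))). lia.
  - apply join_lub.
    + apply (bigjoin_ub (fun j => R j) (m - 1) 0). lia.
    + apply bigjoin_lub. intros i Hi.
      apply (bigjoin_ub (fun j => R j) (m - 1) (S i)). lia.
Qed.

Lemma R_le_t j : j < m -> R j ≤ t.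
Proof. intros H. apply (bigjoin_ub (fun j => R j)). lia. Qed.

Lemma t_fixed : bracket 1 t = t.
Proof.
  unfold bump_t at 1. rewrite bracket_bigjoin. apply anti; apply bigjoin_lub; intros i Hi.
  - rewrite <- bracket_add. destruct (Nat.eq_dec (1 + i) m) as [->|].
    + rewrite r_per. apply (R_le_t 0). lia.
    + apply R_le_t. lia.
  - destruct i as [|i].
    + transitivity (bracket 1 (R (m - 1))).
      * rewrite <- bracket_add. replace (1 + (m - 1)) with m by lia. now rewrite r_per.
      * apply (bigjoin_ub (fun j => bracket 1 (R j))). lia.
    + transitivity (bracket 1 (R i)); [now rewrite <- bracket_add|].
      apply (bigjoin_ub (fun j => bracket 1 (R j))). lia.
Qed.

Lemma t_inv : inv t.
Proof. apply inv_of_fixed, t_fixed. Qed.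

Lemma t_bracket j : bracket j t = t.
Proof. apply inv_bracket, t_inv. Qed.

Lemma r_le_t : r ≤ t.
Proof. apply (R_le_t 0). lia. Qed.

Lemma t_pos : 𝟙 ≤ t.
Proof. rewrite r_pos. apply r_le_t. Qed.

Lemma c_pos : 𝟙 ≤ c.
Proof.
  rewrite (R_pos 1). apply (bigjoin_ub (fun j => R (S j)) (m - 2) 0). lia.
Qed.

(** The join [bump_c] is bounded by the product of its terms, which [orth_mul] makes disjoint from
    [r]. *)
Lemma r_orth_c : r ⊓ c = 𝟙.
Proof.
  assert (H : forall k, k <= m - 2 -> exists y, 𝟙 ≤ y /\ r ⊓ y = 𝟙 /\
            bigjoin (fun j => R (S j)) k ≤ y).
  { induction k as [|k IH]; intros Hk.
    - exists (R 1). repeat split; [apply R_pos | apply r_orth; lia | cbn; reflexivity].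
    - destruct IH as (y & Hy & Hry & Hky); [lia|].
      exists (y ∙ R (S (S k))). repeat split.
      + transitivity (𝟙 ∙ 𝟙 : A); [now rewrite mul_1_l|]. apply mul_mono; [exact Hy | apply R_pos].
      + apply orth_mul; trivial; [apply R_pos | apply r_orth; lia].
      + cbn [bigjoin]. apply join_lub.
        * rewrite Hky. transitivity (y ∙ 𝟙); [now rewrite mul_1_r|].
          apply mul_mono; [reflexivity | apply R_pos].
        * transitivity (𝟙 ∙ R (S (S k))); [now rewrite mul_1_l|].
          apply mul_mono; [exact Hy | reflexivity]. }
  destruct (H (m - 2)) as (y & Hy & Hry & Hcy); [lia|].
  apply anti.
  - rewrite <- Hry. apply meet_glb; [apply meet_l|]. rewrite meet_r. exact Hcy.
  - apply meet_glb; [exact r_pos | apply c_pos].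
Qed.

Lemma c_D : c ∙ D 0 = c.
Proof.
  transitivity (c ∙ (D 0 ⊔ rr c)); [|now rewrite bracket_0, <- rr_meetE, r_orth_c, rr_1, mul_1_r].
  rewrite mul_join_l, join_comm, join_eq_r; [reflexivity|].
  rewrite rr_r. transitivity (R (m - 1) ∙ D m).
  - replace (D m) with (D (S (m - 1))) by (do 2 f_equal; lia). rewrite R_D. apply R_pos.
  - rewrite r_per, bracket_0. apply mul_mono; [|reflexivity].
    replace (m - 1) with (S (m - 2)) by lia. now apply (bigjoin_ub (fun j => R (S j))).
Qed.

Lemma D_c : D 1 ∙ c = c.
Proof.
  transitivity ((D 1 ⊔ ell c) ∙ c).
  - rewrite mul_join_r, join_comm, join_eq_r; [reflexivity|].
    rewrite ell_l, (R_pos 1), <- (D_R 1) at 1. apply mul_mono; [reflexivity|].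
    apply (bigjoin_ub (fun j => R (S j)) (m - 2) 0). lia.
  - rewrite (D_ell 0), bracket_0, <- ell_meetE, r_orth_c, ell_1. apply mul_1_l.
Qed.

Lemma t_D0 : t ∙ D 0 = c.
Proof.
  rewrite t_eq, mul_join_r, c_D. apply join_eq_r.
  rewrite bracket_0, rr_r. apply c_pos.
Qed.

Lemma D1_t : D 1 ∙ t = c.
Proof.
  rewrite t_eq, mul_join_l, D_c. apply join_eq_r.
  rewrite (D_ell 0), bracket_0, ell_l. apply c_pos.
Qed.

(** Both sides equal [bracket j bump_c]. Thus conjugation by [t] shifts the index of [D]. *)
Lemma D_t j : D (S j) ∙ t = t ∙ D j.
Proof.
  transitivity (bracket j (D 1 ∙ t)).
  - rewrite bracket_mul, bracket_rr, <- bracket_add, t_bracket. now replace (j + 1) with (S j) by lia.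
  - rewrite D1_t, <- t_D0, bracket_mul, bracket_rr, <- bracket_add, t_bracket.
    now rewrite Nat.add_0_r.
Qed.

Lemma D_power_t j k : D (j + k) ∙ power t k = power t k ∙ D j.
Proof.
  induction k as [|k IH].
  - rewrite Nat.add_0_r. unfold power. cbn. now rewrite mul_1_l, mul_1_r.
  - rewrite power_S, Nat.add_succ_r, <- mul_assoc, D_t, !mul_assoc. now rewrite IH.
Qed.

Fixpoint PP a l : A := match l with 0 => 𝟙 | S l => D a ∙ PP (S a) l end.

Lemma PP_snoc l : forall a, PP a (S l) = PP a l ∙ D (a + l).
Proof.
  induction l as [|l IH]; intros a.
  - cbn [PP]. now rewrite mul_1_l, mul_1_r, Nat.add_0_r.
  - change (D a ∙ PP (S a) (S l) = (D a ∙ PP (S a) l) ∙ D (a + S l)).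
    rewrite IH, mul_assoc. now replace (S a + l) with (a + S l) by lia.
Qed.

Lemma PP_le1 l : forall a, PP a l ≤ 𝟙.
Proof.
  induction l as [|l IH]; intros a; cbn; [reflexivity|].
  rewrite IH, mul_1_r. apply D_le1.
Qed.

(** In the model, rounding down sends [j] and [j + 1] to the same number. [R j] moves left past the
    last factors until it meets [D (S j)], which absorbs it; [l <= m - 1] keeps [j] distinct modulo
    [m] from the indices it passes. *)
Lemma PP_absorb l a j : a <= S j < a + l -> l <= m - 1 -> PP a l ∙ R j = PP a l.
Proof.
  induction l as [|l IH]; intros H Hl; [lia|].
  rewrite PP_snoc, mul_assoc. destruct (Nat.eq_dec (S j) (a + l)) as [E|E].
  - now rewrite <- E, D_S_R.
  - apply anti.
    + replace (a + l) with (S (a + l - 1)) by lia. rewrite D_R_le.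
      * rewrite <- mul_assoc, IH by lia. reflexivity.
      * replace (S (a + l - 1)) with (a + l) by lia. apply D_orth. lia.
    + apply mul_mono; [reflexivity|].
      transitivity (D (a + l) ∙ 𝟙); [now rewrite mul_1_r|].
      apply mul_mono; [reflexivity | apply R_pos].
Qed.

Lemma ellt_le_D j : ell t ≤ D j.
Proof.
  rewrite <- (inv_rr t t_inv). apply rr_anti_proper.
  rewrite <- (t_bracket j). apply bracket_mono, r_le_t.
Qed.

Lemma PP_ge l : forall a, power (ell t) l ≤ PP a l.
Proof.
  induction l as [|l IH]; intros a; [reflexivity|].
  rewrite power_S. cbn [PP]. apply mul_mono; [apply ellt_le_D | apply IH].
Qed.

Notation α := (PP 2 (m - 1)).
Notation β := (PP 1 (m - 1)).
Notation γ := (PP 2 (m - 2)).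

Lemma bracket_PP l : forall i a, bracket i (PP a l) = PP (a + i) l.
Proof.
  induction l as [|l IH]; intros i a; cbn [PP]; [apply bracket_one|].
  rewrite bracket_mul, bracket_rr, <- bracket_add, IH.
  now replace (i + a) with (a + i) by lia.
Qed.

(** In the model, adding [1] and then stepping back from multiples of [m] stays within a block from
    [k m] to [k m + m - 1], where [β] is constant. *)
Lemma β_D_t : β ∙ D m ∙ t = β.
Proof.
  replace (D m) with (D (S (m - 1))) by (do 2 f_equal; lia).
  transitivity (β ∙ bracket (m - 1) c).
  - f_equal. rewrite D_t, <- t_D0, bracket_mul, bracket_rr, t_bracket, <- bracket_add.
    now rewrite Nat.add_0_r.
  - unfold bump_c. rewrite bracket_bigjoin. apply anti.
    + apply adj_rr_l. apply bigjoin_lub. intros i Hi. apply adj_rr_l.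
      rewrite <- bracket_add. replace (m - 1 + S i) with (i + m) by lia.
      rewrite R_shift, PP_absorb by lia. reflexivity.
    + transitivity (β ∙ 𝟙); [now rewrite mul_1_r|]. apply mul_mono; [reflexivity|].
      transitivity (bracket (m - 1) (R 1)).
      * rewrite <- bracket_add. apply R_pos.
      * apply (bigjoin_ub (fun j => bracket (m - 1) (R (S j))) (m - 2) 0). lia.
Qed.

Lemma α_D_t : α ∙ D 1 ∙ t = α.
Proof.
  pose proof (f_equal (bracket 1) β_D_t) as H.
  rewrite !bracket_mul, !bracket_PP, bracket_rr, r_per, t_bracket in H. exact H.
Qed.

Lemma α_PP k : α ∙ PP 1 k ∙ power t k = α.
Proof.
  induction k as [|k IH].
  - unfold power. cbn. now rewrite !mul_1_r.
  - rewrite PP_snoc, power_S_r, mul_assoc, <- (mul_assoc (D (1 + k))), D_power_t, mul_assoc.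
    rewrite <- (mul_assoc (PP 1 k)), <- (mul_assoc α), IH. apply α_D_t.
Qed.

(** In the model, [β] rounds down to some [k m], and [α] lowers this by [m - 1] more. *)
Lemma αβ_le : α ∙ β ≤ power (ell t) (m - 1).
Proof.
  apply (inv_cancel_r (power t (m - 1))); [apply inv_power, t_inv|].
  rewrite mul_assoc, α_PP, power_ell_l by apply t_inv. apply PP_le1.
Qed.

Lemma αrβ : α ∙ r ∙ β = γ ∙ r ∙ γ.
Proof.
  replace (m - 1) with (S (m - 2)) by lia. rewrite PP_snoc.
  cbn [PP]. rewrite mul_assoc. f_equal.
  replace (2 + (m - 2)) with m by lia. rewrite r_per.
  pose proof (D_R 0) as E1. pose proof (R_D 0) as E2. rewrite bracket_0 in E1, E2.
  now rewrite <- (mul_assoc (rr r)), E1, <- mul_assoc, E2.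
Qed.

Lemma γrγ : γ ∙ r ∙ γ = γ ∙ r.
Proof.
  apply anti; [rewrite PP_le1 at 2; now rewrite mul_1_r|].
  assert (H : forall k, k <= m - 2 -> γ ∙ r ≤ (γ ∙ r) ∙ PP 2 k).
  { induction k as [|k IH]; intros Hk; [cbn; now rewrite mul_1_r|].
    rewrite PP_snoc, <- mul_assoc, <- IH by lia.
    change (2 + k) with (S (S k)). rewrite (D_ell (S k)). apply (proj1 (adj_ell_r _ _ _)).
    assert (E : r ∙ R (S k) ≤ R (S k) ∙ r) by (apply (R_R_le 0), D_orth; lia).
    rewrite mul_assoc, E, <- mul_assoc, PP_absorb by lia. reflexivity. }
  rewrite <- mul_assoc. now apply H.
Qed.

(** In the model, [r] sends [k m] to [k m + 1], which [α] fixes, so the total drop is at most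
    [m - 2]. The gain of one power of [t] over [αβ_le] drives [le1_join_meet_join]. *)
Lemma αrβ_ge : power (ell t) (m - 2) ≤ α ∙ r ∙ β.
Proof.
  rewrite αrβ, γrγ, <- r_pos, mul_1_r. apply PP_ge.
Qed.

Lemma αrβ_le_r : α ∙ r ∙ β ≤ r.
Proof. rewrite !PP_le1, mul_1_l, mul_1_r. reflexivity. Qed.

(** Each [D (S a)] is [ell (R a)], so the factors of [γ] move one by one to the other side, giving
    [r ≤ R (m - 2) ∙ … ∙ R 1], a product disjoint from [r]. *)
Lemma αrβ_le1 : α ∙ r ∙ β ≤ 𝟙 -> r = 𝟙.
Proof.
  rewrite αrβ, γrγ. intros H. apply anti; [|exact r_pos].
  assert (Hl : forall l a z, 1 <= a -> a + l <= m -> 𝟙 ≤ z -> r ⊓ z = 𝟙 ->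
             PP (S a) l ∙ r ≤ z -> r ≤ 𝟙).
  { induction l as [|l IH]; intros a z Ha Hal Hz Hrz H'.
    - cbn in H'. rewrite mul_1_l in H'. rewrite <- Hrz. now apply meet_glb.
    - cbn [PP] in H'. rewrite mul_assoc, D_ell in H'. apply adj_ell_l in H'.
      apply (IH (S a) (R a ∙ z)); trivial; try lia.
      + transitivity (𝟙 ∙ 𝟙 : A); [now rewrite mul_1_l|]. now apply mul_mono; [apply R_pos|].
      + apply orth_mul; trivial; [apply R_pos | apply r_orth; lia]. }
  apply (Hl (m - 2) 1 𝟙); trivial; try lia; [reflexivity|].
  apply anti; [apply meet_r | now apply meet_glb].
Qed.

End Bump.

(** * The distributive law *)

Section Distributive.
Context {A : algebra} {hA : is_lpregroup A} (n : nat) (hn : 0 < n).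
Hypothesis hp : forall x : A, bracket n x = x.
Implicit Types a b c e g h r s x y z u v w : A.

(** If the meet is not [1], there is a bump [r] below both joins. For [u ≤ 1] the map
    [W x = u ∙ f ∙ x ∙ f'] is deflationary, so [W 1 ≤ e] implies [W r ≤ e]. As
    [f ∙ f' ≤ t^(1-m)] while [f ∙ r ∙ f' ≥ t^(2-m)], choosing [u] as large as
    [W 1 ≤ e] allows forces [f ∙ r ∙ f' ≤ 1], hence [r = 1]. *)
Lemma le1_join_meet_join g h : g ⊓ h ≤ 𝟙 -> (𝟙 ⊔ g) ⊓ (𝟙 ⊔ h) = 𝟙.
Proof.
  intros He. set (e := g ⊓ h) in *. set (s := (𝟙 ⊔ g) ⊓ (𝟙 ⊔ h)).
  assert (Hs : 𝟙 ≤ s) by (apply meet_glb; apply join_l).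
  apply NNPP. intros Hs1.
  assert (Hrre : 𝟙 ≤ rr e) by (rewrite <- rr_1; now apply rr_anti_proper).
  assert (Hse : s ≤ rr e ∙ e).
  { assert (H : forall x, e ≤ x -> 𝟙 ⊔ x ≤ rr e ∙ x).
    { intros x Hx. apply join_lub.
      - rewrite (rr_l e). now apply mul_mono.
      - transitivity (𝟙 ∙ x); [now rewrite mul_1_l | now apply mul_mono]. }
    transitivity ((rr e ∙ g) ⊓ (rr e ∙ h)); [|now rewrite <- mul_meet_l].
    apply meet_mono; apply H; [apply meet_l | apply meet_r]. }
  assert (Hes : e ∙ s = e).
  { apply anti.
    - rewrite Hse, <- mul_assoc, rr_r, mul_1_l. reflexivity.
    - transitivity (e ∙ 𝟙); [now rewrite mul_1_r | now apply mul_mono]. }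
  destruct (exists_bump n hn hp s Hs Hs1 (sigma_fix_one n hn hp e s Hs Hes))
    as (r & m & hm & Hr & Hrs & Hr1 & Hper & Horth).
  set (t := bump_t r m). set (f := PP r 2 (m - 1)). set (f' := PP r 1 (m - 1)).
  assert (Ht : inv t) by now apply t_inv.
  assert (Hf : f ≤ 𝟙) by now apply PP_le1.
  assert (Hf' : f' ≤ 𝟙) by now apply PP_le1.
  assert (key : forall u, u ≤ 𝟙 -> u ∙ f ∙ f' ≤ e -> u ∙ f ∙ r ∙ f' ≤ e).
  { intros u Hu H.
    assert (Hx : forall x, r ≤ 𝟙 ⊔ x -> e ≤ x -> u ∙ f ∙ r ∙ f' ≤ x).
    { intros x Hrx Hex. rewrite Hrx, mul_join_r, !mul_join_l. apply join_lub.
      - now rewrite mul_1_l, H.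
      - rewrite Hu, Hf, Hf', !mul_1_l, mul_1_r. reflexivity. }
    apply meet_glb; apply Hx.
    - rewrite Hrs. apply meet_l.
    - apply meet_l.
    - rewrite Hrs. apply meet_r.
    - apply meet_r. }
  (* [w] is the largest invertible element with [w ∙ t^(1-m) ≤ e]; truncating it at [𝟙] gives a [u]
     to which [key] applies. *)
  set (v := sigma n e).
  assert (Hv : inv v) by now apply sigma_inv.
  set (w := v ∙ power t (m - 1)).
  assert (Hw : inv w) by (apply inv_mul; [exact Hv | now apply inv_power]).
  set (u := 𝟙 ⊓ w).
  assert (Hu : inv u) by (apply inv_meet; [apply inv_1 | exact Hw]).
  assert (H1 : u ∙ f ∙ r ∙ f' ≤ e).
  { apply key; [apply meet_l|]. unfold u. rewrite meet_r. unfold w.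
    unfold f, f', t. rewrite αβ_le by assumption.
    rewrite mul_assoc, power_ell_r, mul_1_r by assumption. now apply sigma_le. }
  assert (H2 : u ∙ t ≤ w).
  { assert (H : u ∙ power (ell t) (m - 2) ≤ v).
    { apply inv_le_sigma; trivial.
      - apply inv_mul; [exact Hu | now apply inv_power, inv_ell].
      - rewrite <- H1. apply mul_mono; [reflexivity|]. now apply αrβ_ge. }
    unfold w. rewrite <- H. replace (m - 1) with (S (m - 2)) by lia.
    rewrite power_S_r, mul_assoc, <- (mul_assoc (power (ell t) _)), power_ell_l, mul_1_l by assumption.
    reflexivity. }
  assert (H3 : t ≤ 𝟙 ⊔ w).
  { assert (H : (ell w ⊓ 𝟙) ∙ t ≤ 𝟙).
    { apply (inv_cancel_l w); [exact Hw|]. rewrite mul_1_r. transitivity (u ∙ t); [|exact H2].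
      rewrite <- mul_assoc, mul_meet_l. destruct Hw as [_ ->]. now rewrite mul_1_r. }
    rewrite <- (rr_ell w), <- rr_1, join_comm, <- rr_meetE. apply adj_rr_l in H.
    now rewrite mul_1_r in H. }
  (* [q] is the inverse of [u], and [(𝟙 ⊔ w) ⊓ q = (w ∙ q) ⊓ q = u ∙ q = 𝟙]. Both [t] and [q] turn
     out to bound [f ∙ r ∙ f']. *)
  set (q := 𝟙 ⊔ ell w).
  assert (Hq : ell u = q) by (unfold u, q; now rewrite ell_meetE, ell_1).
  assert (H4 : t ⊓ q ≤ 𝟙).
  { assert (E : 𝟙 ⊔ w = w ∙ q).
    { unfold q. rewrite mul_join_l, mul_1_r. destruct Hw as [_ ->]. apply join_comm. }
    rewrite H3, E. transitivity (u ∙ q).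
    - unfold u. rewrite mul_meet_r, mul_1_l, meet_comm. reflexivity.
    - rewrite <- Hq. destruct Hu as [_ ->]. reflexivity. }
  apply Hr1. apply (αrβ_le1 r m); trivial.
  rewrite <- H4. apply meet_glb.
  - rewrite αrβ_le_r by assumption. now apply r_le_t.
  - rewrite <- Hq, <- (mul_1_r (ell u)). apply (inv_le_l' u); [exact Hu|]. now rewrite <- He.
Qed.

(** Right multiplication by [rr b] turns comparison with [b] into comparison with [𝟙], where
    [le1_join_meet_join] applies. Two cuts give distributivity. *)
Lemma cut_law a b c : c ≤ a ⊔ b -> a ⊓ c ≤ b -> c ≤ b.
Proof.
  intros H1 H2.
  assert (E : (𝟙 ⊔ (a ∙ rr b)) ⊓ (𝟙 ⊔ (c ∙ rr b)) = 𝟙).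
  { apply le1_join_meet_join. rewrite <- mul_meet_r, H2. apply rr_r. }
  rewrite <- (mul_1_l b). apply adj_rr_r. rewrite <- E. apply meet_glb; [|apply join_r].
  rewrite H1 at 1. rewrite mul_join_r. apply join_lub; [apply join_r|].
  rewrite rr_r. apply join_l.
Qed.

Lemma meet_join_distr a b c : a ⊓ (b ⊔ c) ≤ (a ⊓ b) ⊔ (a ⊓ c).
Proof.
  apply (cut_law b).
  - apply (cut_law c).
    + rewrite meet_r, join_comm. apply join_mono; [reflexivity | apply join_l].
    + transitivity (a ⊓ c).
      * apply meet_glb; [rewrite meet_r; apply meet_l | apply meet_l].
      * transitivity ((a ⊓ b) ⊔ (a ⊓ c)); apply join_r.
  - transitivity (a ⊓ b); [|apply join_l].
    apply meet_glb; [rewrite meet_r; apply meet_l | apply meet_l].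
Qed.

End Distributive.

(** * Prime filters and quotients *)

Lemma zorn_inclusion (X : Type) (F : (X -> Prop) -> Prop) (p0 : X -> Prop) :
  F p0 ->
  (forall C : (X -> Prop) -> Prop, (exists p, C p) -> (forall p, C p -> F p) ->
     (forall p q, C p -> C q -> (forall x, p x -> q x) \/ (forall x, q x -> p x)) ->
     F (fun x => exists p, C p /\ p x)) ->
  exists p, F p /\ forall q, F q -> (forall x, p x -> q x) -> forall x, q x -> p x.
Proof.
  intros H0 Hch.
  set (T := {p : X -> Prop | F p}).
  set (R := fun p q : T => boolp.asbool (forall x, proj1_sig p x -> proj1_sig q x)).
  assert (HR : forall p q : T, is_true (R p q) <-> forall x, proj1_sig p x -> proj1_sig q x).
  { intros p q. split; [exact (@boolp.asboolW _) | exact (@boolp.asboolT _)]. }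
  destruct (@classical_sets.Zorn T R) as [[p Hp] Hmax].
  - intros p. now apply HR.
  - intros p q r H1 H2. apply HR. intros x Hx.
    now apply (proj1 (HR _ _) H2), (proj1 (HR _ _) H1).
  - intros [p Hp] [q Hq] H1 H2. pose proof (proj1 (HR _ _) H1) as H1'.
    pose proof (proj1 (HR _ _) H2) as H2'. cbn in H1', H2'.
    assert (p = q) as <-.
    { apply functional_extensionality. intros x. apply propositional_extensionality. split; auto. }
    f_equal. apply proof_irrelevance.
  - intros C Htot. destruct (classic (exists p, C p)) as [[p1 Hp1]|Hno].
    + set (C' := fun p : X -> Prop => exists H : F p, C (exist F p H)).
      assert (HF : F (fun x => exists p, C' p /\ p x)).
      { apply Hch.
        - destruct p1 as [p1 H1]. exists p1. now exists H1.
        - now intros p [H _].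
        - intros p q [Hp Hp'] [Hq Hq'].
          destruct (Htot _ _ Hp' Hq') as [H|H]; [left|right]; exact (proj1 (HR _ _) H). }
      exists (exist F _ HF). intros [q Hq] HCq. apply HR. cbn. intros x Hx.
      exists q. split; [now exists Hq | exact Hx].
    (* The union of the empty chain need not satisfy [F], so [p0] serves as its bound. *)
    + exists (exist F p0 H0). intros q Hq. exfalso. eauto.
  - exists p. split; [exact Hp|]. intros q Hq Hpq.
    assert (E : exist F q Hq = exist F p Hp) by (apply Hmax, HR; exact Hpq).
    apply (f_equal (@proj1_sig _ _)) in E. cbn in E. now subst q.
Qed.

Record prime_filter {A : algebra} (p : A -> Prop) : Prop := {
  pf_up : forall x y, x ≤ y -> p x -> p y;
  pf_meet : forall x y, p x -> p y -> p (x ⊓ y);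
  pf_join : forall x y, p (x ⊔ y) -> p x \/ p y
}.

Lemma exists_prime_filter {A : algebra} {hA : is_lpregroup A} (a b : A) :
  (forall x y z : A, x ⊓ (y ⊔ z) ≤ (x ⊓ y) ⊔ (x ⊓ z)) -> ~ a ≤ b ->
  exists p : A -> Prop, prime_filter p /\ p a /\ ~ p b.
Proof.
  intros Hd Hab.
  set (F := fun p : A -> Prop => (forall x y, x ≤ y -> p x -> p y) /\
              (forall x y, p x -> p y -> p (x ⊓ y)) /\ p a /\ ~ p b).
  destruct (zorn_inclusion A F (fun x => a ≤ x)) as (p & (Hup & Hme & Ha & Hb) & Hmax).
  - repeat split; [now intros x y -> | intros; now apply meet_glb | reflexivity | exact Hab].
  - intros C [p0 Hp0] HF Htot. repeat split.
    + intros x y Hxy (p & Hp & Hx). exists p. split; [exact Hp|].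
      now apply (proj1 (HF p Hp)) with x.
    + intros x y (p & Hp & Hx) (q & Hq & Hy). destruct (Htot p q Hp Hq) as [H|H].
      * exists q. split; [exact Hq|]. apply (HF q Hq); auto.
      * exists p. split; [exact Hp|]. apply (HF p Hp); auto.
    + exists p0. split; [exact Hp0 | apply (HF p0 Hp0)].
    + intros (p & Hp & Hpb). now apply (HF p Hp).
  - exists p. repeat split; trivial. intros x y Hxy.
    assert (Hext : forall z, ~ p z -> exists s, p s /\ s ⊓ z ≤ b).
    { intros z Hz. apply NNPP. intros Hno. apply Hz.
      apply (Hmax (fun w => exists s, p s /\ s ⊓ z ≤ w)).
      - repeat split.
        + intros w w' Hw (s & Hs & H). exists s. split; [exact Hs|]. now rewrite H.
        + intros w w' (s & Hs & H) (s' & Hs' & H'). exists (s ⊓ s'). split; [now apply Hme|].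
          apply meet_glb; [rewrite <- H | rewrite <- H']; apply meet_mono;
            reflexivity || apply meet_l || apply meet_r.
        + exists a. split; [exact Ha | apply meet_l].
        + exact Hno.
      - intros w Hw. exists w. split; [exact Hw | apply meet_l].
      - exists a. split; [exact Ha | apply meet_r]. }
    apply NNPP. intros Hno.
    destruct (Hext x) as (s & Hs & Hsx); [tauto|].
    destruct (Hext y) as (s' & Hs' & Hsy); [tauto|].
    apply Hb, Hup with ((s ⊓ s') ⊓ (x ⊔ y)); [|now repeat apply Hme].
    rewrite Hd. apply join_lub; [rewrite <- Hsx | rewrite <- Hsy]; apply meet_mono;
      reflexivity || apply meet_l || apply meet_r.
Qed.

(** * The class defined by the equation and its closure under quotients *)

Definition central_var (n : nat) (A : algebra) : Prop :=
  LP n A /\ forall x y : A, x ∙ power (sigma n y) n = power (sigma n y) n ∙ x.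

Section Hom.
Context {A B : algebra} (h : A -> B) (hh : is_hom A B h).

Lemma hom_iter_ell k x : h (Nat.iter k ell x) = Nat.iter k ell (h x).
Proof. induction k as [|k IH]; [reflexivity|]. rewrite !Nat.iter_succ. now rewrite (hom_ell _ _ _ hh), IH. Qed.
Lemma hom_iter_rr k x : h (Nat.iter k rr x) = Nat.iter k rr (h x).
Proof. induction k as [|k IH]; [reflexivity|]. rewrite !Nat.iter_succ. now rewrite (hom_rr _ _ _ hh), IH. Qed.
Lemma hom_bracket k x : h (bracket k x) = bracket k (h x).
Proof. apply hom_iter_ell. Qed.
Lemma hom_sigma n x : h (sigma n x) = sigma n (h x).
Proof.
  assert (E : forall l b, h (fold_left (fun a k => a ⊓ bracket k x) l b) =
                fold_left (fun a k => a ⊓ bracket k (h x)) l (h b)).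
  { induction l as [|k l IH]; intros b; [reflexivity|].
    cbn. now rewrite IH, (hom_meet _ _ _ hh), hom_bracket. }
  apply E.
Qed.
Lemma hom_power k x : h (power x k) = power (h x) k.
Proof.
  induction k as [|k IH]; [apply (hom_one _ _ _ hh)|]. unfold power in *. rewrite !Nat.iter_succ.
  now rewrite (hom_mul _ _ _ hh), IH.
Qed.
Lemma hom_le x y : x ≤ y -> h x ≤ h y.
Proof. unfold le. intros H. now rewrite <- (hom_meet _ _ _ hh), H. Qed.

Lemma hom_image_lpregroup : (forall b, exists a, h a = b) -> is_lpregroup A -> is_lpregroup B.
Proof.
  intros Hs hA.
  assert (HL : is_lattice B).
  { destruct (lpg_lattice A hA) as [E1 E2 E3 E4 E5 E6].
    split.
    - intros a b. destruct (Hs a) as [a' <-], (Hs b) as [b' <-].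
      rewrite <- !(hom_meet _ _ _ hh). now rewrite E1.
    - intros a b c. destruct (Hs a) as [a' <-], (Hs b) as [b' <-], (Hs c) as [c' <-].
      rewrite <- !(hom_meet _ _ _ hh). now rewrite E2.
    - intros a b. destruct (Hs a) as [a' <-], (Hs b) as [b' <-].
      rewrite <- !(hom_join _ _ _ hh). now rewrite E3.
    - intros a b c. destruct (Hs a) as [a' <-], (Hs b) as [b' <-], (Hs c) as [c' <-].
      rewrite <- !(hom_join _ _ _ hh). now rewrite E4.
    - intros a b. destruct (Hs a) as [a' <-], (Hs b) as [b' <-].
      rewrite <- (hom_join _ _ _ hh), <- (hom_meet _ _ _ hh). now rewrite E5.
    - intros a b. destruct (Hs a) as [a' <-], (Hs b) as [b' <-].
      rewrite <- (hom_meet _ _ _ hh), <- (hom_join _ _ _ hh). now rewrite E6. }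
  split; [exact HL| | | | | |].
  - destruct (lpg_monoid A hA) as [E1 E2 E3]. split.
    + intros a b c. destruct (Hs a) as [a' <-], (Hs b) as [b' <-], (Hs c) as [c' <-].
      rewrite <- !(hom_mul _ _ _ hh). now rewrite E1.
    + intros a. destruct (Hs a) as [a' <-].
      rewrite <- (hom_one _ _ _ hh), <- (hom_mul _ _ _ hh). now rewrite E2.
    + intros a. destruct (Hs a) as [a' <-].
      rewrite <- (hom_one _ _ _ hh), <- (hom_mul _ _ _ hh). now rewrite E3.
  - assert (Hlift : forall x y : B, x ≤ y -> exists x' y', x' ≤ y' /\ h x' = x /\ h y' = y).
    { intros x y H. destruct (Hs x) as [x' <-], (Hs y) as [y' <-].
      exists (x' ⊓ y'), y'. split; [apply meet_r|]. split; [|reflexivity].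
      rewrite (hom_meet _ _ _ hh). exact H. }
    intros a b c d H1 H2.
    destruct (Hlift a b H1) as (a' & b' & Hab & <- & <-).
    destruct (Hlift c d H2) as (c' & d' & Hcd & <- & <-).
    rewrite <- !(hom_mul _ _ _ hh). now apply hom_le, mul_mono.
  - intros a. destruct (Hs a) as [a' <-].
    rewrite <- (hom_ell _ _ _ hh), <- (hom_mul _ _ _ hh), <- (hom_one _ _ _ hh).
    apply hom_le, ell_l.
  - intros a. destruct (Hs a) as [a' <-].
    rewrite <- (hom_ell _ _ _ hh), <- (hom_mul _ _ _ hh), <- (hom_one _ _ _ hh).
    apply hom_le, ell_r.
  - intros a. destruct (Hs a) as [a' <-].
    rewrite <- (hom_rr _ _ _ hh), <- (hom_mul _ _ _ hh), <- (hom_one _ _ _ hh).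
    apply hom_le, rr_r.
  - intros a. destruct (Hs a) as [a' <-].
    rewrite <- (hom_rr _ _ _ hh), <- (hom_mul _ _ _ hh), <- (hom_one _ _ _ hh).
    apply hom_le, rr_l.
Qed.

Lemma hom_image_central_var n :
  (forall b, exists a, h a = b) -> central_var n A -> central_var n B.
Proof.
  intros Hs [[HA Hper] Hc]. split; [split|].
  - now apply hom_image_lpregroup.
  - intros b. destruct (Hs b) as [a <-]. unfold periodic_elt.
    rewrite <- hom_iter_ell, <- hom_iter_rr. f_equal. apply Hper.
  - intros x y. destruct (Hs x) as [x' <-], (Hs y) as [y' <-].
    rewrite <- hom_sigma, <- hom_power, <- !(hom_mul _ _ _ hh). now rewrite Hc.
Qed.

End Hom.

Section Quotient.
Context {A : algebra} (θ : A -> A -> Prop).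
Hypothesis θ_equiv : Equivalence θ.
Hypothesis θ_meet : Proper (θ ==> θ ==> θ) meet.
Hypothesis θ_join : Proper (θ ==> θ ==> θ) join.
Hypothesis θ_mul : Proper (θ ==> θ ==> θ) mul.
Hypothesis θ_ell : Proper (θ ==> θ) ell.
Hypothesis θ_rr : Proper (θ ==> θ) rr.

Let Q : Type := {P : A -> Prop | exists a, P = θ a}.
Let cls (a : A) : Q := exist _ (θ a) (ex_intro _ a eq_refl).
Let rep (X : Q) : A := proj1_sig (constructive_indefinite_description _ (proj2_sig X)).

Lemma cls_eq a b : θ a b -> cls a = cls b.
Proof.
  intros H. unfold cls.
  assert (E : θ a = θ b).
  { apply functional_extensionality. intros x. apply propositional_extensionality.
    now rewrite H. }
  revert H. generalize (ex_intro (fun a0 => θ a = θ a0) a eq_refl). rewrite E. intros e _.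
  f_equal. apply proof_irrelevance.
Qed.

Lemma rep_cls a : θ (rep (cls a)) a.
Proof.
  unfold rep. destruct (constructive_indefinite_description _ _) as [b Hb]. cbn in *.
  rewrite <- Hb. reflexivity.
Qed.

Lemma cls_rep X : cls (rep X) = X.
Proof.
  destruct X as [P [a ->]]. apply cls_eq. apply rep_cls.
Qed.

Lemma exists_quotient : exists (B : algebra) (h : A -> B),
  is_hom A B h /\ (forall b, exists a, h a = b) /\ forall a b, h a = h b <-> θ a b.
Proof.
  exists {| carrier := Q;
       meet X Y := cls (meet (rep X) (rep Y));
       join X Y := cls (join (rep X) (rep Y));
       mul X Y := cls (mul (rep X) (rep Y));
       one := cls one;
       ell X := cls (ell (rep X));
       rr X := cls (rr (rep X)) |}, cls.
  split; [split; cbn; intros; try reflexivity; apply cls_eq; now rewrite !rep_cls|]. split.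
  - intros b. exists (rep b). apply cls_rep.
  - intros a b. split; [|apply cls_eq]. intros H.
    rewrite <- (rep_cls a), H. apply rep_cls.
Qed.

End Quotient.

(** * The syntactic quotient of a prime filter *)

Definition reduced {A : algebra} (p : A -> Prop) : Prop :=
  forall a b : A, (forall z x, p (z ∙ a ∙ x) -> p (z ∙ b ∙ x)) -> a ≤ b.

Lemma exists_reduced_quotient (n : nat) (A : algebra) (p : A -> Prop) :
  central_var n A -> prime_filter p ->
  exists (B : algebra) (h : A -> B) (q : B -> Prop), is_hom A B h /\ central_var n B /\
    prime_filter q /\ reduced q /\ forall a, q (h a) <-> p a.
Proof.
  intros HV [Hup Hme Hjo]. pose proof (proj1 (proj1 HV)) as hA.
  set (L := fun a b : A => forall z x, p (z ∙ a ∙ x) -> p (z ∙ b ∙ x)).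
  set (θ := fun a b => L a b /\ L b a).
  (* Insert [b ∙ ell b ≥ 𝟙], replace this [b] by [a], and delete [ell a ∙ a ≤ 𝟙]. So residuals
     reverse [L], and [θ] is a congruence. *)
  assert (L_ell : forall a b, L a b -> L b a -> L (ell a) (ell b)).
  { intros a b H1 H2 z x H.
    apply Hup with ((z ∙ ell a) ∙ a ∙ (ell b ∙ x)).
    - rewrite mul_assoc, <- !(mul_assoc (ell a)), ell_l, mul_1_l. reflexivity.
    - apply H2. apply Hup with (z ∙ ell a ∙ x); [|exact H].
      rewrite mul_assoc, <- (mul_assoc b), <- ell_r, mul_1_l. reflexivity. }
  assert (L_rr : forall a b, L a b -> L b a -> L (rr a) (rr b)).
  { intros a b H1 H2 z x H.
    apply Hup with ((z ∙ rr b) ∙ a ∙ (rr a ∙ x)).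
    - rewrite mul_assoc, <- (mul_assoc a), rr_r, mul_1_l. reflexivity.
    - apply H2. apply Hup with (z ∙ rr a ∙ x); [|exact H].
      rewrite mul_assoc, <- !(mul_assoc (rr b)), <- rr_l, mul_1_l. reflexivity. }
  assert (L_trans : forall a b c, L a b -> L b c -> L a c) by (unfold L; auto).
  destruct (exists_quotient θ) as (B & h & Hh & Hs & Hker).
  - split; [split; unfold L; auto | intros a b [H1 H2]; now split |
            intros a b c [H1 H2] [H3 H4]; split; eauto].
  - assert (L_meet : forall a b c d, L a b -> L c d -> L (a ⊓ c) (b ⊓ d)).
    { intros a b c d H1 H2 z x. rewrite !mul_meet_r, !mul_meet_l. intros H.
      apply Hme; [apply H1 | apply H2]; revert H; apply Hup; [apply meet_l | apply meet_r]. }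
    intros a b [H1 H2] c d [H3 H4]. split; auto.
  - assert (L_join : forall a b c d, L a b -> L c d -> L (a ⊔ c) (b ⊔ d)).
    { intros a b c d H1 H2 z x. rewrite !mul_join_r, !mul_join_l. intros H.
      apply Hjo in H. destruct H as [H|H]; [apply H1 in H | apply H2 in H];
        revert H; apply Hup; [apply join_l | apply join_r]. }
    intros a b [H1 H2] c d [H3 H4]. split; auto.
  - assert (L_mul : forall a b c d, L a b -> L c d -> L (a ∙ c) (b ∙ d)).
    { intros a b c d H1 H2 z x H. rewrite mul_assoc in *. apply H1 in H.
      rewrite <- mul_assoc in *. apply H2 in H. exact H. }
    intros a b [H1 H2] c d [H3 H4]. split; auto.
  - intros a b [H1 H2]. split; auto.
  - intros a b [H1 H2]. split; auto.
  - assert (HB : central_var n B) by now apply (hom_image_central_var h Hh).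
    pose proof (proj1 (proj1 HB)) as hB.
    set (q := fun X => exists a, h a = X /\ p a).
    assert (Hq : forall a, q (h a) <-> p a).
    { intros a. split; [|intros H; now exists a]. intros (b & E & Hb).
      apply Hker in E. destruct E as [E _]. specialize (E 𝟙 𝟙).
      rewrite !mul_1_l, !mul_1_r in E. auto. }
    exists B, h, q. split; [exact Hh|]. split; [exact HB|]. split; [split | split; [|exact Hq]].
    + intros x y H. destruct (Hs x) as [x' <-], (Hs y) as [y' <-]. rewrite <- H.
      rewrite <- (hom_meet _ _ _ Hh), !Hq. apply Hup, meet_r.
    + intros x y. destruct (Hs x) as [x' <-], (Hs y) as [y' <-].
      rewrite <- (hom_meet _ _ _ Hh), !Hq. apply Hme.
    + intros x y. destruct (Hs x) as [x' <-], (Hs y) as [y' <-].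
      rewrite <- (hom_join _ _ _ Hh), !Hq. apply Hjo.
    + intros x y. destruct (Hs x) as [x' <-], (Hs y) as [y' <-]. intros H.
      unfold le. rewrite <- (hom_meet _ _ _ Hh). apply Hker.
      assert (HL : L x' y').
      { intros z w. specialize (H (h z) (h w)). rewrite <- !(hom_mul _ _ _ Hh), !Hq in H. exact H. }
      split.
      * intros z w. apply Hup. now rewrite meet_l.
      * intros z w Hz. rewrite mul_meet_r, mul_meet_l. auto.
Qed.

(** * The chain of points of a reduced prime filter *)

Section Points.
Context {A : algebra} {hA : is_lpregroup A} (n : nat) (hn : 0 < n).
Hypothesis hp : forall x : A, bracket n x = x.
Hypothesis hc : forall x y : A, x ∙ power (sigma n y) n = power (sigma n y) n ∙ x.
Context (p : A -> Prop).
Hypothesis pf : prime_filter p.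
Hypothesis red : reduced p.
Implicit Types a b c f g x y z u v w : A.

Definition ptle x y : Prop := forall z, p (z ∙ x) -> p (z ∙ y).
Notation "x ⊑ y" := (ptle x y) (at level 70, no associativity).

#[local] Instance ptle_preorder : PreOrder ptle.
Proof. split; [intros x z; trivial | intros x y z H1 H2 w H; auto]. Qed.

Lemma ptle_le x y : x ≤ y -> x ⊑ y.
Proof. intros H z. apply (pf_up p pf). now apply mul_mono. Qed.

Lemma ptle_mul a x y : x ⊑ y -> a ∙ x ⊑ a ∙ y.
Proof. intros H z. rewrite <- !mul_assoc. apply H. Qed.

Lemma ptle_meet x y z : z ⊑ x -> z ⊑ y -> z ⊑ x ⊓ y.
Proof. intros H1 H2 w H. rewrite mul_meet_l. apply (pf_meet p pf); auto. Qed.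

Lemma ptle_join x y z : x ⊑ z -> y ⊑ z -> x ⊔ y ⊑ z.
Proof.
  intros H1 H2 w. rewrite mul_join_l. intros H.
  destruct (pf_join p pf _ _ H); auto.
Qed.

(** Total because [z x ⊓ w y ≤ (z ⊔ w) (x ⊓ y) ≤ z y ⊔ w x]. *)
Lemma ptle_total x y : x ⊑ y \/ y ⊑ x.
Proof.
  apply NNPP. intros Hno. apply not_or_and in Hno. destruct Hno as [H1 H2].
  apply not_all_ex_not in H1. destruct H1 as [z Hz].
  apply not_all_ex_not in H2. destruct H2 as [w Hw].
  assert (H : p ((z ∙ y) ⊔ (w ∙ x))).
  { apply (pf_up p pf) with ((z ∙ x) ⊓ (w ∙ y)).
    - transitivity ((z ⊔ w) ∙ (x ⊓ y)).
      + rewrite mul_meet_l. apply meet_mono; apply mul_mono; try reflexivity;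
          [apply join_l | apply join_r].
      + rewrite mul_join_r. apply join_mono; apply mul_mono; try reflexivity;
          [apply meet_r | apply meet_l].
    - apply (pf_meet p pf); tauto. }
  destruct (pf_join p pf _ _ H); tauto.
Qed.

Lemma ptle_adj_rr a x y : a ∙ x ⊑ y <-> x ⊑ rr a ∙ y.
Proof.
  split; intros H.
  - transitivity (rr a ∙ a ∙ x); [|now apply ptle_mul].
    apply ptle_le, adj_rr_l. reflexivity.
  - transitivity (a ∙ rr a ∙ y); [now apply ptle_mul|].
    apply ptle_le, adj_rr_l. reflexivity.
Qed.

Lemma ptle_adj_ell a x y : ell a ∙ x ⊑ y <-> x ⊑ a ∙ y.
Proof. pose proof (ptle_adj_rr (ell a) x y) as H. now rewrite rr_ell in H. Qed.

Lemma le_of_ptle a b : (forall x, a ∙ x ⊑ b ∙ x) -> a ≤ b.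
Proof. intros H. apply red. intros z x. apply H. Qed.

(** * Central and invertible elements acting on points *)

Definition central c : Prop := forall x, c ∙ x = x ∙ c.

(** Centrality turns [c ∙ x] into [x ∙ c], so the comparison at the point [𝟙] is carried to every
    point by left multiplication. *)
Lemma central_le1 c : central c -> c ⊑ 𝟙 -> c ≤ 𝟙.
Proof.
  intros Hc H. apply le_of_ptle. intros x. rewrite mul_1_l, Hc.
  transitivity (x ∙ 𝟙); [now apply ptle_mul | now rewrite mul_1_r].
Qed.

Lemma central_1le c : central c -> 𝟙 ⊑ c -> 𝟙 ≤ c.
Proof.
  intros Hc H. apply le_of_ptle. intros x. rewrite mul_1_l, Hc.
  transitivity (x ∙ 𝟙); [now rewrite mul_1_r | now apply ptle_mul].
Qed.

Lemma power_central u : inv u -> central (power u n).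
Proof. intros Hu x. rewrite <- (sigma_inv_eq n hn hp u Hu). symmetry. apply hc. Qed.

Lemma ptle_power u x k : u ∙ x ⊑ x -> power u k ∙ x ⊑ x.
Proof.
  intros H. induction k as [|k IH]; [now apply ptle_le, le_of_eq, mul_1_l|].
  rewrite power_S, mul_assoc. transitivity (u ∙ x); [now apply ptle_mul | exact H].
Qed.

Lemma ptle_cancel u x y : inv u -> u ∙ x ⊑ u ∙ y -> x ⊑ y.
Proof.
  intros Hu H. apply (ptle_mul (ell u)) in H. now rewrite !inv_ell_l in H.
Qed.

Lemma ptlt_power u x k : inv u -> 0 < k -> u ∙ x ⊑ x -> x ⊑ power u k ∙ x -> x ⊑ u ∙ x.
Proof.
  intros Hu Hk H1 H2. destruct k as [|k]; [lia|]. rewrite power_S, mul_assoc in H2.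
  transitivity (u ∙ power u k ∙ x); [exact H2|]. now apply ptle_mul, ptle_power.
Qed.

Lemma one_le_inv_of_power u : inv u -> 𝟙 ≤ power u n -> 𝟙 ≤ u.
Proof.
  intros Hu H. apply le_of_ptle. intros x. rewrite mul_1_l.
  destruct (ptle_total x (u ∙ x)) as [H1|H1]; [exact H1|].
  apply (ptlt_power u x n Hu hn H1). apply ptle_le.
  transitivity (𝟙 ∙ x); [now rewrite mul_1_l | now apply mul_mono].
Qed.

(** The central element [power u n] is comparable with [𝟙]. At each point [x], the comparison of [x]
    with [u ∙ x] cannot contradict that with [power u n ∙ x]. *)
Lemma inv_total u : inv u -> 𝟙 ≤ u \/ u ≤ 𝟙.
Proof.
  intros Hu. destruct (ptle_total 𝟙 (power u n)) as [H|H].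
  - left. apply one_le_inv_of_power, central_1le; trivial. now apply power_central.
  - right. apply central_le1 in H; [|now apply power_central].
    assert (H1 : 𝟙 ≤ ell u).
    { apply one_le_inv_of_power; [now apply inv_ell|].
      apply (inv_cancel_l (power u n)); [now apply inv_power|].
      now rewrite power_ell_r, mul_1_r. }
    apply (mul_mono u u (le_refl A hA u)) in H1. destruct Hu as [_ E].
    now rewrite E, mul_1_r in H1.
Qed.

Lemma inv_total2 u v : inv u -> inv v -> u ≤ v \/ v ≤ u.
Proof.
  intros Hu Hv. destruct (inv_total (ell u ∙ v)) as [H|H].
  - apply inv_mul; [now apply inv_ell | exact Hv].
  - left. apply (inv_le_l' u) in H; [|exact Hu]. now rewrite mul_1_r in H.
  - right. apply (inv_le_l u) in H; [|exact Hu]. now rewrite mul_1_r in H.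
Qed.

(** If [power c N] were not below [ell (ell g)], totality would give [𝟙 ⊑ ell g ∙ power c N], while
    [power c (S N) ⊑ g] gives [c ∙ ell g ∙ power c N ⊑ 𝟙]; together [c ⊑ 𝟙]. Each bracket costs one
    power, so all powers are kept in the hypothesis. *)
Lemma ptle_bracket_of_central c f k :
  central c -> inv c -> ~ c ≤ 𝟙 -> (forall N, power c N ⊑ f) -> forall N, power c N ⊑ bracket k f.
Proof.
  intros Hc Hci Hc1 H. induction k as [|k IH]; [exact H|]. clear H.
  set (g := bracket k f) in *. rewrite bracket_succ. fold g. intros N.
  destruct (ptle_total (power c N) (ell (ell g))) as [H|H]; [exact H | exfalso].
  rewrite <- (mul_1_r (ell (ell g))) in H. apply (ptle_adj_ell (ell g)) in H.
  assert (HcN : forall k x, power c k ∙ x = x ∙ power c k) by (intros; now apply power_comm).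
  assert (H1 : ell g ∙ power c (S N) ⊑ 𝟙).
  { apply ptle_adj_ell. rewrite mul_1_r. apply IH. }
  rewrite power_S_r, <- mul_assoc, <- Hc in H1.
  apply Hc1, central_le1; [exact Hc|].
  transitivity (c ∙ 𝟙); [now rewrite mul_1_r|].
  transitivity (c ∙ ell g ∙ power c N); [now apply ptle_mul | exact H1].
Qed.

Lemma ptle_sigma z f x :
  (forall k, k < n -> z ⊑ bracket k f ∙ x) -> z ⊑ sigma n f ∙ x.
Proof.
  intros H. unfold sigma.
  assert (Hf : forall l b, z ⊑ b ∙ x -> (forall k, In k l -> k < n) ->
            z ⊑ fold_left (fun a k => a ⊓ bracket k f) l b ∙ x).
  { induction l as [|i l IH]; intros b Hb Hl; [exact Hb|]. cbn.
    apply IH; [|intros; apply Hl; now right].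
    rewrite mul_meet_r. apply ptle_meet; [exact Hb|]. apply H, Hl. now left. }
  apply Hf; [apply (H 0 hn)|]. intros k Hk%in_seq. lia.
Qed.

(** A central [c > 1] fixing the point [y] has all its powers below [rr y ∙ y],
    hence below all brackets of that element, whose meet is [1]. *)
Lemma central_free c y : central c -> inv c -> 𝟙 ≤ c -> c ∙ y ⊑ y -> c ≤ 𝟙.
Proof.
  intros Hc Hci H1 Hy. apply NNPP. intros Hno.
  set (κ := rr y ∙ y).
  assert (Hκ : forall N, power c N ⊑ κ).
  { intros N. apply ptle_adj_rr. rewrite <- (power_comm c y N) by apply Hc.
    now apply ptle_power. }
  assert (Hσ : sigma n κ = 𝟙).
  { apply (sigma_fix_one n hn hp y).
    - apply rr_l.
    - apply anti.
      + unfold κ. rewrite <- mul_assoc, rr_r, mul_1_l. reflexivity.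
      + unfold κ. transitivity (y ∙ 𝟙); [now rewrite mul_1_r|].
        apply mul_mono; [reflexivity | apply rr_l]. }
  apply Hno, central_le1; [exact Hc|]. rewrite <- Hσ.
  rewrite <- (mul_1_r (sigma n κ)). apply ptle_sigma. intros k _. rewrite mul_1_r.
  rewrite <- (power_1 c) at 1. now apply ptle_bracket_of_central.
Qed.

(** [u] need not be central, but [power u n] is, and it dominates [u] once [𝟙 ≤ u]. Hence the order
    of invertible elements is decided at any single point. *)
Lemma inv_free u x : inv u -> u ∙ x ⊑ x -> u ≤ 𝟙.
Proof.
  intros Hu Hx. destruct (inv_total u Hu) as [H|H]; [|exact H].
  assert (H1 : power u n ≤ 𝟙).
  { apply central_free with x.
    - now apply power_central.
    - now apply inv_power.
    - now apply one_le_power.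
    - now apply ptle_power. }
  rewrite <- H1, <- (power_1 u) at 1. apply power_mono_exp; [exact H | lia].
Qed.

Lemma inv_ptle u v x : inv u -> inv v -> u ∙ x ⊑ v ∙ x -> u ≤ v.
Proof.
  intros Hu Hv H. rewrite <- (mul_1_r v).
  apply (inv_le_l v); [exact Hv|]. apply inv_free with x.
  - apply inv_mul; [now apply inv_ell | exact Hu].
  - rewrite mul_assoc. now apply ptle_adj_ell.
Qed.

Lemma power_lt_mono u v k : inv u -> inv v -> 0 < k -> u ≤ v -> power v k ≤ power u k -> v ≤ u.
Proof.
  intros Hu Hv Hk Huv H. destruct k as [|k]; [lia|].
  apply (inv_cancel_r (power u k)); [now apply inv_power|].
  transitivity (v ∙ power v k); [|now rewrite <- !power_S].
  apply mul_mono; [reflexivity|]. clear H Hk. induction k as [|k IH]; [reflexivity|].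
  rewrite !power_S. now apply mul_mono.
Qed.

(** The conjugate [w] of [u] has the same [n]-th power, which is central, and [n]-th roots are
    unique in a totally ordered group. *)
Lemma inv_commute u v : inv u -> inv v -> u ∙ v = v ∙ u.
Proof.
  intros Hu Hv.
  set (w := ell v ∙ u ∙ v).
  assert (Hw : inv w) by (repeat apply inv_mul; trivial; now apply inv_ell).
  assert (Hwk : forall k, power w k = ell v ∙ power u k ∙ v).
  { induction k as [|k IH].
    - change (𝟙 = ell v ∙ 𝟙 ∙ v). rewrite mul_1_l. symmetry. apply Hv.
    - rewrite !power_S, IH. unfold w. rewrite !mul_assoc. do 2 f_equal.
      now rewrite inv_ell_r. }
  assert (Hn : power w n = power u n).
  { rewrite Hwk, (power_central u Hu v). now apply inv_ell_l. }
  assert (E : w = u).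
  { destruct (inv_total2 u w Hu Hw) as [H|H]; apply anti; trivial;
      apply (power_lt_mono _ _ n) in H; trivial; now rewrite Hn. }
  apply (inv_cancel_eq (ell v)); [now apply inv_ell|].
  now rewrite (inv_ell_l v).
Qed.

(** * Points with an invertible successor *)

Section Successor.
Context (t : A).
Hypothesis t_inv : inv t.
Hypothesis t_pos : 𝟙 ≤ t.
Hypothesis t_ne1 : ~ t ≤ 𝟙.
Hypothesis t_cover : forall x w, x ⊑ w -> w ⊑ t ∙ x -> w ⊑ x \/ t ∙ x ⊑ w.

Lemma t_step x w : ~ w ⊑ x -> t ∙ x ⊑ w.
Proof.
  intros H. destruct (ptle_total w (t ∙ x)) as [H1|H1]; [|exact H1].
  destruct (ptle_total x w) as [H2|H2]; [|contradiction].
  destruct (t_cover x w H2 H1); [contradiction | assumption].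
Qed.

Lemma t_strict x : ~ t ∙ x ⊑ x.
Proof. intros H. now apply t_ne1, inv_free with x. Qed.

Lemma ptlt_iff x y : ~ y ⊑ x <-> t ∙ x ⊑ y.
Proof.
  split; [apply t_step|]. intros H1 H2. apply (t_strict x). now transitivity y.
Qed.

(** By [ptlt_iff], negating the adjunction for [ell f] yields an adjunction shifted by [t]; so
    [ell (ell f)] and [t ∙ f ∙ ell t] have the same upper bounds at each point. *)
Lemma bracket_conj f : bracket 1 f = t ∙ f ∙ ell t.
Proof.
  change (bracket 1 f) with (ell (ell f)).
  assert (H : forall x q, ell (ell f) ∙ x ⊑ q <-> (t ∙ f ∙ ell t) ∙ x ⊑ q).
  { intros x q. rewrite ptle_adj_ell, !mul_assoc.
    rewrite <- (ptlt_iff (f ∙ ell t ∙ x) q), <- (ptle_adj_ell f q).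
    rewrite (ptlt_iff (ell t ∙ x)), inv_ell_r by exact t_inv. reflexivity. }
  apply anti; apply le_of_ptle; intros x; apply H; reflexivity.
Qed.

Lemma bracket_conj_power k f : bracket k f = power t k ∙ f ∙ power (ell t) k.
Proof.
  induction k as [|k IH].
  - change (f = 𝟙 ∙ f ∙ 𝟙). now rewrite mul_1_l, mul_1_r.
  - change (S k) with (1 + k). rewrite bracket_add, bracket_conj, IH.
    change (1 + k) with (S k). rewrite power_S, power_S_r. now rewrite !mul_assoc.
Qed.

Lemma ptle_t_power v f N : v ⊑ f -> f ⊑ power t N ∙ v -> exists i, f ⊑ power t i ∙ v /\ power t i ∙ v ⊑ f.
Proof.
  intros H1. induction N as [|N IH]; intros H2.
  - exists 0. change (power t 0) with (one : A) in *. rewrite mul_1_l in *. now split.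
  - destruct (classic (f ⊑ power t N ∙ v)) as [H|H]; [auto|].
    apply t_step in H. exists (S N). split; [exact H2|]. now rewrite power_S, mul_assoc.
Qed.

(** In a chain the meet [sigma n f] is attained by some [bracket k f], a conjugate of [f] by [t^k].
    Centrality of [t^n] leads back to [f] within [n] steps. *)
Lemma ptle_t_sigma f : f ⊑ power t n ∙ sigma n f.
Proof.
  assert (E : exists k, k < n /\ bracket k f ⊑ sigma n f).
  { apply NNPP. intros Hno.
    assert (H : forall k, k < n -> t ∙ sigma n f ⊑ bracket k f).
    { intros k Hk. apply t_step. intros H. apply Hno. now exists k. }
    apply (t_strict (sigma n f)). rewrite <- (mul_1_r (sigma n f)) at 2.
    apply ptle_sigma. intros k Hk. rewrite mul_1_r. auto. }
  destruct E as (k & Hk & H). rewrite bracket_conj_power in H.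
  transitivity (power t (n - k) ∙ sigma n f).
  - transitivity (power t (n - k) ∙ power t k ∙ f ∙ power (ell t) k); [|now apply ptle_mul].
    apply ptle_le. rewrite <- mul_assoc, <- power_add. replace (n - k + k) with n by lia.
    rewrite <- (mul_assoc (power t n)), (power_central t t_inv f), mul_assoc.
    replace n with (n - k + k) by lia. rewrite power_add, mul_assoc, power_ell_r, mul_1_r by exact t_inv.
    transitivity (f ∙ 𝟙); [now rewrite mul_1_r|].
    apply mul_mono; [reflexivity | now apply one_le_power].
  - apply ptle_le. apply mul_mono; [apply power_mono_exp; [exact t_pos|lia] | reflexivity].
Qed.

(** Between [sigma n f] and [t^n ∙ sigma n f] there are, up to equivalence, only the points
    [t^i ∙ sigma n f], all of them invertible. *)
Lemma exists_nu f : exists u, inv u /\ f ⊑ u /\ u ⊑ f.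
Proof.
  destruct (ptle_t_power (sigma n f) f n) as (i & H1 & H2).
  - apply ptle_le, sigma_le; assumption.
  - apply ptle_t_sigma.
  - exists (power t i ∙ sigma n f). split; [|now split].
    apply inv_mul; [now apply inv_power | now apply sigma_inv].
Qed.

(** Otherwise a finite meet [f ≥ 1] (at the point [1]) of counterexamples has
    [sigma_up n f < 1]. So conjugation by some [v = u t^k] preserves the set of [f] with
    [1 ⊑ f]; as [v^n] is central, it has finite order, hence fixes that set, which
    determines each element of [A]. *)
Lemma central_translate u : inv u -> exists k, k < n /\ central (u ∙ power t k).
Proof.
  intros Hu.
  assert (Hv : forall k, inv (u ∙ power t k)) by (intros; apply inv_mul; [exact Hu | now apply inv_power]).
  assert (Step : exists k, k < n /\ forall f, 𝟙 ⊑ f -> u ∙ power t k ⊑ f ∙ u ∙ power t k).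
  { apply NNPP. intros Hno.
    assert (H : forall m, m <= n -> exists f, 𝟙 ⊑ f /\
              forall k, k < m -> ~ u ∙ power t k ⊑ f ∙ u ∙ power t k).
    { induction m as [|m IH]; intros Hm; [exists 𝟙; split; [reflexivity | lia]|].
      destruct IH as (f & Hf & Hfk); [lia|].
      assert (Hg : exists g, 𝟙 ⊑ g /\ ~ u ∙ power t m ⊑ g ∙ u ∙ power t m).
      { apply NNPP. intros Hg. apply Hno. exists m. split; [lia|].
        intros g H1. apply NNPP. intros H2. apply Hg. now exists g. }
      destruct Hg as (g & Hg & Hgm). exists (f ⊓ g). split; [now apply ptle_meet|].
      intros k Hk H. destruct (Nat.eq_dec k m) as [->|Hne].
      - apply Hgm. rewrite H at 1. apply ptle_le, mul_mono; [apply meet_r | reflexivity].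
      - apply (Hfk k); [lia|]. rewrite H at 1. apply ptle_le, mul_mono; [apply meet_l | reflexivity]. }
    destruct (H n (le_n n)) as (f & Hf & Hfk).
    assert (Hb : forall k, ~ u ⊑ bracket k f ∙ u).
    { intros k H'. rewrite <- (bracket_mod n hn hp) in H'.
      assert (Hk : k mod n < n) by (apply Nat.mod_upper_bound; lia).
      (* [j] is [- k] modulo [n]: brackets being conjugation by [t], a comparison for [bracket k f]
         becomes one at the exponent [j], which the choice of [f] excludes. *)
      set (i := k mod n) in *. set (j := (n - i) mod n).
      assert (Hj : j < n) by (apply Nat.mod_upper_bound; lia).
      assert (E : f = power t j ∙ bracket i f ∙ power (ell t) j).
      { rewrite <- bracket_conj_power, <- bracket_add, <- (bracket_mod n hn hp).
        unfold j. rewrite Nat.Div0.add_mod_idemp_l. replace (n - i + i) with n by lia.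
        now rewrite Nat.Div0.mod_same. }
      apply (Hfk j Hj). rewrite E at 1. rewrite (inv_commute u) by (trivial; now apply inv_power).
      rewrite !mul_assoc, <- (mul_assoc (power (ell t) j)), power_ell_l, mul_1_l by exact t_inv.
      now apply ptle_mul. }
    assert (Hs : ~ u ⊑ sigma_up n f ∙ u).
    { intros H'. apply ptle_adj_rr in H'. apply (t_strict u).
      transitivity (sigma n (ell f) ∙ u); [|exact H'].
      apply ptle_sigma. intros k _. apply t_step. rewrite bracket_ell.
      intros H''. apply (Hb k). now apply ptle_adj_ell. }
    apply Hs, ptle_le. transitivity (𝟙 ∙ u); [now rewrite mul_1_l|].
    apply mul_mono; [|reflexivity].
    apply inv_ptle with 𝟙; [apply inv_1 | now apply sigma_up_inv|].
    rewrite !mul_1_r. rewrite Hf. now apply ptle_le, le_sigma_up. }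
  destruct Step as (k & Hk & Hf). exists k. split; [exact Hk|].
  specialize (Hv k). set (v := u ∙ power t k) in *.
  assert (Hiv : inv (ell v)) by now apply inv_ell.
  assert (H1 : forall f, 𝟙 ⊑ f -> 𝟙 ⊑ ell v ∙ f ∙ v).
  { intros f H. transitivity (ell v ∙ v); [|now apply ptle_mul, Hf].
    apply ptle_le, le_of_eq. symmetry. apply Hv. }
  assert (H1' : forall m f, 𝟙 ⊑ f -> 𝟙 ⊑ power (ell v) m ∙ f ∙ power v m).
  { induction m as [|m IH]; intros f H.
    - change (𝟙 ⊑ 𝟙 ∙ f ∙ 𝟙). now rewrite mul_1_l, mul_1_r.
    - rewrite power_S_r, power_S, mul_assoc. rewrite <- (mul_assoc f), <- (mul_assoc (ell v)).
      apply IH. now apply H1. }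
  (* Conjugating [n - 1] more times undoes the first conjugation, because [power v n] is central. *)
  assert (H2 : forall f, 𝟙 ⊑ f <-> 𝟙 ⊑ ell v ∙ f ∙ v).
  { intros f. split; [apply H1|]. intros H. apply (H1' (n - 1)) in H.
    rewrite !mul_assoc, <- power_S, <- mul_assoc, <- power_S_r in H.
    replace (S (n - 1)) with n in H by lia.
    rewrite <- (power_central v Hv f), <- mul_assoc, power_ell_l, mul_1_l in H by exact Hv.
    exact H. }
  (* Conjugation by [v] fixes the invertible [ell w], so [H2] passes from [𝟙] to every invertible
     [w]. *)
  assert (H3 : forall w f, inv w -> w ⊑ f <-> w ⊑ ell v ∙ f ∙ v).
  { assert (Hw1 : forall w f, inv w -> w ⊑ f <-> 𝟙 ⊑ ell w ∙ f).
    { intros w f Hw. rewrite <- (inv_rr w Hw), <- ptle_adj_rr, mul_1_r. reflexivity. }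
    intros w f Hw. rewrite !(Hw1 w) by exact Hw. rewrite (H2 (ell w ∙ f)).
    rewrite <- !(mul_assoc (ell w)), <- (mul_assoc (ell v)), <- (mul_assoc (ell v)).
    rewrite (inv_commute (ell v) (ell w)) by (trivial; now apply inv_ell).
    rewrite !mul_assoc. reflexivity. }
  assert (H4 : forall f, f ⊑ ell v ∙ f ∙ v /\ ell v ∙ f ∙ v ⊑ f).
  { intros f. split.
    - destruct (exists_nu f) as (w & Hw & Hw1 & Hw2).
      transitivity w; [exact Hw1 | exact (proj1 (H3 w f Hw) Hw2)].
    - destruct (exists_nu (ell v ∙ f ∙ v)) as (w & Hw & Hw1 & Hw2).
      transitivity w; [exact Hw1 | exact (proj2 (H3 w f Hw) Hw2)]. }
  assert (H5 : forall f x, inv x -> f ∙ x ⊑ (ell v ∙ f ∙ v) ∙ x /\ (ell v ∙ f ∙ v) ∙ x ⊑ f ∙ x).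
  { intros f x Hx. rewrite !mul_assoc, (inv_commute v x), <- (mul_assoc f) by trivial. apply H4. }
  intros f. assert (E : f = ell v ∙ f ∙ v).
  { apply anti; apply le_of_ptle; intros x;
      destruct (exists_nu x) as (w & Hw & Hw1 & Hw2).
    - transitivity (f ∙ w); [now apply ptle_mul|].
      transitivity ((ell v ∙ f ∙ v) ∙ w); [now apply H5 | now apply ptle_mul].
    - transitivity ((ell v ∙ f ∙ v) ∙ w); [now apply ptle_mul|].
      transitivity (f ∙ w); [now apply H5 | now apply ptle_mul]. }
  rewrite E at 1. now rewrite inv_ell_r.
Qed.

End Successor.
End Points.

(** * Ordered abelian groups *)

Record ogroup : Type := {
  ocar :> Type;
  oadd : ocar -> ocar -> ocar;
  oopp : ocar -> ocar;
  ozero : ocar;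
  ole : ocar -> ocar -> Prop;
  oaddA : forall x y z, oadd x (oadd y z) = oadd (oadd x y) z;
  oaddC : forall x y, oadd x y = oadd y x;
  oadd0 : forall x, oadd ozero x = x;
  oaddN : forall x, oadd x (oopp x) = ozero;
  ole_trans : forall x y z, ole x y -> ole y z -> ole x z;
  ole_anti : forall x y, ole x y -> ole y x -> x = y;
  ole_total : forall x y, ole x y \/ ole y x;
  ole_add : forall x y z, ole x y -> ole (oadd z x) (oadd z y)
}.
Arguments oadd {_}. Arguments oopp {_}. Arguments ozero {_}. Arguments ole {_}.

Declare Scope og_scope.
Delimit Scope og_scope with og.
Bind Scope og_scope with ocar.
Notation "x + y" := (oadd x y) : og_scope.
Notation "- x" := (oopp x) : og_scope.
Notation "x - y" := (oadd x (oopp y)) : og_scope.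
Notation "0" := ozero : og_scope.
Notation "x <= y" := (ole x y) : og_scope.

Section ModuleRing.
Context {G : ogroup}.
Implicit Types g h x z p q : G.
Local Open Scope og_scope.

Lemma oadd0r x : x + 0 = x.
Proof. now rewrite oaddC, oadd0. Qed.

Lemma oadd_cancel x y z : x + y = x + z -> y = z.
Proof.
  intros H. apply (f_equal (oadd (- x))) in H.
  rewrite !oaddA, (oaddC _ (- x) x), oaddN, !oadd0 in H. exact H.
Qed.

Lemma oopp_uniq x y : x + y = 0 -> y = - x.
Proof. intros H. apply (oadd_cancel x). now rewrite oaddN. Qed.

Lemma oopp_add x y : - (x + y) = - x - y.
Proof.
  symmetry. apply oopp_uniq.
  rewrite (oaddC _ (- x)), oaddA, <- (oaddA _ x y), oaddN, oadd0r. apply oaddN.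
Qed.

Lemma oopp_opp x : - - x = x.
Proof. symmetry. apply oopp_uniq. rewrite oaddC. apply oaddN. Qed.

Lemma oopp_0 : - 0 = (0 : G).
Proof. symmetry. apply oopp_uniq, oadd0. Qed.

Definition smul (k : Z) (g : G) : G :=
  match k with
  | Z0 => 0
  | Zpos a => Nat.iter (Pos.to_nat a) (oadd g) 0
  | Zneg a => - Nat.iter (Pos.to_nat a) (oadd g) 0
  end.
Local Notation "k • g" := (smul k g) (at level 30, right associativity) : og_scope.

Lemma smul_of_nat (m : nat) g : Z.of_nat m • g = Nat.iter m (oadd g) 0.
Proof. destruct m; [reflexivity|]. cbn [Z.of_nat smul]. now rewrite SuccNat2Pos.id_succ. Qed.

Lemma smul_opp_of_nat (m : nat) g : (- Z.of_nat m) • g = - Nat.iter m (oadd g) 0.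
Proof.
  destruct m; [symmetry; apply oopp_0|].
  cbn [Z.of_nat Z.opp smul]. now rewrite SuccNat2Pos.id_succ.
Qed.

Lemma smul_succ k g : (Z.succ k) • g = g + k • g.
Proof.
  destruct (Z_lt_le_dec k 0) as [H|H].
  - replace k with (- Z.of_nat (S (Z.to_nat (- k - 1))))%Z by lia.
    generalize (Z.to_nat (- k - 1)). intros m. clear k H.
    replace (Z.succ (- Z.of_nat (S m))) with (- Z.of_nat m)%Z by lia.
    rewrite !smul_opp_of_nat. cbn [Nat.iter nat_rect]. change (nat_rect _ ?a (fun _ => ?f) m) with (Nat.iter m f a).
    now rewrite oopp_add, oaddA, oaddN, oadd0.
  - replace k with (Z.of_nat (Z.to_nat k)) by lia. generalize (Z.to_nat k). intros m.
    rewrite <- Nat2Z.inj_succ, !smul_of_nat. reflexivity.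
Qed.

Lemma smul_add_l j k g : (j + k)%Z • g = j • g + k • g.
Proof.
  revert j. apply Z.peano_ind.
  - cbn [smul]. now rewrite oadd0.
  - intros j IH. now rewrite Z.add_succ_l, !smul_succ, IH, oaddA.
  - intros j IH. apply (oadd_cancel g). rewrite <- smul_succ, oaddA, <- smul_succ.
    rewrite <- Z.add_succ_l, Z.succ_pred. exact IH.
Qed.

Lemma smul_add_r k g h : k • (g + h) = k • g + k • h.
Proof.
  revert k. apply Z.peano_ind.
  - cbn [smul]. now rewrite oadd0.
  - intros j IH. rewrite !smul_succ, IH, !oaddA. f_equal.
    rewrite <- !oaddA. f_equal. apply oaddC.
  - intros j IH. apply (oadd_cancel (g + h)). rewrite <- smul_succ, Z.succ_pred, IH.
    rewrite <- (Z.succ_pred j) at 1 2. rewrite !smul_succ, !oaddA. f_equal.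
    rewrite <- !oaddA. f_equal. apply oaddC.
Qed.

Lemma smul_mul j k g : (j * k)%Z • g = j • k • g.
Proof.
  revert j. apply Z.peano_ind.
  - reflexivity.
  - intros j IH. now rewrite Z.mul_succ_l, Z.add_comm, smul_add_l, smul_succ, IH.
  - intros j IH. apply (oadd_cancel (k • g)). rewrite <- smul_succ, <- smul_add_l.
    rewrite Z.succ_pred, <- IH. f_equal. lia.
Qed.

Lemma smul_1 g : 1%Z • g = g.
Proof. apply oadd0r. Qed.

Lemma smul_0 k : k • 0 = (0 : G).
Proof. apply (oadd_cancel (k • 0)). rewrite <- smul_add_r, (oadd0r 0). symmetry. apply oadd0r. Qed.

(** The trivial extension [Z ⊕ G], a commutative ring, lets [ring] prove
    identities between integer combinations of elements of [G]. *)
Definition ZG : Type := (Z * G)%type.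
Definition zg_add (a b : ZG) : ZG := ((fst a + fst b)%Z, snd a + snd b).
Definition zg_mul (a b : ZG) : ZG := ((fst a * fst b)%Z, fst a • snd b + fst b • snd a).
Definition zg_opp (a : ZG) : ZG := ((- fst a)%Z, - snd a).
Definition zg_sub (a b : ZG) : ZG := zg_add a (zg_opp b).
Definition zgZ (k : Z) : ZG := (k, 0).
Definition zgG (g : G) : ZG := (0%Z, g).

Lemma zg_ring : ring_theory (zgZ 0) (zgZ 1) zg_add zg_mul zg_sub zg_opp eq.
Proof.
  split; unfold zg_sub, zg_add, zg_mul, zg_opp, zgZ; cbn [fst snd]; trivial.
  - intros [a g]; cbn [fst snd]. now rewrite oadd0.
  - intros [a g] [b h]; cbn [fst snd]. f_equal; [lia | apply oaddC].
  - intros [a g] [b h] [c i]; cbn [fst snd]. f_equal; [lia | apply oaddA].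
  - intros [a g]; cbn [fst snd]. rewrite smul_1, smul_0, oadd0r. f_equal. lia.
  - intros [a g] [b h]; cbn [fst snd]. f_equal; [lia | apply oaddC].
  - intros [a g] [b h] [c i]; cbn [fst snd]. f_equal; [lia|].
    rewrite !smul_add_r, <- !smul_mul, !oaddA, (Z.mul_comm c a), (Z.mul_comm b c).
    reflexivity.
  - intros [a g] [b h] [c i]; cbn [fst snd]. f_equal; [lia|].
    rewrite !smul_add_r, !smul_add_l, <- !oaddA. f_equal.
    rewrite !oaddA. f_equal. apply oaddC.
  - intros [a g]; cbn [fst snd]. rewrite oaddN. f_equal. lia.
Qed.

Add Ring zg_ring : zg_ring.

Lemma zgG_add g h : zgG (g + h) = zg_add (zgG g) (zgG h).
Proof. reflexivity. Qed.
Lemma zgG_opp g : zgG (- g) = zg_opp (zgG g).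
Proof. reflexivity. Qed.
Lemma zgG_smul k g : zgG (k • g) = zg_mul (zgZ k) (zgG g).
Proof. unfold zgG, zg_mul, zgZ. cbn -[smul]. f_equal; [lia|]. now rewrite oadd0r. Qed.
Lemma zgG_0 : zgG 0 = zgZ 0.
Proof. reflexivity. Qed.
Lemma zgZ_add j k : zgZ (j + k) = zg_add (zgZ j) (zgZ k).
Proof. unfold zgZ, zg_add. cbn. now rewrite oadd0. Qed.
Lemma zgZ_opp j : zgZ (- j) = zg_opp (zgZ j).
Proof. unfold zgZ, zg_opp. cbn. now rewrite oopp_0. Qed.
Lemma zgZ_sub j k : zgZ (j - k) = zg_sub (zgZ j) (zgZ k).
Proof. unfold zg_sub. now rewrite <- zgZ_opp, <- zgZ_add. Qed.
Lemma zgZ_mul j k : zgZ (j * k) = zg_mul (zgZ j) (zgZ k).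
Proof.
  unfold zgZ, zg_mul. cbn -[smul]. f_equal.
  now rewrite !smul_0, oadd0.
Qed.
Lemma zgZ_m1 : zgZ (-1) = zg_opp (zgZ 1).
Proof. apply (zgZ_opp 1). Qed.
Lemma zgG_inj g h : zgG g = zgG h -> g = h.
Proof. intros H. now injection H. Qed.

End ModuleRing.

Ltac module :=
  apply zgG_inj;
  rewrite ?zgG_add, ?zgG_opp, ?zgG_smul, ?zgG_add, ?zgG_opp, ?zgG_smul, ?zgG_0,
    ?zgZ_add, ?zgZ_sub, ?zgZ_opp, ?zgZ_mul, ?zgZ_add, ?zgZ_sub, ?zgZ_opp, ?zgZ_m1;
  ring.

Notation "k • g" := (smul k g) (at level 30, right associativity) : og_scope.

Section OGroup.
Context {G : ogroup}.
Implicit Types g h x z p q : G.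
Local Open Scope og_scope.
Add Ring zg_ring_G : (@zg_ring G).

Lemma ole_refl x : x <= x.
Proof. destruct (ole_total G x x); assumption. Qed.

Lemma ole_shift x y z : x <= y -> x + z <= y + z.
Proof. rewrite (oaddC _ x), (oaddC _ y). apply ole_add. Qed.

Lemma ole_sub x y : x <= y <-> 0 <= y - x.
Proof.
  split; intros H.
  - apply (ole_shift _ _ (- x)) in H. now rewrite oaddN in H.
  - apply (ole_shift _ _ x) in H. rewrite oadd0 in H.
    replace (y - x + x) with y in H by module. exact H.
Qed.

Lemma oadd_pos x y : 0 <= x -> 0 <= y -> 0 <= x + y.
Proof.
  intros H1 H2. apply (ole_trans _ _ x); [exact H1|].
  rewrite <- (oadd0r x) at 1. now apply ole_add.
Qed.

Lemma smul_pos k x : (0 <= k)%Z -> 0 <= x -> 0 <= k • x.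
Proof.
  intros Hk Hx. revert k Hk. apply natlike_ind; [apply ole_refl|].
  intros k _ IH. rewrite smul_succ. now apply oadd_pos.
Qed.

Lemma smul_mono j k x : (j <= k)%Z -> 0 <= x -> j • x <= k • x.
Proof.
  intros H Hx. apply ole_sub. replace (k • x - j • x) with ((k - j)%Z • x) by module.
  apply smul_pos; [lia | exact Hx].
Qed.

(** * Finite and infinite elements relative to the least positive [t] *)

Section Unit.
Context (t : G).
Hypothesis t_pos : 0 <= t.
Hypothesis t_min : forall g, 0 <= g -> g <> 0 -> t <= g.
Hypothesis t_ne0 : t <> 0.

Definition fin g : Prop := exists k : Z, g = k • t.
Definition infp g : Prop := forall k : Z, ~ g <= k • t.

(** Nothing lies strictly between consecutive multiples of [t]. *)
Lemma fin_of_bounded h (N : nat) : 0 <= h -> h <= Z.of_nat N • t -> fin h.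
Proof.
  intros H0. induction N as [|N IH]; intros H.
  - exists 0%Z. apply ole_anti; assumption.
  - destruct (ole_total G h (Z.of_nat N • t)) as [H1|H1]; [auto|].
    destruct (classic (h - Z.of_nat N • t = 0)) as [E|E].
    + exists (Z.of_nat N). replace h with ((h - Z.of_nat N • t) + Z.of_nat N • t) by module.
      rewrite E. apply oadd0.
    + exists (Z.of_nat (S N)). apply ole_anti; [exact H|].
      apply t_min in E; [|now apply ole_sub in H1].
      apply (ole_shift _ _ (Z.of_nat N • t)) in E.
      replace (h - Z.of_nat N • t + Z.of_nat N • t) with h in E by module.
      rewrite Nat2Z.inj_succ, smul_succ. exact E.
Qed.

Lemma trichotomy g : fin g \/ infp g \/ infp (- g).
Proof.
  destruct (classic (infp g)) as [H|H]; [tauto|].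
  destruct (classic (infp (- g))) as [H'|H']; [tauto|]. left.
  apply not_all_ex_not in H. destruct H as [k Hk]. apply NNPP in Hk.
  apply not_all_ex_not in H'. destruct H' as [j Hj]. apply NNPP in Hj.
  apply (ole_add _ _ _ g) in Hj. rewrite oaddN in Hj.
  destruct (fin_of_bounded (g + j • t) (Z.to_nat (k + j))) as [i Hi].
  - exact Hj.
  - apply (ole_trans _ _ ((k + j)%Z • t)).
    + replace ((k + j)%Z • t) with (k • t + j • t) by module. now apply ole_shift.
    + apply smul_mono; [lia | exact t_pos].
  - exists (i - j)%Z. replace ((i - j)%Z • t) with (i • t - j • t) by module.
    rewrite <- Hi. module.
Qed.

Lemma fin_add g h : fin g -> fin h -> fin (g + h).
Proof. intros [j ->] [k ->]. exists (j + k)%Z. module. Qed.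

Lemma fin_opp g : fin g -> fin (- g).
Proof. intros [j ->]. exists (- j)%Z. module. Qed.

Lemma infp_not_fin g : infp g -> ~ fin g.
Proof. intros H [k ->]. apply (H k), ole_refl. Qed.

Lemma infp_pos g : infp g -> 0 <= g.
Proof. intros H. destruct (ole_total G 0 g) as [H'|H']; [exact H'|]. now apply (H 0%Z) in H'. Qed.

Lemma infp_add g h : infp g -> 0 <= h -> infp (g + h).
Proof.
  intros Hg Hh k H. apply (Hg k). apply (ole_trans _ _ (g + h)); [|exact H].
  apply ole_sub. now replace (g + h - g) with h by module.
Qed.

Lemma infp_shift g k : infp g -> infp (g + k • t).
Proof.
  intros Hg j H. apply (Hg (j - k)%Z). apply ole_sub. apply ole_sub in H.
  now replace ((j - k)%Z • t - g) with (j • t - (g + k • t)) by module.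
Qed.

Lemma infp_smul g k : infp g -> (0 < k)%Z -> infp (k • g).
Proof.
  intros Hg Hk. replace k with (1 + (k - 1))%Z by lia. rewrite smul_add_l, smul_1.
  apply infp_add; [exact Hg|]. apply smul_pos; [lia | now apply infp_pos].
Qed.

Lemma smul_t_inj j k : j • t = k • t -> j = k.
Proof.
  assert (H : forall j k, (j < k)%Z -> j • t <> k • t).
  { clear j k. intros j k Hjk E. apply t_ne0, ole_anti; [|exact t_pos].
    apply ole_sub. replace (0 - t) with ((k - j - 1)%Z • t - (k • t - j • t)) by module.
    rewrite E, oaddN, oopp_0, oadd0r. apply smul_pos; [lia | exact t_pos]. }
  intros E. destruct (Z.lt_trichotomy j k) as [L|[L|L]]; [now apply H in E | exact L |].
  symmetry in E. now apply H in E.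
Qed.

(** * Elliott's algorithm modulo the multiples of [t] *)

Section Span.
Context (E : G -> Prop).
Hypothesis E_sub : forall x y, E x -> E y -> E (x - y).
Hypothesis E_0 : E 0.

Lemma E_opp x : E x -> E (- x).
Proof. intros H. rewrite <- (oadd0 _ (- x)). now apply E_sub. Qed.
Lemma E_add x y : E x -> E y -> E (x + y).
Proof. intros H1 H2. rewrite <- (oopp_opp y). now apply E_sub, E_opp. Qed.
Lemma E_smul k x : E x -> E (k • x).
Proof.
  intros H. revert k. apply Z.peano_ind; [exact E_0| |]; intros k IH.
  - rewrite smul_succ. now apply E_add.
  - replace (Z.pred k • x) with (k • x - x); [now apply E_sub|].
    unfold Z.pred. module.
Qed.

Definition valid (b : list G) : Prop := forall x, In x b -> infp x /\ E x.

(** Multiples of [t] enter with either sign: this is the submonoid generated by [b] in the quotient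
    by them. *)
Inductive nspan (b : list G) : G -> Prop :=
| nspan_fin g : fin g -> nspan b g
| nspan_add x g : In x b -> nspan b g -> nspan b (x + g).

Lemma nspan_plus b g h : nspan b g -> nspan b h -> nspan b (g + h).
Proof.
  intros Hg Hh. induction Hg as [g Hg|x g Hx Hg IH].
  - destruct Hh as [h Hh|x h Hx Hh].
    + now apply nspan_fin, fin_add.
    + revert x Hx. induction Hh as [h Hh|y h Hy Hh IH]; intros x Hx.
      * replace (g + (x + h)) with (x + (g + h)) by module. apply nspan_add; [exact Hx|].
        now apply nspan_fin, fin_add.
      * replace (g + (x + (y + h))) with (x + (g + (y + h))) by module.
        apply nspan_add; auto.
  - replace (x + g + h) with (x + (g + h)) by module. now apply nspan_add.
Qed.

Lemma fin_0 : fin 0.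
Proof. now exists 0%Z. Qed.

Lemma nspan_in b x : In x b -> nspan b x.
Proof. intros H. rewrite <- (oadd0r x). apply nspan_add; [exact H | apply nspan_fin, fin_0]. Qed.

Lemma nspan_trans b b' g : (forall x, In x b -> nspan b' x) -> nspan b g -> nspan b' g.
Proof.
  intros H Hg. induction Hg as [g Hg|x g Hx Hg IH]; [now apply nspan_fin|].
  apply nspan_plus; auto.
Qed.

Definition gsum (l : list (Z * G)) : G := fold_right (fun y a => fst y • snd y + a) 0 l.

Lemma gsum_app l l' : gsum (l ++ l') = gsum l + gsum l'.
Proof.
  induction l as [|y l IH]; cbn [gsum fold_right app]; [now rewrite oadd0|].
  change (fst y • snd y + gsum (l ++ l') = (fst y • snd y + gsum l) + gsum l').
  rewrite IH. apply oaddA.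
Qed.

Lemma gsum_cons c q l : gsum ((c, q) :: l) = c • q + gsum l.
Proof. reflexivity. Qed.

(** [cnt] and [ncnt] are the termination measures of [elliott_shorten] and [elliott_round]. *)
Definition cnt (M : Z) (l : list (Z * G)) : nat :=
  length (filter (fun y => Z.abs (fst y) =? M)%Z l).
Definition ncnt (l : list (Z * G)) : nat := length (filter (fun y => fst y <? 0)%Z l).

Lemma gsum_nonneg l :
  (forall y, In y l -> (0 <= fst y)%Z /\ 0 <= snd y) -> 0 <= gsum l.
Proof.
  induction l as [|y l IH]; intros H; [apply ole_refl|].
  apply oadd_pos; [apply smul_pos; apply H; now left | apply IH; intros; apply H; now right].
Qed.

(** One round of Elliott's algorithm: [p] carries the coefficient of largest
    absolute value [M > 0] in the relation; subtracting it from (or reducing it by)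
    the generators with coefficients of the opposite sign lowers the number of
    coefficients of absolute value [M], or shows one generator to be redundant. *)
Lemma elliott_round (M : Z) (k : nat) : (0 < M)%Z -> forall p rest,
  (ncnt rest <= k)%nat ->
  (forall y, In y rest -> (Z.abs (fst y) <= M)%Z) ->
  valid (p :: map snd rest) -> fin (M • p + gsum rest) ->
  (exists b, valid b /\ (length b < S (length rest))%nat /\
     forall q, In q (p :: map snd rest) -> nspan b q) \/
  (exists l, valid (map snd l) /\ length l = S (length rest) /\
     (forall q, In q (p :: map snd rest) -> nspan (map snd l) q) /\
     fin (gsum l) /\ (exists y, In y l /\ fst y <> 0%Z) /\
     (forall y, In y l -> (Z.abs (fst y) <= M)%Z) /\ (cnt M l <= cnt M rest)%nat).
Proof.
  intros HM. induction k as [k IH] using (well_founded_induction lt_wf).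
  intros p rest Hk HrM Hv Hfin.
  (* Without a negative coefficient the relation would be infinitely positive instead of finite. *)
  assert (Hneg : exists y, In y rest /\ (fst y < 0)%Z).
  { apply NNPP. intros Hno. apply (infp_not_fin (M • p + gsum rest)); [|exact Hfin].
    apply infp_add.
    - apply infp_smul; [apply Hv; now left | exact HM].
    - apply gsum_nonneg. intros y Hy. split.
      + apply Z.nlt_ge. intros H. apply Hno. now exists y.
      + apply infp_pos, Hv. right. now apply in_map. }
  destruct Hneg as ([x q] & Hin & Hx). cbn [fst] in Hx.
  pose proof (HrM _ Hin) as HxM. cbn [fst] in HxM.
  apply in_split in Hin. destruct Hin as (r1 & r2 & ->).
  set (r := r1 ++ r2).
  assert (Hlen : length (r1 ++ (x, q) :: r2) = S (length r)).
  { unfold r. rewrite !length_app. cbn. lia. }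
  assert (Hsum : gsum (r1 ++ (x, q) :: r2) = x • q + gsum r).
  { unfold r. rewrite !gsum_app, gsum_cons. module. }
  assert (Hcnt : cnt M (r1 ++ (x, q) :: r2) = cnt M ((x, q) :: r)).
  { unfold cnt, r. rewrite filter_app. cbn [filter]. rewrite filter_app.
    destruct (Z.abs (fst (x, q)) =? M)%Z; rewrite !length_app; cbn [length];
      rewrite ?length_app; lia. }
  assert (Hncnt : ncnt (r1 ++ (x, q) :: r2) = S (ncnt r)).
  { unfold ncnt, r. rewrite !filter_app. cbn [filter fst].
    replace (x <? 0)%Z with true by lia. rewrite !length_app. cbn [length]. lia. }
  assert (Hr : forall y, In y r -> In y (r1 ++ (x, q) :: r2)).
  { intros y Hy. unfold r in Hy. apply in_app_or in Hy. apply in_or_app. cbn. tauto. }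
  assert (Hin : forall g, In g (p :: map snd (r1 ++ (x, q) :: r2)) ->
            g = p \/ g = q \/ In g (map snd r)).
  { intros g [->|Hg]; [now left|]. unfold r. rewrite map_app in *. apply in_app_or in Hg.
    cbn in Hg. rewrite in_app_iff. destruct Hg as [Hg|[Hg|Hg]]; auto. }
  assert (Hvp : infp p /\ E p) by (apply Hv; now left).
  assert (Hvq : infp q /\ E q).
  { apply Hv. right. rewrite map_app. apply in_or_app. right. now left. }
  assert (Hvr : forall g, In g (map snd r) -> infp g /\ E g).
  { intros g Hg. apply Hv. right. apply in_map_iff in Hg. destruct Hg as (y & <- & Hy).
    now apply in_map, Hr. }
  rewrite Hlen. rewrite Hsum in Hfin. rewrite Hcnt.
  (* If [p - q] is finite, [p] is dropped. If it is infinitely positive, it replaces [p] with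
     coefficient [M], and the coefficient of [q] becomes [x + M], no longer negative. Otherwise
     [q - p] replaces [q], and the coefficient of [p] falls to [M + x < M]. *)
  destruct (trichotomy (p - q)) as [H|[H|H]].
  - left. exists (q :: map snd r). repeat split.
    + destruct H0 as [<-|H0]; [apply Hvq | now apply Hvr].
    + destruct H0 as [<-|H0]; [apply Hvq | now apply Hvr].
    + cbn. rewrite length_map. lia.
    + intros g Hg. destruct (Hin g Hg) as [->|[->|Hg']].
      * replace p with (q + (p - q)) by module.
        apply nspan_add; [now left | now apply nspan_fin].
      * apply nspan_in. now left.
      * apply nspan_in. now right.
  - destruct (IH (ncnt r)) with (p := p - q) (rest := ((x + M)%Z, q) :: r) as [(b & Hb)|(l & Hl)].
    + lia.
    + unfold ncnt. cbn [filter fst]. replace (x + M <? 0)%Z with false by lia. unfold ncnt. lia.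
    + intros y [<-|Hy]; [cbn; lia | auto].
    + cbn [map snd]. intros g [<-|[<-|Hg]]; [split; [exact H|] | exact Hvq | auto].
      apply E_sub; tauto.
    + rewrite gsum_cons. replace (M • (p - q) + ((x + M)%Z • q + gsum r))
        with (M • p + (x • q + gsum r)) by module. exact Hfin.
    + left. exists b. destruct Hb as (Hb1 & Hb2 & Hb3). repeat split; [apply Hb1, H0 | apply Hb1, H0 | exact Hb2|].
      intros g Hg. destruct (Hin g Hg) as [->|[->|Hg']].
      * replace p with ((p - q) + q) by module. apply nspan_plus; apply Hb3; cbn; auto.
      * apply Hb3. cbn. auto.
      * apply Hb3. cbn. auto.
    + right. exists l. destruct Hl as (Hl1 & Hl2 & Hl3 & Hl4 & Hl5 & Hl6 & Hl7).
      split; [exact Hl1|]. split; [exact Hl2|]. split; [|split; [exact Hl4|split; [exact Hl5|split; [exact Hl6|]]]].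
      * intros g Hg. destruct (Hin g Hg) as [->|[->|Hg']].
        -- replace p with ((p - q) + q) by module. apply nspan_plus; apply Hl3; cbn; auto.
        -- apply Hl3. cbn. auto.
        -- apply Hl3. cbn. auto.
      * rewrite Hl7. unfold cnt. cbn [filter fst].
        replace (Z.abs (x + M) =? M)%Z with false by lia.
        destruct (Z.abs x =? M)%Z; cbn [length]; lia.
  - right. replace (- (p - q)) with (q - p) in H by module.
    exists (((M + x)%Z, p) :: (x, q - p) :: r). repeat split.
    + destruct H0 as [<-|[<-|H0]]; cbn; [apply Hvp | exact H | now apply Hvr].
    + destruct H0 as [<-|[<-|H0]]; cbn; [apply Hvp | apply E_sub; tauto | now apply Hvr].
    + intros g Hg. destruct (Hin g Hg) as [->|[->|Hg']].
      * apply nspan_in. now left.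
      * assert (Hq : nspan (p :: (q - p) :: map snd r) ((q - p) + p))
          by (apply nspan_plus; apply nspan_in; cbn; auto).
        now replace (q - p + p) with q in Hq by module.
      * apply nspan_in. cbn. auto.
    + rewrite !gsum_cons. replace ((M + x)%Z • p + (x • (q - p) + gsum r))
        with (M • p + (x • q + gsum r)) by module. exact Hfin.
    + exists (x, q - p). split; [cbn; auto | cbn; lia].
    + intros y [<-|[<-|Hy]]; cbn; [lia | lia | auto].
    + unfold cnt. cbn [filter fst]. replace (Z.abs (M + x) =? M)%Z with false by lia.
      destruct (Z.abs x =? M)%Z; cbn [length]; lia.
Qed.

Lemma cnt_0_le (M : Z) l : cnt M l = 0%nat -> (forall y, In y l -> (Z.abs (fst y) <= M)%Z) ->
  forall y, In y l -> (Z.abs (fst y) <= M - 1)%Z.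
Proof.
  unfold cnt. intros H HM y Hy. specialize (HM y Hy).
  destruct (Z.eq_dec (Z.abs (fst y)) M) as [E1|]; [|lia]. exfalso.
  assert (Hf : In y (filter (fun y => Z.abs (fst y) =? M)%Z l)).
  { apply filter_In. split; [exact Hy|]. now apply Z.eqb_eq. }
  apply length_zero_iff_nil in H. now rewrite H in Hf.
Qed.

(** Induction on the bound [M] and, for fixed [M], on the number of coefficients attaining it, which
    [elliott_round] lowers. The relation is negated if the chosen extremal coefficient is
    negative. *)
Lemma elliott_shorten (M : nat) : forall (k : nat) l,
  valid (map snd l) -> fin (gsum l) -> (exists y, In y l /\ fst y <> 0%Z) ->
  (forall y, In y l -> (Z.abs (fst y) <= Z.of_nat M)%Z) -> (cnt (Z.of_nat M) l <= k)%nat ->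
  exists b, valid b /\ (length b < length l)%nat /\ forall q, In q (map snd l) -> nspan b q.
Proof.
  induction M as [|M IHM].
  { intros k l _ _ (y & Hy & Hy0) H _. specialize (H y Hy). lia. }
  induction k as [k IHk] using (well_founded_induction lt_wf).
  intros l Hv Hfin Hnz HM Hk.
  destruct (Nat.eq_dec (cnt (Z.of_nat (S M)) l) 0) as [E0|E0].
  { apply (IHM (length l)); trivial.
    - intros y Hy. pose proof (cnt_0_le _ l E0 HM y Hy). lia.
    - apply filter_length_le. }
  assert (Key : forall l, valid (map snd l) -> fin (gsum l) ->
            (forall y, In y l -> (Z.abs (fst y) <= Z.of_nat (S M))%Z) ->
            (cnt (Z.of_nat (S M)) l <= k)%nat ->
            (exists p, In (Z.of_nat (S M), p) l) ->
            exists b, valid b /\ (length b < length l)%nat /\ forall q, In q (map snd l) -> nspan b q).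
  { clear l Hv Hfin Hnz HM Hk E0. intros l Hv Hfin HM Hk (p & Hp).
    apply in_split in Hp. destruct Hp as (l1 & l2 & ->).
    set (rest := l1 ++ l2).
    assert (Hlen : length (l1 ++ (Z.of_nat (S M), p) :: l2) = S (length rest)).
    { unfold rest. rewrite !length_app. cbn. lia. }
    assert (Hin : forall q, In q (map snd (l1 ++ (Z.of_nat (S M), p) :: l2)) <-> In q (p :: map snd rest)).
    { intros q. unfold rest. rewrite !map_app. cbn. rewrite !in_app_iff. cbn. tauto. }
    assert (Hcnt : cnt (Z.of_nat (S M)) (l1 ++ (Z.of_nat (S M), p) :: l2) = S (cnt (Z.of_nat (S M)) rest)).
    { unfold cnt, rest. rewrite !filter_app. cbn [filter fst].
      rewrite (proj2 (Z.eqb_eq (Z.abs (Z.of_nat (S M))) _)) by lia.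
      rewrite !length_app. cbn [length]. lia. }
    rewrite Hlen.
    destruct (elliott_round (Z.of_nat (S M)) (ncnt rest) ltac:(lia) p rest) as [(b & H1 & H2 & H3)|
      (l' & H1 & H2 & H3 & H4 & H5 & H6 & H7)]; trivial.
    - intros y Hy. apply HM. unfold rest in Hy. apply in_app_or in Hy. apply in_or_app. cbn. tauto.
    - intros q Hq. apply Hv, Hin, Hq.
    - unfold rest. replace (Z.of_nat (S M) • p + gsum (l1 ++ l2))
        with (gsum (l1 ++ (Z.of_nat (S M), p) :: l2)); [exact Hfin|].
      rewrite !gsum_app, gsum_cons. module.
    - exists b. repeat split; [apply H1, H | apply H1, H | exact H2|].
      intros q Hq. apply H3, Hin, Hq.
    - destruct (IHk (cnt (Z.of_nat (S M)) rest)) with (l := l') as (b & Hb1 & Hb2 & Hb3);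
        trivial; [lia|].
      exists b. repeat split; [apply Hb1, H | apply Hb1, H | lia|].
      intros q Hq. apply (nspan_trans (map snd l')); [exact Hb3|]. apply H3, Hin, Hq. }
  assert (Hex : exists y, In y l /\ Z.abs (fst y) = Z.of_nat (S M)).
  { unfold cnt in E0. destruct (filter _ l) as [|y f] eqn:Ef; [easy|].
    exists y. assert (Hy : In y (y :: f)) by now left. rewrite <- Ef in Hy.
    apply filter_In in Hy. now rewrite Z.eqb_eq in Hy. }
  destruct Hex as ([c p] & Hy & Hc). cbn [fst] in Hc.
  destruct (Z_lt_le_dec c 0) as [Hc0|Hc0].
  - set (f := fun y : Z * G => ((- fst y)%Z, snd y)).
    assert (Hm : map snd (map f l) = map snd l) by (rewrite map_map; now apply map_ext).
    destruct (Key (map f l)) as (b & Hb1 & Hb2 & Hb3).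
    + now rewrite Hm.
    + replace (gsum (map f l)) with (- gsum l); [now apply fin_opp|].
      clear. induction l as [|[c q] l IH]; [apply oopp_0|].
      cbn [map]. unfold f at 1. cbn [fst snd]. rewrite !gsum_cons, <- IH. module.
    + intros y Hy'. apply in_map_iff in Hy'. destruct Hy' as (y' & <- & Hy'). cbn [f fst].
      rewrite Z.abs_opp. now apply HM.
    + replace (cnt (Z.of_nat (S M)) (map f l)) with (cnt (Z.of_nat (S M)) l); [exact Hk|].
      unfold cnt. clear. induction l as [|y l IH]; [reflexivity|].
      cbn [map filter]. unfold f at 1. cbn [fst]. rewrite Z.abs_opp.
      destruct (_ =? _)%Z; cbn [length]; now rewrite IH.
    + exists p. apply in_map_iff. exists (c, p). split; [|exact Hy]. unfold f. cbn. f_equal. lia.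
    + exists b. rewrite length_map in Hb2. rewrite Hm in Hb3. now repeat split; try apply Hb1.
  - apply Key; trivial. exists p. now replace (Z.of_nat (S M)) with c by lia.
Qed.

Definition independent (b : list G) : Prop :=
  forall l, map snd l = b -> fin (gsum l) -> forall y, In y l -> fst y = 0%Z.

(** Every nontrivial relation leads to a shorter list whose span still contains the old generators.
    This is Elliott's theorem modulo the multiples of [t]. *)
Lemma exists_independent (k : nat) : forall P, (length P <= k)%nat -> valid P ->
  exists b, valid b /\ independent b /\ forall q, In q P -> nspan b q.
Proof.
  induction k as [k IH] using (well_founded_induction lt_wf). intros P HP Hv.
  destruct (classic (independent P)) as [Hi|Hi].
  { exists P. repeat split; trivial; try (apply Hv; assumption). apply nspan_in. }
  assert (Hl : exists l, map snd l = P /\ fin (gsum l) /\ exists y, In y l /\ fst y <> 0%Z).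
  { apply NNPP. intros Hno. apply Hi. intros l Hl Hf y Hy. apply NNPP. intros Hy0.
    apply Hno. exists l. split; [exact Hl|]. split; [exact Hf|]. now exists y. }
  destruct Hl as (l & <- & Hf & Hnz).
  assert (HM : exists M : nat, forall y, In y l -> (Z.abs (fst y) <= Z.of_nat M)%Z).
  { clear. induction l as [|y l (M & HM)]; [exists 0%nat; intros y []|].
    exists (Nat.max (Z.to_nat (Z.abs (fst y))) M). intros y' [<-|Hy']; [lia|].
    specialize (HM y' Hy'). lia. }
  destruct HM as (M & HM).
  destruct (elliott_shorten M (length l) l Hv Hf Hnz HM) as (b & Hb1 & Hb2 & Hb3);
    [apply filter_length_le|].
  rewrite length_map in HP.
  destruct (IH (length b) ltac:(lia) b (le_n _) Hb1) as (b' & H1 & H2 & H3).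
  exists b'. repeat split; trivial; try (apply H1; assumption).
  intros q Hq. apply (nspan_trans b); auto.
Qed.

(** [repr b g j l]: [g] is [j • t] plus an integer combination of [b] with
    coefficient sum [l]. *)
Inductive repr (b : list G) : G -> Z -> Z -> Prop :=
| repr_t k : repr b (k • t) k 0
| repr_add x g j l : In x b -> repr b g j l -> repr b (x + g) j (l + 1)
| repr_sub x g j l : In x b -> repr b g j l -> repr b (g - x) j (l - 1).

Section Repr.
Context (b : list G).
Hypothesis b_valid : valid b.
Hypothesis b_indep : independent b.

Lemma repr_plus_t g j l k : repr b g j l -> repr b (g + k • t) (j + k) l.
Proof.
  induction 1 as [i|x g j l Hx _ IH|x g j l Hx _ IH].
  - replace (i • t + k • t) with ((i + k)%Z • t) by module. constructor.
  - replace (x + g + k • t) with (x + (g + k • t)) by module. now constructor.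
  - replace (g - x + k • t) with ((g + k • t) - x) by module. now constructor.
Qed.

Lemma repr_plus g j l g' j' l' : repr b g j l -> repr b g' j' l' -> repr b (g + g') (j + j') (l + l').
Proof.
  intros H H'. revert g j l H.
  induction H' as [k|x g' j' l' Hx _ IH|x g' j' l' Hx _ IH]; intros g j l H.
  - rewrite Z.add_0_r. now apply repr_plus_t.
  - replace (g + (x + g')) with (x + (g + g')) by module. rewrite Z.add_assoc.
    constructor; auto.
  - replace (g + (g' - x)) with ((g + g') - x) by module. rewrite Z.add_sub_assoc.
    constructor; auto.
Qed.

Lemma repr_opp g j l : repr b g j l -> repr b (- g) (- j) (- l).
Proof.
  induction 1 as [i|x g j l Hx _ IH|x g j l Hx _ IH].
  - replace (- (i • t)) with ((- i)%Z • t) by module. constructor.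
  - replace (- (x + g)) with (- g - x) by module.
    replace (- (l + 1))%Z with (- l - 1)%Z by lia. now constructor.
  - replace (- (g - x)) with (x + - g) by module.
    replace (- (l - 1))%Z with (- l + 1)%Z by lia. now constructor.
Qed.

Lemma bump_coef x c l0 : In x (map snd l0) -> exists l1,
  map snd l1 = map snd l0 /\ gsum l1 = c • x + gsum l0 /\
  fold_right (fun y a => fst y + a)%Z 0%Z l1 = (c + fold_right (fun y a => fst y + a)%Z 0%Z l0)%Z.
Proof.
  induction l0 as [|[d q] l0 IH]; intros H; [contradiction|]. destruct H as [H|H].
  - cbn in H. subst q. exists (((c + d)%Z, x) :: l0). repeat split.
    + rewrite !gsum_cons. module.
    + cbn. lia.
  - destruct (IH H) as (l1 & H1 & H2 & H3). exists ((d, q) :: l1). repeat split.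
    + cbn. now rewrite H1.
    + rewrite !gsum_cons, H2. module.
    + cbn. rewrite H3. lia.
Qed.

Lemma repr_coef g j l : repr b g j l -> exists l0, map snd l0 = b /\
  g = j • t + gsum l0 /\ l = fold_right (fun y a => fst y + a)%Z 0%Z l0.
Proof.
  induction 1 as [i|x g j l Hx _ (l0 & <- & -> & ->)|x g j l Hx _ (l0 & <- & -> & ->)].
  - exists (map (fun x => (0%Z, x)) b). repeat split.
    + rewrite map_map. apply map_id.
    + assert (E0 : gsum (map (fun x => (0%Z, x)) b) = 0); [|now rewrite E0, oadd0r].
      induction b as [|x b' IH]; [reflexivity|]. cbn [map]. rewrite gsum_cons.
      change (0 + gsum (map (fun x => (0%Z, x)) b') = 0). rewrite oadd0.
      clear -b'. induction b' as [|x b' IH]; [reflexivity|]. cbn [map]. rewrite gsum_cons.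
      change (0 + gsum (map (fun x => (0%Z, x)) b') = 0). now rewrite oadd0.
    + clear. induction b as [|x b' IH]; [reflexivity|]. cbn. exact IH.
  - destruct (bump_coef x 1 l0 Hx) as (l1 & H1 & H2 & H3). exists l1. repeat split; trivial.
    + rewrite H2. module.
    + rewrite H3. lia.
  - destruct (bump_coef x (-1) l0 Hx) as (l1 & H1 & H2 & H3). exists l1. repeat split; trivial.
    + rewrite H2. module.
    + rewrite H3. lia.
Qed.

(** The difference of two representations is a relation on [b], so its coefficients vanish by
    independence; then [smul_t_inj] compares the multiples of [t]. *)
Lemma repr_uniq g j l j' l' : repr b g j l -> repr b g j' l' -> j = j' /\ l = l'.
Proof.
  intros H H'. pose proof (repr_plus _ _ _ _ _ _ H (repr_opp _ _ _ H')) as H0.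
  rewrite oaddN in H0. apply repr_coef in H0. destruct H0 as (l0 & H1 & H2 & H3).
  assert (Hf : fin (gsum l0)).
  { exists (- (j + - j'))%Z. apply (oadd_cancel ((j + - j')%Z • t)). rewrite <- H2. module. }
  assert (Hz : forall y, In y l0 -> fst y = 0%Z) by now apply b_indep.
  assert (Hs : gsum l0 = 0 /\ fold_right (fun y a => fst y + a)%Z 0%Z l0 = 0%Z).
  { clear -Hz. induction l0 as [|[c q] l0 IH]; [now split|].
    destruct IH as [E1 E2]; [intros; apply Hz; now right|].
    assert (E3 : c = 0%Z) by (apply (Hz (c, q)); now left). subst c.
    rewrite gsum_cons, E1. split; [apply oadd0|]. cbn. exact E2. }
  destruct Hs as [Hs1 Hs2]. rewrite Hs1, oadd0r in H2. rewrite Hs2 in H3.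
  split; [|lia]. change 0 with (0%Z • t) in H2. apply smul_t_inj in H2. lia.
Qed.

Lemma repr_E g j l : repr b g j l -> E (g - j • t).
Proof.
  induction 1 as [i|x g j l Hx _ IH|x g j l Hx _ IH].
  - rewrite oaddN. exact E_0.
  - replace (x + g - j • t) with (x + (g - j • t)) by module.
    apply E_add; [now apply b_valid | exact IH].
  - replace (g - x - j • t) with ((g - j • t) - x) by module.
    apply E_sub; [exact IH | now apply b_valid].
Qed.

Lemma nspan_repr g : nspan b g -> exists j l, repr b g j l /\ (0 <= l)%Z /\ (l = 0%Z -> fin g).
Proof.
  induction 1 as [g [k ->]|x g Hx _ (j & l & H1 & H2 & H3)].
  - exists k, 0%Z. split; [constructor|]. split; [lia|]. intros _. now exists k.
  - exists j, (l + 1)%Z. split; [now constructor|]. split; lia.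
Qed.

End Repr.

(** [τ g = j + n M l] for [g] as in [repr b g j l], where [b] spans the infinitely
    positive elements coming from [L] with nonnegative coefficients, and [M] is large. *)
Lemma exists_tau (n : nat) (L : list G) : (0 < n)%nat -> E (Z.of_nat n • t) ->
  (forall g, exists k : Z, E (g + k • t)) ->
  exists (H : G -> Prop) (τ : G -> Z),
    (forall g, In g L -> H g) /\ (forall k, H (k • t)) /\
    (forall g h, H g -> H h -> H (g + h)) /\ (forall g, H g -> H (- g)) /\
    (forall g h, H g -> H h -> τ (g + h) = (τ g + τ h)%Z) /\
    (forall k, τ (k • t) = k) /\ (forall g, H g -> E (g - τ g • t)) /\
    (forall g, In g L -> 0 <= g -> (0 <= τ g)%Z /\ (g <> 0 -> (0 < τ g)%Z)).
Proof.
  intros Hn Ent Eshift.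
  (* [P] collects the absolute values of the infinite members of [L], shifted into [E] by multiples
     of [t]. *)
  assert (HP : exists P, valid P /\ forall g, In g L ->
            fin g \/ (infp g /\ exists k, In (g + k • t) P) \/
            (infp (- g) /\ exists k, In (- g + k • t) P)).
  { induction L as [|g L (P & HP & HL)]; [exists nil; split; [intros x [] | intros g []]|].
    assert (Hx : forall x, infp x -> exists k, infp (x + k • t) /\ E (x + k • t)).
    { intros x Hx. destruct (Eshift x) as [k Hk]. exists k. split; [now apply infp_shift | exact Hk]. }
    destruct (trichotomy g) as [Hg|[Hg|Hg]].
    - exists P. split; [exact HP|]. intros g' [<-|Hg']; auto.
    - destruct (Hx _ Hg) as [k Hk]. exists ((g + k • t) :: P). split.
      + intros x [<-|Hx']; auto.
      + intros g' [<-|Hg'].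
        * right. left. split; [exact Hg|]. exists k. now left.
        * destruct (HL g' Hg') as [H|[[H [k' H']]|[H [k' H']]]]; [now left| |].
          -- right. left. split; [exact H|]. exists k'. now right.
          -- right. right. split; [exact H|]. exists k'. now right.
    - destruct (Hx _ Hg) as [k Hk]. exists ((- g + k • t) :: P). split.
      + intros x [<-|Hx']; auto.
      + intros g' [<-|Hg'].
        * right. right. split; [exact Hg|]. exists k. now left.
        * destruct (HL g' Hg') as [H|[[H [k' H']]|[H [k' H']]]]; [now left| |].
          -- right. left. split; [exact H|]. exists k'. now right.
          -- right. right. split; [exact H|]. exists k'. now right. }
  destruct HP as (P & HP & HL).
  destruct (exists_independent (length P) P (le_n _) HP) as (b & Hv & Hi & Hspan).
  assert (Hcase : forall x, infp x -> (exists k, In (x + k • t) P) ->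
            exists j l, repr b x j l /\ (0 < l)%Z).
  { intros x Hx [k Hk]. destruct (nspan_repr b _ (Hspan _ Hk)) as (j & l & H1 & H2 & H3).
    exists (j + - k)%Z, l. split.
    - replace x with ((x + k • t) + (- k)%Z • t) by module. now apply repr_plus_t.
    - destruct (Z.eq_dec l 0) as [->|]; [exfalso|lia].
      apply (infp_not_fin (x + k • t)); [now apply infp_shift | auto]. }
  assert (HM : exists M : Z, (0 <= M)%Z /\ forall g j l, In g L -> repr b g j l -> (Z.abs j < M)%Z).
  { clear HL. induction L as [|g L (M & HM0 & HM)]; [exists 0%Z; split; [lia | intros g j l []]|].
    destruct (classic (exists j l, repr b g j l)) as [(j & l & Hr)|Hno].
    - exists (Z.max M (Z.abs j + 1)). split; [lia|]. intros g' j' l' [<-|Hg'] Hr'.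
      + destruct (repr_uniq b Hv Hi _ _ _ _ _ Hr Hr'). lia.
      + specialize (HM _ _ _ Hg' Hr'). lia.
    - exists M. split; [exact HM0|]. intros g' j' l' [<-|Hg'] Hr'; [exfalso; eauto | eauto]. }
  destruct HM as (M & HM0 & HM).
  (* [M] outweighs every finite part [j] occurring in [L], which yields positivity; the factor [n]
     puts [(N * l) • t] into [E]. *)
  set (N := (Z.of_nat n * M)%Z).
  assert (Hτ : forall g, exists c : Z, forall j l, repr b g j l -> c = (j + N * l)%Z).
  { intros g. destruct (classic (exists j l, repr b g j l)) as [(j & l & Hr)|Hno].
    - exists (j + N * l)%Z. intros j' l' Hr'. now destruct (repr_uniq b Hv Hi _ _ _ _ _ Hr Hr') as [-> ->].
    - exists 0%Z. intros j l Hr. exfalso. eauto. }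
  (* Off the span of [b] and [t] the value is arbitrary; [τ] is used through [τE] only. *)
  set (τ := fun g => proj1_sig (constructive_indefinite_description _ (Hτ g))).
  assert (τE : forall g j l, repr b g j l -> τ g = (j + N * l)%Z).
  { intros g. exact (proj2_sig (constructive_indefinite_description _ (Hτ g))). }
  exists (fun g => exists j l, repr b g j l), τ.
  assert (HH : forall g, In g L -> exists j l, repr b g j l).
  { intros g Hg. destruct (HL g Hg) as [[k ->]|[[H1 H2]|[H1 H2]]].
    - exists k, 0%Z. constructor.
    - destruct (Hcase g H1 H2) as (j & l & H & _). eauto.
    - destruct (Hcase (- g) H1 H2) as (j & l & H & _). apply repr_opp in H.
      rewrite oopp_opp in H. eauto. }
  assert (Hpos : forall g, In g L -> 0 <= g -> g <> 0 -> (0 < τ g)%Z).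
  { intros g Hg H0 Hg0. destruct (HL g Hg) as [[k ->]|[[H1 H2]|[H1 H2]]].
    - rewrite (τE _ _ _ (repr_t b k)). apply Z.nle_gt. intros Hk. apply Hg0.
      apply ole_anti; [|exact H0]. apply (smul_mono k 0); [lia | exact t_pos].
    - destruct (Hcase g H1 H2) as (j & l & H & Hl). rewrite (τE _ _ _ H).
      specialize (HM _ _ _ Hg H).
      assert (Hnl : (1 <= Z.of_nat n * l)%Z) by nia.
      replace (N * l)%Z with (M * (Z.of_nat n * l))%Z by (unfold N; lia). nia.
    - exfalso. apply (H1 0%Z). apply (ole_add _ _ _ (- g)) in H0.
      now rewrite oadd0r, (oaddC _ _ g), oaddN in H0. }
  split; [exact HH|]. split; [intros k; exists k, 0%Z; constructor|]. repeat split.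
  - intros g h (j & l & Hg) (j' & l' & Hh). exists (j + j')%Z, (l + l')%Z. now apply repr_plus.
  - intros g (j & l & Hg). exists (- j)%Z, (- l)%Z. now apply repr_opp.
  - intros g h (j & l & Hg) (j' & l' & Hh).
    rewrite (τE _ _ _ Hg), (τE _ _ _ Hh), (τE _ _ _ (repr_plus b _ _ _ _ _ _ Hg Hh)). lia.
  - intros k. rewrite (τE _ _ _ (repr_t b k)). lia.
  - intros g (j & l & Hg). rewrite (τE _ _ _ Hg).
    replace (g - (j + N * l)%Z • t) with ((g - j • t) - (N * l)%Z • t) by module.
    apply E_sub; [now apply (repr_E b Hv g j l)|].
    replace ((N * l)%Z • t) with ((M * l)%Z • Z.of_nat n • t) by (unfold N; module).
    now apply E_smul.
  - destruct (classic (g = 0)) as [->|Hg0].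
    + change 0 with (0%Z • t). rewrite (τE _ _ _ (repr_t b 0)). lia.
    + now apply Z.lt_le_incl, Hpos.
  - now apply Hpos.
Qed.
End Span.
End Unit.
End OGroup.

(** * Actions by n-periodic maps and F_n(Z) *)

Section Periodicity.
Context {A : algebra} {hA : is_lpregroup A}.

Lemma iter_ell_rr k (x : A) : Nat.iter k ell (Nat.iter k rr x) = x.
Proof.
  induction k as [|k IH]; [reflexivity|].
  rewrite (Nat.iter_succ_r _ _ ell), (Nat.iter_succ _ _ rr), ell_rr. exact IH.
Qed.

Lemma iter_rr_ell k (x : A) : Nat.iter k rr (Nat.iter k ell x) = x.
Proof.
  induction k as [|k IH]; [reflexivity|].
  rewrite (Nat.iter_succ_r _ _ rr), (Nat.iter_succ _ _ ell), rr_ell. exact IH.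
Qed.

Lemma periodic_bracket n (x : A) : periodic_elt n x <-> bracket n x = x.
Proof.
  unfold periodic_elt, bracket. replace (2 * n) with (n + n) by lia. rewrite Nat.iter_add.
  split; intros H.
  - rewrite H. apply iter_ell_rr.
  - rewrite <- H at 2. symmetry. apply iter_rr_ell.
Qed.
End Periodicity.

(** Jointly injective homomorphisms reflect equations and order. Inclusions of subalgebras and
    projections of products are both of this kind. *)
Lemma hom_joint_lpregroup (B : algebra) (I : Type) (A : I -> algebra) (h : forall i, B -> A i) :
  (forall i, is_hom B (A i) (h i)) -> (forall a b, (forall i, h i a = h i b) -> a = b) ->
  (forall i, is_lpregroup (A i)) -> is_lpregroup B.
Proof.
  intros Hh Hinj HA.
  assert (HL : forall a b, le a b <-> forall i, le (h i a) (h i b)).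
  { intros a b. unfold le. split.
    - intros H i. now rewrite <- (hom_meet _ _ _ (Hh i)), H.
    - intros H. apply Hinj. intros i. now rewrite (hom_meet _ _ _ (Hh i)). }
  assert (Hm := fun i => hom_meet _ _ _ (Hh i)). assert (Hj := fun i => hom_join _ _ _ (Hh i)).
  assert (Hu := fun i => hom_mul _ _ _ (Hh i)). assert (Ho := fun i => hom_one _ _ _ (Hh i)).
  assert (He := fun i => hom_ell _ _ _ (Hh i)). assert (Hr := fun i => hom_rr _ _ _ (Hh i)).
  split; [split|split| | | | |]; intros; try apply HL; try apply Hinj; intros i;
    rewrite ?Hu, ?Hm, ?Hj, ?Hm, ?Ho, ?He, ?Hr; pose proof (HA i) as hAi.
  - apply meetC, hAi.
  - apply meetA, hAi.
  - apply joinC, hAi.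
  - apply joinA, hAi.
  - apply meet_joinK, hAi.
  - apply join_meetK, hAi.
  - apply mulA, hAi.
  - apply mul_1_l.
  - apply mul_1_r.
  - rewrite HL in H, H0. now apply mul_mono.
  - apply ell_l.
  - apply ell_r.
  - apply rr_r.
  - apply rr_l.
Qed.

Lemma hom_joint_central_var n (B : algebra) (I : Type) (A : I -> algebra) (h : forall i, B -> A i) :
  (forall i, is_hom B (A i) (h i)) -> (forall a b, (forall i, h i a = h i b) -> a = b) ->
  (forall i, central_var n (A i)) -> central_var n B.
Proof.
  intros Hh Hinj HA. split; [split|].
  - apply (hom_joint_lpregroup B I A h Hh Hinj). intros i. apply (HA i).
  - intros x. apply Hinj. intros i. rewrite (hom_iter_ell _ (Hh i)), (hom_iter_rr _ (Hh i)).
    apply (HA i).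
  - intros x y. apply Hinj. intros i. rewrite !(hom_mul _ _ _ (Hh i)), (hom_power _ (Hh i)), (hom_sigma _ (Hh i)).
    apply (HA i).
Qed.

Lemma subalgebra_hom A P hP : is_hom (subalgebra A P hP) A (@proj1_sig A P).
Proof. split; reflexivity. Qed.

Lemma subset_ext {X : Type} {P : X -> Prop} (a b : {x | P x}) : proj1_sig a = proj1_sig b -> a = b.
Proof.
  destruct a as [a ha], b as [b hb]. cbn. intros <-. f_equal. apply proof_irrelevance.
Qed.

Lemma FnZ_lpregroup n : is_lpregroup (FnZ n).
Proof.
  apply (hom_joint_lpregroup (FnZ n) unit (fun _ => FZ) (fun _ => @proj1_sig _ _)).
  - intros _. apply subalgebra_hom.
  - intros a b H. apply subset_ext, (H tt).
  - intros _. exact FZ_lpregroup.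
Qed.

(** * [F_n(Z)] as monotone maps commuting with translation by [n] *)

Definition fz {n} (f : FnZ n) : Z -> Z := proj1_sig (proj1_sig f).

Lemma fz_ext {n} (f g : FnZ n) : (forall x, fz f x = fz g x) -> f = g.
Proof. intros H. apply subset_ext, FZ_ext, H. Qed.

Lemma fz_le {n} (f g : FnZ n) : f ≤ g <-> forall x, (fz f x <= fz g x)%Z.
Proof.
  unfold fz. rewrite <- FZ_leE. unfold le. split.
  - intros H. now rewrite <- H at 2.
  - intros H. apply subset_ext. exact H.
Qed.

Lemma fz_mono {n} (f : FnZ n) x y : (x <= y)%Z -> (fz f x <= fz f y)%Z.
Proof. apply (proj1 (proj2_sig (proj1_sig f))). Qed.

Lemma FZ_ell_le (f : FZ) q p : (proj1_sig (ell f) q <= p <-> q <= proj1_sig f p)%Z.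
Proof.
  destruct (FZ_ell_min _ (proj2_sig f) q) as [H1 H2]. cbv beta in *.
  change (proj1_sig (ell f) q) with (FZ_ell_fun _ (proj2_sig f) q). split; intros H.
  - pose proof (proj1 (proj2_sig f) _ _ H). lia.
  - now apply H2.
Qed.

(** On [Z] a strict inequality is a weak one shifted by [1], so two left adjoints amount to
    conjugation by that translation; [bracket_conj] is the abstract counterpart. *)
Lemma FZ_bracket (f : FZ) k x :
  proj1_sig (bracket k f) x = (proj1_sig f (x - Z.of_nat k) + Z.of_nat k)%Z.
Proof.
  assert (H : forall (f : FZ) x, proj1_sig (ell (ell f)) x = (proj1_sig f (x - 1) + 1)%Z).
  { clear. intros f x.
    assert (H : forall p, (proj1_sig (ell (ell f)) x <= p <-> proj1_sig f (x - 1) + 1 <= p)%Z).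
    { intros p. rewrite FZ_ell_le. pose proof (FZ_ell_le f p (x - 1)%Z). lia. }
    pose proof (H (proj1_sig (ell (ell f)) x)). pose proof (H (proj1_sig f (x - 1) + 1)%Z). lia. }
  revert x. induction k as [|k IH]; intros x.
  - cbn [Z.of_nat]. rewrite Z.sub_0_r, Z.add_0_r. reflexivity.
  - pose proof FZ_lpregroup. rewrite bracket_succ, H, IH.
    replace (x - 1 - Z.of_nat k)%Z with (x - Z.of_nat (S k))%Z by lia. lia.
Qed.

Lemma FZ_periodic n (f : FZ) :
  periodic_elt n f <-> forall x, proj1_sig f (x + Z.of_nat n)%Z = (proj1_sig f x + Z.of_nat n)%Z.
Proof.
  pose proof FZ_lpregroup as hF. rewrite periodic_bracket. split.
  - intros H x. rewrite <- H at 1. rewrite FZ_bracket. do 2 f_equal. lia.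
  - intros H. apply FZ_ext. intros x. rewrite FZ_bracket, <- H. f_equal. lia.
Qed.

Lemma shift_iter n (F : Z -> Z) :
  (forall x, F (x + Z.of_nat n) = F x + Z.of_nat n)%Z ->
  forall k x, (F (x + Z.of_nat n * k) = F x + Z.of_nat n * k)%Z.
Proof.
  intros H k x. revert k. apply Z.peano_ind.
  - rewrite Z.mul_0_r, !Z.add_0_r. reflexivity.
  - intros k IH. replace (x + Z.of_nat n * Z.succ k)%Z with (x + Z.of_nat n * k + Z.of_nat n)%Z by lia.
    rewrite H, IH. lia.
  - intros k IH. pose proof (H (x + Z.of_nat n * Z.pred k)%Z) as E.
    replace (x + Z.of_nat n * Z.pred k + Z.of_nat n)%Z with (x + Z.of_nat n * k)%Z in E by lia. lia.
Qed.

Lemma fz_shift {n} (f : FnZ n) k x : (fz f (x + Z.of_nat n * k) = fz f x + Z.of_nat n * k)%Z.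
Proof. apply shift_iter. apply FZ_periodic, (proj2_sig f). Qed.

Lemma FnZ_of_fun n (hn : 0 < n) (F : Z -> Z) :
  (forall x, F x <= F (x + 1))%Z -> (forall x, F (x + Z.of_nat n) = F x + Z.of_nat n)%Z ->
  exists f : FnZ n, forall x, fz f x = F x.
Proof.
  intros Hs Hper.
  assert (Hm : forall x y, (x <= y -> F x <= F y)%Z).
  { intros x y H. replace y with (x + Z.of_nat (Z.to_nat (y - x)))%Z by lia.
    induction (Z.to_nat (y - x)) as [|k IH]; [rewrite Z.add_0_r; lia|].
    specialize (Hs (x + Z.of_nat k)%Z).
    replace (x + Z.of_nat (S k))%Z with (x + Z.of_nat k + 1)%Z by lia. lia. }
  assert (HF : in_FZ F).
  { split; [exact Hm|]. intros x.
    (* [F p - p] differs from [F 0] by at most [n], so the fibre over [x] lies in this interval. *)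
    destruct (interval_list (x - F 0%Z - Z.of_nat n)%Z (x - F 0%Z + Z.of_nat n)%Z) as [s Hs'].
    exists s. intros p Hp. apply Hs'.
    pose proof (Z.div_mod p (Z.of_nat n) ltac:(lia)) as Hd.
    pose proof (Z.mod_pos_bound p (Z.of_nat n) ltac:(lia)) as Hb.
    set (k := (p / Z.of_nat n)%Z) in *.
    pose proof (shift_iter n F Hper k 0%Z) as E1.
    pose proof (shift_iter n F Hper (k + 1)%Z 0%Z) as E2.
    pose proof (Hm (0 + Z.of_nat n * k)%Z p ltac:(lia)).
    pose proof (Hm p (0 + Z.of_nat n * (k + 1))%Z ltac:(lia)). lia. }
  assert (HP : periodic_elt n (exist in_FZ F HF : FZ)) by now apply FZ_periodic.
  exists (exist _ (exist in_FZ F HF : FZ) HP). reflexivity.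
Qed.

Lemma FnZ_inv_translation n (u : FnZ n) : inv u -> exists k, forall x, fz u x = (x + k)%Z.
Proof.
  intros [H1 H2].
  assert (E1 : forall x, fz (ell u) (fz u x) = x).
  { intros x. exact (f_equal (fun f => fz f x) H1). }
  assert (E2 : forall x, fz u (fz (ell u) x) = x).
  { intros x. exact (f_equal (fun f => fz f x) H2). }
  assert (Hs : forall x, fz u (x + 1) = (fz u x + 1)%Z).
  { intros x. pose proof (fz_mono u x (x + 1) ltac:(lia)).
    pose proof (E1 x). pose proof (E1 (x + 1)%Z).
    assert (fz u x <> fz u (x + 1)).
    { intros E. pose proof (E1 x) as E'. rewrite E, E1 in E'. lia. }
    destruct (Z_lt_le_dec (fz u x + 1) (fz u (x + 1))) as [L|L]; [exfalso|lia].
    pose proof (fz_mono (ell u) (fz u x) (fz u x + 1) ltac:(lia)).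
    pose proof (fz_mono (ell u) (fz u x + 1) (fz u (x + 1)) ltac:(lia)).
    pose proof (E2 (fz u x + 1)%Z) as E.
    assert (D : (fz (ell u) (fz u x + 1) = x \/ fz (ell u) (fz u x + 1) = x + 1)%Z) by lia.
    destruct D as [D|D]; rewrite D in E; lia. }
  exists (fz u 0). intros x.
  pose proof (shift_iter 1 (fz u) Hs x 0%Z) as E. rewrite !Z.mul_1_l, Z.add_0_l in E. lia.
Qed.

Lemma FnZ_central_var n : 0 < n -> central_var n (FnZ n).
Proof.
  intros hn. pose proof (FnZ_lpregroup n) as hF.
  assert (hper : forall x : FnZ n, periodic_elt n x).
  { intros x. apply subset_ext.
    pose proof (subalgebra_hom FZ _ (periodic_subuniverse FZ FZ_lpregroup n)) as Hi.
    exact (eq_trans (hom_iter_ell _ Hi n x)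
             (eq_trans (proj2_sig x) (eq_sym (hom_iter_rr _ Hi n x)))). }
  split; [split; [exact hF | exact hper]|]. intros x y.
  assert (hp : forall x : FnZ n, bracket n x = x) by (intros; now apply periodic_bracket).
  destruct (FnZ_inv_translation n (sigma n y) (sigma_inv n hn hp y)) as [k Hk].
  assert (Hpow : forall m z, fz (power (sigma n y) m) z = (z + Z.of_nat m * k)%Z).
  { induction m as [|m IH]; intros z; [change (z = z + 0 * k)%Z; lia|].
    change (fz (sigma n y) (fz (power (sigma n y) m) z) = z + Z.of_nat (S m) * k)%Z.
    rewrite IH, Hk. lia. }
  apply fz_ext. intros z.
  change (fz x (fz (power (sigma n y) n) z) = fz (power (sigma n y) n) (fz x z)).
  rewrite !Hpow. apply fz_shift.
Qed.

(** * Terms and the values of their subterms *)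

Inductive term (X : Type) : Type :=
| tvar (x : X)
| tmeet (s u : term X)
| tjoin (s u : term X)
| tmul (s u : term X)
| tone
| tell (s : term X)
| trr (s : term X).
Arguments tvar {X} x. Arguments tmeet {X} s u. Arguments tjoin {X} s u.
Arguments tmul {X} s u. Arguments tone {X}. Arguments tell {X} s. Arguments trr {X} s.

Fixpoint eval {X : Type} {A : algebra} (e : X -> A) (s : term X) : A :=
  match s with
  | tvar x => e x
  | tmeet s u => meet (eval e s) (eval e u)
  | tjoin s u => join (eval e s) (eval e u)
  | tmul s u => mul (eval e s) (eval e u)
  | tone => one
  | tell s => ell (eval e s)
  | trr s => rr (eval e s)
  end.

Lemma hom_eval {X : Type} {A B : algebra} (h : A -> B) (e : X -> A) (s : term X) :
  is_hom A B h -> h (eval e s) = eval (fun x => h (e x)) s.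
Proof.
  intros [H1 H2 H3 H4 H5 H6]. induction s; cbn; rewrite ?H1, ?H2, ?H3, ?H4, ?H5, ?H6; congruence.
Qed.

Fixpoint subvalues {X : Type} {A : algebra} (e : X -> A) (s : term X) : list A :=
  eval e s ::
  match s with
  | tvar _ | tone => nil
  | tmeet s u | tjoin s u | tmul s u => subvalues e s ++ subvalues e u
  | tell s | trr s => subvalues e s
  end.

(** [ta_shift]: translation by a suitable representative of each coset of [Z t]
    commutes with the action. *)
Record translation_action (n : nat) (A : algebra) (G : ogroup) (t : G) (act : A -> G -> G) : Prop := {
  ta_t_pos : ole ozero t;
  ta_t_min : forall g, ole ozero g -> g <> ozero -> ole t g;
  ta_t_ne0 : t <> ozero;
  ta_mul : forall a b g, act (mul a b) g = act a (act b g);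
  ta_one : forall g, act one g = g;
  ta_le : forall a b g, le a b -> ole (act a g) (act b g);
  ta_mono : forall a g h, ole g h -> ole (act a g) (act a h);
  ta_meet : forall a b g, act (meet a b) g = act a g \/ act (meet a b) g = act b g;
  ta_join : forall a b g, act (join a b) g = act a g \/ act (join a b) g = act b g;
  ta_nt : forall a h, act a (oadd h (smul (Z.of_nat n) t)) = oadd (act a h) (smul (Z.of_nat n) t);
  ta_shift : forall g, exists k : Z, forall a h,
    act a (oadd h (oadd g (smul k t))) = oadd (act a h) (oadd g (smul k t))
}.

(** * From an action on an ordered group to [F_n(Z)] *)

Section Refute.
Context (n : nat) (hn : 0 < n) (A : algebra) (hA : is_lpregroup A) (G : ogroup) (t : G)
  (act : A -> G -> G) (ta : translation_action n A G t act).

Add Ring zg_ring_G : (@zg_ring G).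

Definition equivariant (g : G) : Prop := forall a h, act a (oadd h g) = oadd (act a h) g.

(** [F a x = τ (act a (x • t))] with [τ] from [exists_tau]. *)
Lemma exists_partial_hom (T : list A) : In one T -> exists F : A -> Z -> Z,
  (forall x, F one x = x) /\
  (forall a, In a T -> forall x, (F a x <= F a (x + 1))%Z) /\
  (forall a, In a T -> forall x, (F a (x + Z.of_nat n) = F a x + Z.of_nat n)%Z) /\
  (forall a b, In a T -> In b T -> forall x, F (mul a b) x = F a (F b x)) /\
  (forall a b, In a T -> In b T -> a ≤ b -> forall x, (F a x <= F b x)%Z) /\
  (forall a b, In a T -> In b T -> In (a ⊓ b) T -> forall x, F (a ⊓ b) x = Z.min (F a x) (F b x)) /\
  (forall a b, In a T -> In b T -> In (a ⊔ b) T -> forall x, F (a ⊔ b) x = Z.max (F a x) (F b x)) /\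
  (forall a b, In a T -> In b T -> ~ ole (act a ozero) (act b ozero) -> (F b 0 < F a 0)%Z).
Proof.
  intros H1T.
  assert (Esub : forall x y, equivariant x -> equivariant y -> equivariant (oadd x (oopp y))).
  { intros x y Hx Hy a h. rewrite oaddA.
    apply (oadd_cancel y). rewrite (oaddC _ y (act a _)), <- Hy, (oaddC _ y (oadd _ _)).
    replace (oadd (oadd (oadd h x) (oopp y)) y) with (oadd h x) by module.
    replace (oadd (oadd (act a h) (oadd x (oopp y))) y) with (oadd (act a h) x) by module. apply Hx. }
  assert (E0 : equivariant ozero) by (intros a h; now rewrite !oadd0r).
  assert (Ent : equivariant (smul (Z.of_nat n) t)) by (intros a h; apply ta).
  (* The range includes [n], since the step from [n - 1] to [n] must be monotone too; periodicity
     gives the rest. *)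
  set (xs := map Z.of_nat (seq 0 (S n))).
  assert (Hxs : forall r, (0 <= r <= Z.of_nat n)%Z -> In r xs).
  { intros r Hr. apply in_map_iff. exists (Z.to_nat r). split; [lia|]. apply in_seq. lia. }
  set (V := flat_map (fun a => map (fun x => act a (smul x t)) xs) T).
  assert (HV : forall a x, In a T -> In x xs -> In (act a (smul x t)) V).
  { intros a x Ha Hx. apply in_flat_map. exists a. split; [exact Ha|].
    apply in_map_iff. now exists x. }
  (* Including the differences makes [τ] strictly monotone on [V]. *)
  set (L := V ++ flat_map (fun v => map (fun w => oadd w (oopp v)) V) V).
  destruct (exists_tau t (ta_t_pos _ _ _ _ _ ta) (ta_t_min _ _ _ _ _ ta) (ta_t_ne0 _ _ _ _ _ ta)
              equivariant Esub E0 n L hn Ent (ta_shift _ _ _ _ _ ta))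
    as (H & τ & HL & Ht & Hadd & Hopp & τadd & τt & τE & τpos).
  assert (Et : forall q, equivariant (smul (Z.of_nat n * q) t)).
  { intros q. rewrite Z.mul_comm, smul_mul. now apply E_smul. }
  set (F := fun a x => τ (act a (smul x t))).
  assert (Hdm : forall x, exists r q, (0 <= r < Z.of_nat n)%Z /\ x = (r + Z.of_nat n * q)%Z).
  { intros x. exists (x mod Z.of_nat n)%Z, (x / Z.of_nat n)%Z.
    split; [apply Z.mod_pos_bound; lia|]. rewrite Z.add_comm. apply Z.div_mod. lia. }
  assert (Hshift : forall a x q, act a (smul (x + Z.of_nat n * q) t) =
            oadd (act a (smul x t)) (smul (Z.of_nat n * q) t)).
  { intros a x q. rewrite smul_add_l. apply Et. }
  assert (HVH : forall a x, In a T -> H (act a (smul x t))).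
  { intros a x Ha. destruct (Hdm x) as (r & q & Hr & ->). rewrite Hshift.
    apply Hadd; [|apply Ht]. apply HL, in_or_app. left. apply HV; [exact Ha|]. apply Hxs. lia. }
  assert (Fshift : forall a x q, In a T -> F a (x + Z.of_nat n * q)%Z = (F a x + Z.of_nat n * q)%Z).
  { intros a x q Ha. unfold F. rewrite Hshift, τadd, τt; auto. }
  assert (τsub : forall v w, In v V -> In w V -> H v -> H w -> ole v w ->
            (τ v <= τ w)%Z /\ (v <> w -> (τ v < τ w)%Z)).
  { intros v w Hv Hw Hv' Hw' Hvw.
    assert (Hd : In (oadd w (oopp v)) L).
    { apply in_or_app. right. apply in_flat_map. exists v. split; [exact Hv|].
      apply in_map_iff. now exists w. }
    pose proof (proj1 (ole_sub v w) Hvw) as Hd0.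
    destruct (τpos _ Hd Hd0) as [P1 P2].
    assert (E : τ w = (τ (oadd w (oopp v)) + τ v)%Z).
    { rewrite <- τadd; auto. f_equal. module. }
    split; [lia|]. intros Hne. enough (0 < τ (oadd w (oopp v)))%Z by lia. apply P2.
    intros E'. apply Hne. rewrite <- (oadd0 _ v), <- E'. module. }
  assert (Fcmp : forall a b r r', In a T -> In b T -> In r xs -> In r' xs ->
            ole (act a (smul r t)) (act b (smul r' t)) -> (F a r <= F b r')%Z).
  { intros a b r r' Ha Hb Hr Hr' Hle. apply τsub; auto. }
  assert (Fle : forall a b x, In a T -> In b T -> ole (act a (smul x t)) (act b (smul x t)) ->
            (F a x <= F b x)%Z).
  { intros a b x Ha Hb Hle. destruct (Hdm x) as (r & q & Hr & ->). rewrite !Fshift by assumption.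
    enough (F a r <= F b r)%Z by lia. apply Fcmp; trivial; try (apply Hxs; lia).
    rewrite !Hshift in Hle. apply (ole_shift _ _ (oopp (smul (Z.of_nat n * q) t))) in Hle.
    replace (oadd (oadd (act a (smul r t)) (smul (Z.of_nat n * q) t)) (oopp (smul (Z.of_nat n * q) t)))
      with (act a (smul r t)) in Hle by module.
    replace (oadd (oadd (act b (smul r t)) (smul (Z.of_nat n * q) t)) (oopp (smul (Z.of_nat n * q) t)))
      with (act b (smul r t)) in Hle by module. exact Hle. }
  exists F. repeat split.
  - intros x. unfold F. rewrite (ta_one _ _ _ _ _ ta). apply τt.
  - intros a Ha x. destruct (Hdm x) as (r & q & Hr & ->).
    replace (r + Z.of_nat n * q + 1)%Z with ((r + 1) + Z.of_nat n * q)%Z by lia.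
    rewrite !Fshift by assumption. enough (F a r <= F a (r + 1))%Z by lia.
    apply Fcmp; trivial; try (apply Hxs; lia). apply (ta_mono _ _ _ _ _ ta).
    apply smul_mono; [lia | apply ta].
  - intros a Ha x. pose proof (Fshift a x 1%Z Ha) as E. now rewrite !Z.mul_1_r in E.
  - intros a b Ha Hb x. unfold F. rewrite (ta_mul _ _ _ _ _ ta).
    set (v := act b (smul x t)). assert (Hv : H v) by now apply HVH.
    pose proof (τE v Hv) as Ev.
    (* The difference of [v] and [τ v] copies of [t] is equivariant and killed by [τ]; pulling it
       out of the action turns products into compositions. *)
    assert (E : act a v = oadd (act a (smul (τ v) t)) (oadd v (oopp (smul (τ v) t)))).
    { rewrite <- Ev. f_equal. module. }
    assert (Hd : H (oadd v (oopp (smul (τ v) t)))) by (apply Hadd; [exact Hv | apply Hopp, Ht]).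
    rewrite E, τadd by (trivial; now apply HVH).
    assert (E' : τ v = (τ (oadd v (oopp (smul (τ v) t))) + τ (smul (τ v) t))%Z).
    { rewrite <- τadd by (trivial; apply Ht). f_equal. module. }
    rewrite τt in E'. lia.
  - intros a b Ha Hb Hab x. apply Fle; trivial. now apply (ta_le _ _ _ _ _ ta).
  - intros a b Ha Hb Hab x.
    pose proof (Fle (a ⊓ b) a x Hab Ha (ta_le _ _ _ _ _ ta _ _ _ (meet_l a b))).
    pose proof (Fle (a ⊓ b) b x Hab Hb (ta_le _ _ _ _ _ ta _ _ _ (meet_r a b))).
    destruct (ta_meet _ _ _ _ _ ta a b (smul x t)) as [E|E];
      apply (f_equal τ) in E; change (F (a ⊓ b) x = F a x) in E || change (F (a ⊓ b) x = F b x) in E; lia.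
  - intros a b Ha Hb Hab x.
    pose proof (Fle a (a ⊔ b) x Ha Hab (ta_le _ _ _ _ _ ta _ _ _ (join_l a b))).
    pose proof (Fle b (a ⊔ b) x Hb Hab (ta_le _ _ _ _ _ ta _ _ _ (join_r a b))).
    destruct (ta_join _ _ _ _ _ ta a b (smul x t)) as [E|E];
      apply (f_equal τ) in E; change (F (a ⊔ b) x = F a x) in E || change (F (a ⊔ b) x = F b x) in E; lia.
  - intros a b Ha Hb Hab.
    assert (Hx0 : In 0%Z xs) by (apply Hxs; lia).
    destruct (ole_total G (act b ozero) (act a ozero)) as [Hle|Hle]; [|contradiction].
    apply (τsub (act b (smul 0 t)) (act a (smul 0 t))); auto.
    intros E. apply Hab. change (smul 0 t) with (@ozero G) in E. rewrite E. apply ole_refl.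
Qed.

Lemma refute_in_FnZ (X : Type) (e : X -> A) (s u : term X) :
  ~ ole (act (eval e s) ozero) (act (eval e u) ozero) ->
  exists e' : X -> FnZ n, eval e' s <> eval e' u.
Proof.
  intros Hsu. pose proof (FnZ_lpregroup n) as hF.
  set (T0 := subvalues e s ++ subvalues e u).
  (* With these products in [T], the inequalities characterizing residuals transfer to [F_n(Z)], and
     uniqueness of residuals shows that [ell] and [rr] are respected. *)
  set (T := one :: T0 ++ flat_map (fun b => (ell b ∙ b) :: (b ∙ ell b) :: (rr b ∙ b) :: (b ∙ rr b) :: nil) T0).
  destruct (exists_partial_hom T) as (F & F1 & Fstep & Fper & Fmul & Fle & Fmeet & Fjoin & Flt);
    [now left|].
  assert (Hincl : forall a, In a T0 -> In a T) by (intros a Ha; right; apply in_or_app; now left).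
  assert (Hres : forall a b, In b T0 -> In a ((ell b ∙ b) :: (b ∙ ell b) :: (rr b ∙ b) :: (b ∙ rr b) :: nil) -> In a T).
  { intros a b Hb Ha. right. apply in_or_app. right. apply in_flat_map. now exists b. }
  assert (HΦ : forall a, exists f : FnZ n, In a T -> forall x, fz f x = F a x).
  { intros a. destruct (classic (In a T)) as [Ha|Ha]; [|exists one; contradiction].
    destruct (FnZ_of_fun n hn (F a) (Fstep a Ha) (Fper a Ha)) as [f Hf]. exists f. auto. }
  set (Φ := fun a => proj1_sig (constructive_indefinite_description _ (HΦ a))).
  assert (ΦE : forall a, In a T -> forall x, fz (Φ a) x = F a x).
  { intros a. exact (proj2_sig (constructive_indefinite_description _ (HΦ a))). }
  assert (Heval : forall r, (forall a, In a (subvalues e r) -> In a T0) ->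
            eval (fun x => Φ (e x)) r = Φ (eval e r)).
  { assert (Hhead : forall r, In (eval e r) (subvalues e r)) by (intros r; destruct r; now left).
    induction r as [x|r1 IH1 r2 IH2|r1 IH1 r2 IH2|r1 IH1 r2 IH2| |r IH|r IH]; intros Hr.
    1: reflexivity.
    1-3: assert (Hr1 : forall a, In a (subvalues e r1) -> In a T0)
           by (intros a Ha; apply Hr; cbn; right; apply in_or_app; now left);
         assert (Hr2 : forall a, In a (subvalues e r2) -> In a T0)
           by (intros a Ha; apply Hr; cbn; right; apply in_or_app; now right);
         cbn [eval]; rewrite IH1, IH2 by assumption;
         pose proof (Hincl _ (Hr1 _ (Hhead r1))) as M1;
         pose proof (Hincl _ (Hr2 _ (Hhead r2))) as M2;
         pose proof (Hincl _ (Hr _ (Hhead _))) as M; cbn [eval] in M;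
         apply fz_ext; intros x; rewrite ΦE by exact M.
    - rewrite Fmeet by assumption. rewrite <- !ΦE by assumption. reflexivity.
    - rewrite Fjoin by assumption. rewrite <- !ΦE by assumption. reflexivity.
    - rewrite Fmul by assumption. rewrite <- !ΦE by assumption. reflexivity.
    - cbn [eval]. apply fz_ext. intros x. rewrite ΦE by now left. now rewrite F1.
    - assert (Hr1 : forall a, In a (subvalues e r) -> In a T0)
        by (intros a Ha; apply Hr; cbn; now right).
      cbn [eval]. rewrite IH by exact Hr1.
      pose proof (Hincl _ (Hr1 _ (Hhead r))) as M1.
      pose proof (Hincl _ (Hr _ (Hhead _))) as M. cbn [eval] in M.
      set (b := eval e r) in *. symmetry. apply ell_uniq; [exact hF| |]; apply fz_le; intros x.
      + change (fz (Φ (ell b)) (fz (Φ b) x) <= x)%Z. rewrite !ΦE, <- Fmul by assumption.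
        rewrite <- (F1 x) at 2. apply Fle; [|now left | apply ell_l].
        apply (Hres _ b); [now apply Hr1, Hhead | cbn; auto].
      + change (x <= fz (Φ b) (fz (Φ (ell b)) x))%Z. rewrite !ΦE, <- Fmul by assumption.
        rewrite <- (F1 x) at 1. apply Fle; [now left | | apply ell_r].
        apply (Hres _ b); [now apply Hr1, Hhead | cbn; auto].
    - assert (Hr1 : forall a, In a (subvalues e r) -> In a T0)
        by (intros a Ha; apply Hr; cbn; now right).
      cbn [eval]. rewrite IH by exact Hr1.
      pose proof (Hincl _ (Hr1 _ (Hhead r))) as M1.
      pose proof (Hincl _ (Hr _ (Hhead _))) as M. cbn [eval] in M.
      set (b := eval e r) in *. symmetry. apply rr_uniq; [exact hF| |]; apply fz_le; intros x.
      + change (fz (Φ b) (fz (Φ (rr b)) x) <= x)%Z. rewrite !ΦE, <- Fmul by assumption.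
        rewrite <- (F1 x) at 2. apply Fle; [|now left | apply rr_r].
        apply (Hres _ b); [now apply Hr1, Hhead | cbn; auto].
      + change (x <= fz (Φ (rr b)) (fz (Φ b) x))%Z. rewrite !ΦE, <- Fmul by assumption.
        rewrite <- (F1 x) at 1. apply Fle; [now left | | apply rr_l].
        apply (Hres _ b); [now apply Hr1, Hhead | cbn; auto]. }
  assert (Hs : forall a, In a (subvalues e s) -> In a T0) by (intros; apply in_or_app; now left).
  assert (Hu : forall a, In a (subvalues e u) -> In a T0) by (intros; apply in_or_app; now right).
  assert (Hhead : forall r, In (eval e r) (subvalues e r)) by (intros r; destruct r; now left).
  exists (fun x => Φ (e x)). rewrite !Heval by assumption. intros E.
  assert (Ms : In (eval e s) T) by auto. assert (Mu : In (eval e u) T) by auto.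
  pose proof (Flt _ _ Ms Mu Hsu) as Hlt.
  rewrite <- (ΦE _ Ms), <- (ΦE _ Mu), E in Hlt. lia.
Qed.

End Refute.

(** * The action on the ordered group of invertible elements *)

Section Actions.
Context {A : algebra} {hA : is_lpregroup A} (n : nat) (hn : 0 < n).
Hypothesis hp : forall x : A, bracket n x = x.
Hypothesis hc : forall x y : A, x ∙ power (sigma n y) n = power (sigma n y) n ∙ x.
Context (p : A -> Prop).
Hypothesis pf : prime_filter p.
Hypothesis red : reduced p.
Implicit Types a b f x w : A.
Notation "x ⊑ y" := (ptle p x y) (at level 70, no associativity).
#[local] Instance ptle_preorder' : PreOrder (ptle p) := ptle_preorder p.

Let tot2 := inv_total2 n hn hp hc p pf red.
Let comm := inv_commute n hn hp hc p pf red.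
Let free := inv_free n hn hp hc p pf red.
Let lept := inv_ptle n hn hp hc p pf red.

Lemma bigjoin_attained (F : nat -> A) k x : exists j, j <= k /\ bigjoin F k ∙ x ⊑ F j ∙ x.
Proof.
  induction k as [|k (j & Hj & H)]; [exists 0; split; [lia | cbn; reflexivity]|].
  cbn [bigjoin]. destruct (ptle_total p pf (bigjoin F k ∙ x) (F (S k) ∙ x)) as [H1|H1].
  - exists (S k). split; [lia|]. rewrite mul_join_r. now apply ptle_join.
  - exists j. split; [lia|]. rewrite mul_join_r. apply ptle_join; trivial.
    now transitivity (bigjoin F k ∙ x).
Qed.

(** [t] is the join of the brackets of a bump, and at each point a single bracket attains it. If [w]
    were strictly between [x] and [t ∙ x], the brackets attaining [t] at [x] and at [w] would
    differ; being disjoint, one of them would not move [w]. For the one at [w] this contradicts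
    freeness, for the one at [x] it gives [t ∙ x ⊑ w]. *)
Lemma exists_successor : (exists b, ~ inv b) -> exists t, inv t /\ 𝟙 ≤ t /\ ~ t ≤ 𝟙 /\
  forall x w, x ⊑ w -> w ⊑ t ∙ x -> w ⊑ x \/ t ∙ x ⊑ w.
Proof.
  intros [b Hb].
  (* If [rr b ∙ b] and [rr (rr b) ∙ rr b] are both trivial, then [rr (rr b) = b], and [rr b] is a
     two-sided inverse of [b]. *)
  assert (Hf : exists f, rr f ∙ f <> 𝟙).
  { destruct (classic (rr b ∙ b = 𝟙)) as [E1|]; [|now exists b].
    destruct (classic (rr (rr b) ∙ rr b = 𝟙)) as [E2|]; [|now exists (rr b)].
    exfalso. apply Hb.
    assert (E : rr (rr b) = b).
    { now rewrite <- (mul_1_r (rr (rr b))), <- E1, <- mul_assoc, E2, mul_1_l. }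
    rewrite E in E2. apply (inv_intro b (rr b) E2 E1). }
  destruct Hf as [f Hf]. set (s := rr f ∙ f) in *.
  assert (Hs : 𝟙 ≤ s) by apply rr_l.
  assert (Hfs : f ∙ s = f).
  { unfold s. apply anti.
    - rewrite <- mul_assoc, rr_r, mul_1_l. reflexivity.
    - transitivity (f ∙ 𝟙); [now rewrite mul_1_r|]. apply mul_mono; [reflexivity | apply rr_l]. }
  destruct (exists_bump n hn hp s Hs Hf (sigma_fix_one n hn hp f s Hs Hfs))
    as (r & m & hm & Hr & _ & Hr1 & Hper & Horth).
  set (t := bump_t r m).
  assert (Ht : inv t) by now apply t_inv.
  assert (Htp : 𝟙 ≤ t) by now apply t_pos.
  assert (Ht1 : ~ t ≤ 𝟙).
  { intros H. apply Hr1, anti; [|exact Hr]. rewrite <- H. now apply r_le_t. }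
  exists t. repeat split; trivial; try apply Ht.
  intros x w Hxw Hwt. apply NNPP. intros Hno. apply not_or_and in Hno. destruct Hno as [N1 N2].
  destruct (bigjoin_attained (fun j => bracket j r) (m - 1) x) as (j & Hj & Hjx).
  destruct (bigjoin_attained (fun j => bracket j r) (m - 1) w) as (i & Hi & Hiw).
  fold (bump_t r m) in Hjx, Hiw. fold t in Hjx, Hiw. cbv beta in Hjx, Hiw.
  assert (Hjw : bracket j r ∙ w ⊑ t ∙ x).
  { transitivity (bracket j r ∙ bracket j r ∙ x).
    - apply ptle_mul. now transitivity (t ∙ x).
    - apply ptle_le; [exact pf|]. rewrite <- mul_assoc, R_R by eassumption.
      apply mul_mono; [apply R_le_t; trivial; lia | reflexivity]. }
  destruct (Nat.eq_dec i j) as [->|Hij].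
  - apply N1. apply (ptle_cancel p t); [exact Ht|]. now transitivity (bracket j r ∙ w).
  - assert (Eij : bracket i r ⊓ bracket j r = 𝟙).
    { destruct (Nat.lt_total i j) as [L|[L|L]]; [|contradiction|].
      - apply (R_orth r m); trivial; lia.
      - rewrite meet_comm. apply (R_orth r m); trivial; lia. }
    assert (Hw : bracket i r ∙ w ⊑ w \/ bracket j r ∙ w ⊑ w).
    { destruct (ptle_total p pf (bracket i r ∙ w) (bracket j r ∙ w)) as [L|L]; [left|right];
        (transitivity ((bracket i r ∙ w) ⊓ (bracket j r ∙ w));
          [apply ptle_meet; trivial; reflexivity|]);
        rewrite <- mul_meet_r, Eij, mul_1_l; reflexivity. }
    destruct Hw as [Hw|Hw].
    + apply Ht1, free with w; [exact Ht|]. now transitivity (bracket i r ∙ w).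
    + apply N2. transitivity (bracket j r ∙ x); [exact Hjx|].
      transitivity (bracket j r ∙ w); [now apply ptle_mul | exact Hw].
Qed.

Definition U : Type := {u : A | inv u}.

Lemma U_ext (u v : U) : proj1_sig u = proj1_sig v -> u = v.
Proof. apply subset_ext. Qed.

Definition Umul (u v : U) : U := exist _ _ (inv_mul _ _ (proj2_sig u) (proj2_sig v)).
Definition Uopp (u : U) : U := exist _ _ (inv_ell _ (proj2_sig u)).
Definition Uone : U := exist _ _ inv_1.

Definition U_ogroup : ogroup.
Proof.
  refine {| ocar := U; oadd := Umul; oopp := Uopp; ozero := Uone;
            ole := fun u v : U => proj1_sig u ≤ proj1_sig v |}.
  - intros. apply U_ext. symmetry. apply mul_assoc.
  - intros [u Hu] [v Hv]. apply U_ext. now apply comm.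
  - intros. apply U_ext, mul_1_l.
  - intros [u Hu]. apply U_ext, Hu.
  - intros u v w H1 H2. now transitivity (proj1_sig v).
  - intros u v H1 H2. now apply U_ext, anti.
  - intros [u Hu] [v Hv]. now apply tot2.
  - intros u v w H. now apply mul_mono.
Defined.

(** Lexicographic product with [U] dominant: [Z] supplies the least positive element that [U] may
    lack. *)
Definition UZ_ogroup : ogroup.
Proof.
  refine {| ocar := (U * Z)%type;
            oadd := fun g h : U * Z => (Umul (fst g) (fst h), (snd g + snd h)%Z);
            oopp := fun g : U * Z => (Uopp (fst g), (- snd g)%Z);
            ozero := (Uone, 0%Z);
            ole := fun g h : U * Z => proj1_sig (fst g) ≤ proj1_sig (fst h) /\
              (proj1_sig (fst h) ≤ proj1_sig (fst g) -> (snd g <= snd h)%Z) |}.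
  - intros [u i] [v j] [w k]; cbn. f_equal; [apply (oaddA U_ogroup) | lia].
  - intros [u i] [v j]; cbn. f_equal; [apply (oaddC U_ogroup) | lia].
  - intros [u i]; cbn. f_equal; apply (oadd0 U_ogroup).
  - intros [u i]; cbn. f_equal; [apply (oaddN U_ogroup) | lia].
  - intros [u i] [v j] [w k]; cbn. intros [H1 H2] [H3 H4]. split; [now transitivity (proj1_sig v)|].
    intros H. transitivity j; [apply H2 | apply H4].
    + now transitivity (proj1_sig w).
    + now transitivity (proj1_sig u).
  - intros [u i] [v j]; cbn. intros [H1 H2] [H3 H4]. f_equal; [now apply U_ext, anti|].
    specialize (H2 H3). specialize (H4 H1). lia.
  - intros [[u Hu] i] [[v Hv] j]; cbn.
    destruct (classic (u ≤ v)) as [H1|H1], (classic (v ≤ u)) as [H2|H2].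
    + destruct (Z.le_ge_cases i j); [left|right]; auto.
    + left. now split.
    + right. now split.
    + destruct (tot2 u v Hu Hv); contradiction.
  - intros [[u Hu] i] [[v Hv] j] [[w Hw] k]; cbn. intros [H1 H2]. split; [now apply mul_mono|].
    intros H. apply inv_cancel_l in H; [|exact Hw]. specialize (H2 H). lia.
Defined.

Lemma group_action : (forall b, inv b) ->
  exists (G : ogroup) (t : G) (act : A -> G -> G), translation_action n A G t act /\
    forall a b, ole (act a ozero) (act b ozero) -> a ⊑ b.
Proof.
  intros Hinv.
  exists UZ_ogroup, (Uone, 1%Z), (fun a g => (Umul (exist _ a (Hinv a)) (fst g), snd g)).
  assert (Eq : forall a (h g : UZ_ogroup),
     (Umul (exist _ a (Hinv a)) (fst (oadd h g)), snd (oadd h g)) =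
     oadd ((Umul (exist _ a (Hinv a)) (fst h), snd h) : UZ_ogroup) g).
  { intros a h g. cbn. f_equal. apply (oaddA U_ogroup). }
  split; [split|].
  - split; cbn; [reflexivity | lia].
  - intros [[u Hu] i]. cbn. intros [H1 H2] Hne. split; [exact H1|]. intros H3.
    specialize (H2 H3). assert (i <> 0%Z); [|lia]. intros ->. apply Hne. f_equal.
    apply U_ext. now apply anti.
  - intros H. apply (f_equal snd) in H. discriminate H.
  - intros a b [[u Hu] i]. cbn. f_equal. apply U_ext, mul_assoc.
  - intros [[u Hu] i]. cbn. f_equal. apply U_ext, mul_1_l.
  - intros a b [[u Hu] i] H. cbn. split; [now apply mul_mono | lia].
  - intros a [[u Hu] i] [[v Hv] j] [H1 H2]. cbn in *. split; [now apply mul_mono|].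
    intros H. apply H2. now apply (inv_cancel_l a).
  - intros a b [[u Hu] i]. cbn. destruct (tot2 a b (Hinv a) (Hinv b)) as [H|H].
    + left. f_equal. apply U_ext. cbn. now rewrite (meet_eq_l a b H).
    + right. f_equal. apply U_ext. cbn. now rewrite meet_comm, (meet_eq_l b a H).
  - intros a b [[u Hu] i]. cbn. destruct (tot2 a b (Hinv a) (Hinv b)) as [H|H].
    + right. f_equal. apply U_ext. cbn. now rewrite (join_eq_r a b H).
    + left. f_equal. apply U_ext. cbn. now rewrite join_comm, (join_eq_r b a H).
  - intros a h. apply Eq.
  - intros g. exists 0%Z. intros a h. apply Eq.
  - intros a b [H _]. cbn in H. rewrite !mul_1_r in H. now apply ptle_le.
Qed.

(** Each point is equivalent to exactly one invertible element, by [exists_nu] and [inv_ptle]; the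
    action on points is transported to [U] along this correspondence [ν]. *)
Lemma nongroup_action : (exists b, ~ inv b) ->
  exists (G : ogroup) (t : G) (act : A -> G -> G), translation_action n A G t act /\
    forall a b, ole (act a ozero) (act b ozero) -> a ⊑ b.
Proof.
  intros Hb. destruct (exists_successor Hb) as (t & Ht & Htp & Ht1 & Hcov).
  pose proof (exists_nu n hn hp hc p pf red t Ht Htp Ht1 Hcov) as Hν.
  set (ν := fun f => exist _ _ (proj1 (proj2_sig (constructive_indefinite_description _ (Hν f)))) : U).
  assert (ν1 : forall f, f ⊑ proj1_sig (ν f)).
  { intros f. apply (proj2_sig (constructive_indefinite_description _ (Hν f))). }
  assert (ν2 : forall f, proj1_sig (ν f) ⊑ f).
  { intros f. apply (proj2_sig (constructive_indefinite_description _ (Hν f))). }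
  clearbody ν.
  assert (le1 : forall u v, inv u -> inv v -> u ⊑ v -> u ≤ v).
  { intros u v Hu Hv H. apply lept with 𝟙; trivial. now rewrite !mul_1_r. }
  assert (νle : forall f g, f ⊑ g -> proj1_sig (ν f) ≤ proj1_sig (ν g)).
  { intros f g H. apply le1; [apply (proj2_sig (ν f)) | apply (proj2_sig (ν g)) |].
    transitivity f; [apply ν2|]. transitivity g; [exact H | apply ν1]. }
  assert (νeq : forall f g, f ⊑ g -> g ⊑ f -> ν f = ν g).
  { intros f g H1 H2. apply U_ext, anti; now apply νle. }
  assert (νU : forall u : U, ν (proj1_sig u) = u).
  { intros u. apply U_ext, anti; apply le1; try apply (proj2_sig (ν (proj1_sig u)));
      try apply (proj2_sig u); [apply ν2 | apply ν1]. }
  assert (νmul : forall u : U, forall f, ν (proj1_sig u ∙ f) = Umul u (ν f)).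
  { intros u f. rewrite <- (νU (Umul u (ν f))). cbn. apply νeq; now apply ptle_mul. }
  set (tU := exist _ t Ht : U_ogroup).
  assert (Hpow : forall k : nat, proj1_sig (smul (Z.of_nat k) tU : U_ogroup) = power t k).
  { intros k. rewrite smul_of_nat. induction k as [|k IH]; [reflexivity|].
    rewrite Nat.iter_succ, power_S, <- IH. reflexivity. }
  exists U_ogroup, tU, (fun a g => ν (a ∙ proj1_sig g)).
  (* A central element passes through [a], so its translation commutes with the action;
     [central_translate] provides one in each coset of the powers of [t]. *)
  assert (Hcen : forall a (h g : U_ogroup), central (proj1_sig g) ->
            ν (a ∙ proj1_sig (oadd h g)) = oadd (ν (a ∙ proj1_sig h) : U_ogroup) g).
  { intros a h g Hg. rewrite (oaddC U_ogroup (ν _)). rewrite <- (νmul g).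
    cbn. now rewrite (Hg (a ∙ proj1_sig h)), mul_assoc. }
  split; [split|].
  - exact Htp.
  - intros [g Hg] H1 H2. apply le1; trivial. change (t ⊑ g). rewrite <- (mul_1_r t).
    apply (t_step p pf t); trivial. intros H. apply H2, U_ext. cbn.
    apply anti; [|exact H1]. apply free with 𝟙; [exact Hg|]. now rewrite mul_1_r.
  - intros E. apply Ht1. apply (f_equal (@proj1_sig _ _)) in E. cbn in E. rewrite E. reflexivity.
  - intros a b g. rewrite mul_assoc. apply νeq; apply ptle_mul; [apply ν1 | apply ν2].
  - intros g. rewrite mul_1_l. apply νU.
  - intros a b g H. apply νle, ptle_le; [exact pf|]. now apply mul_mono.
  - intros a g h H. apply νle, ptle_mul, ptle_le; [exact pf | exact H].
  - intros a b g. rewrite mul_meet_r.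
    destruct (ptle_total p pf (a ∙ proj1_sig g) (b ∙ proj1_sig g)) as [H|H]; [left|right];
      (apply νeq; [apply ptle_le; trivial; (apply meet_l || apply meet_r) |
                   apply ptle_meet; trivial; reflexivity]).
  - intros a b g. rewrite mul_join_r.
    destruct (ptle_total p pf (a ∙ proj1_sig g) (b ∙ proj1_sig g)) as [H|H]; [right|left];
      (apply νeq; [apply ptle_join; trivial; reflexivity |
                   apply ptle_le; trivial; (apply join_l || apply join_r)]).
  - intros a h. apply Hcen. rewrite Hpow. now apply (power_central n hn hp hc).
  - intros g. destruct (central_translate n hn hp hc p pf red t Ht Htp Ht1 Hcov (proj1_sig g) (proj2_sig g))
      as (k & _ & Hk).
    exists (Z.of_nat k). intros a h. apply Hcen. cbn [oadd U_ogroup Umul proj1_sig].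
    rewrite Hpow. exact Hk.
  - intros a b H. cbn in H. rewrite !mul_1_r in H.
    transitivity (proj1_sig (ν a)); [apply ν1|]. transitivity (proj1_sig (ν b)); [|apply ν2].
    now apply ptle_le.
Qed.

End Actions.

(** * Identities of [F_n(Z)] and the generated variety *)

Lemma central_var_identity (n : nat) (hn : 0 < n) (A : algebra) (hA : central_var n A)
  (X : Type) (e : X -> A) (s u : term X) :
  (forall e' : X -> FnZ n, eval e' s = eval e' u) -> eval e s ≤ eval e u.
Proof.
  intros Hid. apply NNPP. intros Hsu.
  pose proof hA as [[hlp hper] hc].
  assert (hp : forall x : A, bracket n x = x) by (intros; now apply periodic_bracket).
  destruct (exists_prime_filter (eval e s) (eval e u) (meet_join_distr n hn hp) Hsu)
    as (p & pf & Hs & Hu).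
  destruct (exists_reduced_quotient n A p hA pf) as (B & h & q & Hh & HB & qf & red & Hq).
  destruct HB as [[hB hperB] hcB].
  assert (hpB : forall x : B, bracket n x = x) by (intros; now apply periodic_bracket).
  assert (Hact : exists (G : ogroup) (t : G) (act : B -> G -> G), translation_action n B G t act /\
            forall a b, ole (act a ozero) (act b ozero) -> ptle q a b).
  { destruct (classic (exists b : B, ~ inv b)) as [Hb|Hb].
    - now apply nongroup_action.
    - apply group_action; trivial. intros b. apply NNPP. intros H. apply Hb. now exists b. }
  destruct Hact as (G & t & act & ta & Hle).
  destruct (refute_in_FnZ n hn B hB G t act ta X (fun x => h (e x)) s u) as [e' He'].
  - rewrite <- !(hom_eval h e _ Hh). intros H. apply Hle in H. specialize (H one).
    rewrite !mul_1_l in H. apply Hu, Hq, H, Hq, Hs.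
  - now apply He', Hid.
Qed.

Lemma central_var_is_variety n : is_variety (central_var n).
Proof.
  split.
  - intros A B h Hh Hs. now apply hom_image_central_var with h.
  - intros A P hP HA.
    apply (hom_joint_central_var n (subalgebra A P hP) unit (fun _ => A) (fun _ => @proj1_sig A P)); trivial.
    + intros _. apply subalgebra_hom.
    + intros a b H. apply subset_ext, (H tt).
  - intros I A HA.
    apply (hom_joint_central_var n (product I A) I A (fun i a => a i)); trivial.
    + intros i. split; reflexivity.
    + intros a b H. now apply functional_extensionality_dep.
Qed.

(** Birkhoff: [A] is a quotient of the term functions on [K], which form a subalgebra
    of a power of [K]. *)
Lemma generated_of_identities (K A : algebra) :
  (forall s u : term A, (forall e : A -> K, eval e s = eval e u) ->
     eval (fun a => a) s = eval (fun a => a) u) ->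
  generated_variety (fun B => B = K) A.
Proof.
  intros Hid V HV HK. specialize (HK K eq_refl).
  set (W := product (A -> K) (fun _ => K)).
  set (P := fun w : W => exists s : term A, w = fun e => eval e s).
  assert (hP : subuniverse W P).
  { split.
    - intros a b [s ->] [u ->]. now exists (tmeet s u).
    - intros a b [s ->] [u ->]. now exists (tjoin s u).
    - intros a b [s ->] [u ->]. now exists (tmul s u).
    - now exists tone.
    - intros a [s ->]. now exists (tell s).
    - intros a [s ->]. now exists (trr s). }
  set (S := subalgebra W P hP).
  set (rep := fun w : S => proj1_sig (constructive_indefinite_description _ (proj2_sig w))).
  assert (Hrep : forall (w : S) e, proj1_sig w e = eval e (rep w)).
  { intros w e. unfold rep. destruct (constructive_indefinite_description _ _) as [s Hs].
    exact (f_equal (fun f => f e) Hs). }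
  set (h := fun w : S => eval (fun a : A => a) (rep w)).
  assert (Hh : forall (w : S) s, (forall e, proj1_sig w e = eval e s) -> h w = eval (fun a => a) s).
  { intros w s H. apply Hid. intros e. now rewrite <- Hrep. }
  apply (variety_H V HV S A h).
  - split; intros.
    + apply (Hh _ (tmeet (rep a) (rep b))). intros e. cbn. now rewrite <- !Hrep.
    + apply (Hh _ (tjoin (rep a) (rep b))). intros e. cbn. now rewrite <- !Hrep.
    + apply (Hh _ (tmul (rep a) (rep b))). intros e. cbn. now rewrite <- !Hrep.
    + apply (Hh _ tone). intros e. reflexivity.
    + apply (Hh _ (tell (rep a))). intros e. cbn. now rewrite <- !Hrep.
    + apply (Hh _ (trr (rep a))). intros e. cbn. now rewrite <- !Hrep.
  - intros a. assert (Pa : P (fun e => e a)) by now exists (tvar a).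
    exists (exist _ (fun e => e a : K) Pa : S). now apply (Hh _ (tvar a)).
  - apply (variety_S V HV), (variety_P V HV). intros _. exact HK.
Qed.

Theorem theorem6p10 (n : nat) (hn : 0 < n) (A : algebra) :
  generated_variety (fun B : algebra => B = FnZ n) A <->
  LP n A /\
  forall x y : A, mul x (power (sigma n y) n) = mul (power (sigma n y) n) x.
Proof.
  split.
  - intros H. apply (H (central_var n) (central_var_is_variety n)).
    intros B ->. now apply FnZ_central_var.
  - intros H. apply generated_of_identities. intros s u Hsu.
    pose proof (proj1 (proj1 H)) as hA.
    apply anti; apply (central_var_identity n hn A H); auto.
Qed.
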